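(* Let $(M,g)$ be a Riemann-Lorentz space with polar end $D^{\infty}$, $\dim M=m$. Around each point of $D^\infty$ there exists a coordinate system $(z^1,\dots,z^{m-1},z^m)$ of $M$, with domain $U$, such that on $U-D^\infty$ $$g(\partial_{z^i},\partial_{z^m})=0\ \ (1\le i\le m-1),\qquad g(\partial_{z^m},\partial_{z^m})=\frac{1}{z^m}.$$
   Context: Riemann-Lorentz space with polar end: $M$ is a smooth manifold of dimension $m\ge 2$, $D^\infty\subset M$ is a nonempty closed subset, and $g$ is a smooth nondegenerate symmetric $(0,2)$-tensor field on $M-D^\infty$. The dual metric $g^*$ on $T^*(M-D^\infty)$ is $g^*(\alpha,\beta)=g(X_\alpha,X_\beta)$, where $g(X_\alpha,\cdot)=\alpha$. It is required that: (D1) $g^*$ extends smoothly to all of $M$ (extension still denoted $g^*$), and for every coframe $(\theta^1,\dots,\theta^m)$ on an open set $U$ meeting $D^\infty$ one has $U\cap D^\infty=\{x\in U:\det(g^*(\theta^a,\theta^b))|_x=0\}$ and $d_x\det(g^*(\theta^a,\theta^b))\neq0$ for all $x\in U\cap D^\infty$ (so $D^\infty$ is a hypersurface and the radical $\mathrm{Rad}_p(g^* )\subset T_p^*M$ is one-dimensional for $p\in D^\infty$); (D2) for every $p\in D^\infty$ the annihilator $\{X\in T_pM:\mu(X)=0\ \forall\mu\in \mathrm{Rad}_p(g^* )\}$ equals $T_pD^\infty$; (RL) every connected component of $M-D^\infty$ is either Riemannian or Lorentzian (one minus sign) for $g$. *)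

(* Defs.v *)
From HB Require Import structures.
From mathcomp Require Import all_boot all_order all_algebra.
From mathcomp Require Import boolp classical_sets functions cardinality reals.
From mathcomp Require Import topology normedtype derive.

Set Implicit Arguments.
Unset Strict Implicit.
Unset Printing Implicit Defensive.
Import Order.TTheory GRing.Theory Num.Theory.
Import numFieldNormedType.Exports.

Local Open Scope classical_set_scope.
Local Open Scope ring_scope.

(* C^infinity on an open set U: all iterated directional derivatives of f exist
   and are (Frechet) differentiable at every point of U.  In finite dimension
   this is the usual notion (continuous partial derivatives of all orders). *)
Definition iter_derive (R : realType) (V W : normedModType R) (s : seq V)
  (f : V -> W) : V -> W := foldr (fun v h => 'D_v h) f s.

Definition smooth_on (R : realType) (V W : normedModType R) (U : set V)
  (f : V -> W) : Prop :=
  forall (s : seq V) (x : V), U x -> differentiable (iter_derive s f) x.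

(* The maps are total functions; chart_map is only meaningful on chart_dom, and
   chart_inv on the image of chart_dom. *)
Record chart (R : realType) (m : nat) (M : topologicalType) := Chart {
  chart_dom : set M;
  chart_map : M -> 'rV[R]_m;
  chart_inv : 'rV[R]_m -> M;
  chart_dom_open : open chart_dom;
  chart_img_open : open (chart_map @` chart_dom);
  chart_mapK : forall x, chart_dom x -> chart_inv (chart_map x) = x;
  chart_map_continuous :
    forall x, chart_dom x -> {for x, continuous chart_map};
  chart_inv_continuous :
    forall y, (chart_map @` chart_dom) y -> {for y, continuous chart_inv} }.

Definition compatible (R : realType) (m : nat) (M : topologicalType)
    (c d : chart R m M) : Prop :=
  smooth_on (chart_map c @` (chart_dom c `&` chart_dom d))
            (chart_map d \o chart_inv c)
  /\ smooth_on (chart_map d @` (chart_dom c `&` chart_dom d))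
            (chart_map c \o chart_inv d).

(* chart_at picks a reference chart of the atlas around each point; it serves
   only to represent tangent vectors by their components. *)
Record manifold (R : realType) (m : nat) := Manifold {
  mcarrier :> topologicalType;
  manifold_hausdorff : hausdorff_space mcarrier;
  manifold_second_countable : @second_countable mcarrier;
  atlas : set (chart R m mcarrier);
  atlas_compatible : forall c d, atlas c -> atlas d -> compatible c d;
  chart_at : mcarrier -> chart R m mcarrier;
  chart_at_atlas : forall p, atlas (chart_at p);
  chart_at_dom : forall p, chart_dom (chart_at p) p }.

(* A row vector u : 'rV[R]_m at a point p of M stands for the tangent vector
   with components u in the coordinates x = chart_at p, or, for a covector, for
   \sum_k u_k dx^k.  A bilinear form on T_pM or T_p^*M is its Gram matrix. *)
Definition pairing (R : realType) (m : nat) (mu X : 'rV[R]_m) : R :=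
  (X *m mu^T) 0 0.

Definition bil (R : realType) (m : nat) (B : 'M[R]_m) (u v : 'rV[R]_m) : R :=
  (u *m B *m v^T) 0 0.

Definition radical (R : realType) (m : nat) (B : 'M[R]_m) : set 'rV[R]_m :=
  [set u | forall v, bil B u v = 0].

Definition riemannian_form (R : realType) (m : nat) (B : 'M[R]_m) : Prop :=
  forall u, u != 0 -> 0 < bil B u u.

(* Some basis is orthonormal with exactly one vector of square -1. *)
Definition lorentzian_form (R : realType) (m : nat) (B : 'M[R]_m) : Prop :=
  exists e : 'I_m -> 'rV[R]_m, row_free (\matrix_i e i) /\
    forall i j, bil B (e i) (e j) = (i == j)%:R * (-1) ^+ (val i == 0%N).

(* Bs is the form on the dual space induced by B: u and v below are the vectors
   representing mu and nu through B. *)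
Definition dual_form (R : realType) (m : nat) (B Bs : 'M[R]_m) : Prop :=
  forall mu nu u v : 'rV[R]_m,
    (forall w, bil B u w = pairing mu w) ->
    (forall w, bil B v w = pairing nu w) ->
    bil Bs mu nu = bil B u v.

Section Manifold.
Context (R : realType) (m : nat) (M : manifold R m).
Implicit Types (p : M) (c : chart R m M) (U D : set M).

(* The charts of the maximal atlas. *)
Definition coordinate_system c : Prop := forall d, atlas d -> compatible c d.

Definition smooth_fun U (f : M -> R) : Prop :=
  forall c, coordinate_system c ->
    smooth_on (chart_map c @` (chart_dom c `&` U)) (f \o chart_inv c).

(* The coordinate vector field of the i-th coordinate of c. *)
Definition dvect c (i : 'I_m) p : 'rV[R]_m :=
  'D_('e_i) (chart_map (chart_at p) \o chart_inv c) (chart_map c p).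

Definition dfun (f : M -> R) p : 'rV[R]_m :=
  \row_k 'D_('e_k) (f \o chart_inv (chart_at p)) (chart_map (chart_at p) p).

Definition chart_coord c (i : 'I_m) p : R := chart_map c p 0 i.

Definition smooth_form U (theta : M -> 'rV[R]_m) : Prop :=
  forall c, coordinate_system c -> forall i,
    smooth_fun (U `&` chart_dom c) (fun p => pairing (theta p) (dvect c i p)).

Definition smooth_covariant2 U (g : M -> 'M[R]_m) : Prop :=
  forall c, coordinate_system c -> forall i j,
    smooth_fun (U `&` chart_dom c)
      (fun p => bil (g p) (dvect c i p) (dvect c j p)).

Definition smooth_contravariant2 U (gs : M -> 'M[R]_m) : Prop :=
  forall c, coordinate_system c -> forall i j,
    smooth_fun (U `&` chart_dom c)
      (fun p => bil (gs p) (dfun (chart_coord c i) p) (dfun (chart_coord c j) p)).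

Definition coframe U (theta : 'I_m -> M -> 'rV[R]_m) : Prop :=
  (forall a, smooth_form U (theta a)) /\
  forall p, U p -> row_free (\matrix_a theta a p).

Definition coframe_det (gs : M -> 'M[R]_m) (theta : 'I_m -> M -> 'rV[R]_m) p :
    R :=
  \det (\matrix_(a, b) bil (gs p) (theta a p) (theta b p)).

(* T_pD for an embedded submanifold D: the velocities at p of the smooth curves
   of M through p which lie in D. *)
Definition tangent_to D p : set 'rV[R]_m :=
  [set X | exists (gamma : R -> M) (e : R),
    [/\ 0 < e, gamma 0 = p,
        forall t, ball 0 e t -> D (gamma t) /\ chart_dom (chart_at p) (gamma t),
        smooth_on (ball (0 : R) e) (chart_map (chart_at p) \o gamma) &
        'D_1 (chart_map (chart_at p) \o gamma) 0 = X]].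

(* Values of g on D are irrelevant; gs is the smooth extension to M of the dual
   metric of g (unique, since the conditions force D to have empty interior). *)
Record RL_polar_end D (g gs : M -> 'M[R]_m) : Prop := {
  RL_closed : closed D;
  RL_nonempty : D !=set0;
  RL_g_smooth : smooth_covariant2 (~` D) g;
  RL_g_sym : forall p, ~ D p -> forall X Y, bil (g p) X Y = bil (g p) Y X;
  RL_g_nondegenerate : forall p, ~ D p -> radical (g p) = [set 0];
  RL_gs_smooth : smooth_contravariant2 [set: M] gs;
  RL_gs_dual : forall p, ~ D p -> dual_form (g p) (gs p);
  RL_D1 : forall U theta, open U -> U `&` D !=set0 -> coframe U theta ->
    U `&` D = [set p | U p /\ coframe_det gs theta p = 0] /\
    (forall p, (U `&` D) p -> dfun (coframe_det gs theta) p != 0);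
  RL_D2 : forall p, D p ->
    [set X | forall mu, radical (gs p) mu -> pairing mu X = 0]
    = tangent_to D p;
  RL_signature : forall p, ~ D p ->
    (forall q, connected_component (~` D) p q -> riemannian_form (g q)) \/
    (forall q, connected_component (~` D) p q -> lorentzian_form (g q)) }.

End Manifold.

(* Main.v *)
From HB Require Import structures.
Require Import Defs.
From mathcomp Require Import all_boot all_order all_algebra.
From mathcomp Require Import perm ring lra.
From mathcomp Require Import boolp classical_sets functions reals.
From mathcomp Require Import ereal topology normedtype sequences landau derive realfun.
From mathcomp Require Import measure lebesgue_measure lebesgue_integral ftc.

Set Implicit Arguments.
Unset Strict Implicit.
Unset Printing Implicit Defensive.
Import Order.TTheory GRing.Theory Num.Theory.
Import numFieldNormedType.Exports.
Local Open Scope classical_set_scope.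
Local Open Scope ring_scope.

(** Write [s] for the last coordinate to be built and [q] for the others. In a
    chart where the polar end is the hyperplane [y = 0], the conditions on the
    radical and Hadamard's lemma give [g*(dy, .) = y b] with [b(dy) <> 0] on it.
    Solve [s x' = g* p], [2 s p' = p - d_x g*(p, p)] starting from the polar end
    with [p] conormal: the [x]-curves are reparametrized geodesics orthogonal to
    it, [g*(p, p) = s], and [p] annihilates every [d_q x]. Hence
    [g(d_s, .) = p / s] in the coordinates [(q, s)], which is the theorem.

    The system is singular at [s = 0]. Put [x = x0 + q + s X], [y = s Y],
    [p = (s zeta, eta)]. Every equation but that of [Y] then reads
    [w(q, s) = int_0^1 F(q, t s, w(q, t s)) dt]; the equation of [Y] is resonant
    and is replaced by the first integral [g*(p, p) = s]. In a weighted sup norm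
    [F] is a contraction in [w]. The Picard iterates converge with all their
    derivatives because the system prolonged by one derivative of the unknowns
    is again contractive. Dropping the averages, the same fixed point theorem
    yields the inverse function theorem. *)

(** * Differential calculus on row vectors *)

Section Partials.
Context {R : realType}.

(** The system is the characteristic system of the eikonal equation [g*(df, df) = f], which the
    wanted last coordinate satisfies: the characteristics are [x' = 2 g* p],
    [p' = p - d_x g*(p, p)], [f' = 2 f], and [s = f] is then taken as the parameter. Everything is
    written with [g*], since [g] blows up at the polar end. At [s = 0] the covector [p] is conormal,
    and the equation of its last component reads [eta = b eta^2], so the nonzero choice is
    [eta = 1 / b]. The equation of [Y] divided by [s] is [s Y' + Y = Y (b eta + O(s))] with
    [b eta = 1]: the linear part has factor 1, so averaging does not contract, and [Y] at [s = 0] is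
    left undetermined. The first integral divided by [s] gives [Y b eta^2 = 1] there, hence [Y = b].
    The price is that the equation of motion of the last coordinate has to be recovered afterwards,
    by differentiating the first integral in [s]. *)

Lemma nbhs_dist (V : normedModType R) (x : V) (P : set V) :
  nbhs x P <-> exists2 d : R, 0 < d & forall y, `|y - x| < d -> P y.
Proof.
split=> [/nbhs_ballP[d /= d0 h]|[d d0 h]].
  by exists d => // y xy; apply: h; rewrite -ball_normE /= distrC.
by apply/nbhs_ballP; exists d => //= y; rewrite -ball_normE /= distrC; exact: h.
Qed.

Lemma is_derive_line (V W : normedModType R) (f : V -> W) (x v : V) (t : R) :
  derivable f (t *: v + x) v ->
  is_derive t 1 (fun s => f (s *: v + x)) ('D_v f (t *: v + x)).
Proof.
have e : (fun h : R => h^-1 *: (((fun s => f (s *: v + x)) \o shift t) (h *: (1:R)) -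
      f (t *: v + x))) =
   (fun h : R => h^-1 *: ((f \o shift (t *: v + x)) (h *: v) - f (t *: v + x))).
  apply/funext => h /=; congr (_ *: (f _ - _)).
  by rewrite [h *: 1]mulr1 scalerDl addrA.
by move=> df; split; rewrite /derivable /derive e.
Qed.

Lemma MVT_line (V : normedModType R) (f : V -> R) (x v : V) (h : R) :
  (forall t, `|t| <= `|h| -> derivable f (t *: v + x) v) ->
  exists2 c, `|c| <= `|h| & f (h *: v + x) - f x = h * 'D_v f (c *: v + x).
Proof.
move=> df; pose g := fun s : R => f (s *: v + x).
have dg (t : R) : `|t| <= `|h| -> is_derive t 1 g ('D_v f (t *: v + x)).
  by move=> ht; apply: is_derive_line; exact: df.
have cg (a b : R) : (forall t : R, t \in `[a, b] -> `|t| <= `|h|) -> {within `[a, b], continuous g}.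
  move=> hab; apply: derivable_within_continuous => t /hab /dg ht.
  exact: (@ex_derive _ _ _ _ _ _ _ ht).
have g0 : g 0 = f x by rewrite /g scale0r add0r.
have [h0|h0] := leP 0 h.
- have B (t : R) : t \in `[0, h] -> `|t| <= `|h|.
    by rewrite in_itv/= => /andP[t0 th]; rewrite !ger0_norm.
  have [] := @MVT_segment R g (fun t => 'D_v f (t *: v + x)) 0 h h0 _ (cg _ _ B).
    by move=> t; rewrite in_itv/= => /andP[t0 th]; apply: dg; apply: B; rewrite in_itv/= !ltW.
  by move=> c /B hc; rewrite g0 subr0 mulrC => e; exists c.
- have B (t : R) : t \in `[h, 0] -> `|t| <= `|h|.
    by rewrite in_itv/= => /andP[t0 th]; rewrite !ler0_norm ?lerN2// ltW.
  have [] := @MVT_segment R g (fun t => 'D_v f (t *: v + x)) h 0 (ltW h0) _ (cg _ _ B).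
    by move=> t; rewrite in_itv/= => /andP[t0 th]; apply: dg; apply: B; rewrite in_itv/= !ltW.
  move=> c /B hc; rewrite g0 sub0r mulrN => e; exists c => //.
  by rewrite -/(g h) -[LHS]opprB e opprK mulrC.
Qed.

Lemma coord_norm n (x : 'rV[R]_n) i : `|x 0 i| <= `|x|.
Proof.
rewrite [leRHS]/Num.norm /= mx_normrE; apply/bigmax_geP; right => /=.
by exists (0, i).
Qed.

Lemma norm_row_le n (x : 'rV[R]_n) e : 0 <= e ->
  (forall i, `|x 0 i| <= e) -> `|x| <= e.
Proof.
move=> e0 h; rewrite [leLHS]/Num.norm /= mx_normrE; apply/bigmax_leP.
by split => // -[i j] _ /=; rewrite (ord1 i).
Qed.

Lemma norm_row_lt n (x : 'rV[R]_n) e : 0 < e ->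
  (forall i, `|x 0 i| < e) -> `|x| < e.
Proof.
move=> e0 h; rewrite [ltLHS]/Num.norm /= mx_normrE; apply/bigmax_ltP.
by split => // -[i j] _ /=; rewrite (ord1 i).
Qed.

Lemma differentiable_of (V W : normedModType R) (f : V -> W)
    (df : {linear V -> W}) (x : V) : continuous df ->
  (forall e, 0 < e -> \forall h \near 0, `|f (h + x) - f x - df h| <= e * `|h|) ->
  differentiable f x /\ 'd f x = df :> (V -> W).
Proof.
move=> cdf h.
have E : f \o shift x = cst (f x) + df +o_ 0 id.
  apply/eqaddoP => e e0; have := h _ e0; apply: filterS => y /=.
  by rewrite !fctE /= opprD addrA.
have D := diff_unique cdf E.
by split => //; apply/diff_locallyP; split; rewrite D.
Qed.

(** The path from [x] to [x + h] moves one coordinate at a time. The mean value theorem on each of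
    its [n] segments replaces an increment by a partial derivative at a nearby point, and continuity
    of the partials at [x] makes each error at most [e / n.+1] times [|h|]. *)
Lemma differentiable_partials n (f : 'rV[R]_n -> R) (x : 'rV[R]_n) :
  (forall i, \forall y \near x, derivable f y 'e_i) ->
  (forall i, {for x, continuous ('D_('e_i) f)}) ->
  differentiable f x /\ forall v, 'D_v f x = \sum_i v 0 i * 'D_('e_i) f x.
Proof.
move=> df cf.
pose L (v : 'rV[R]_n) := \sum_i v 0 i * 'D_('e_i) f x.
have Llin : linear L.
  move=> a u v; rewrite /L scaler_sumr -big_split/=; apply: eq_bigr => i _.
  by rewrite !mxE mulrDl [_ *: _]mulrA.
pose LM := GRing.isLinear.Build _ _ _ _ _ Llin.
pose LL : {linear 'rV[R]_n -> R} := HB.pack L LM.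
suff H : forall e : R, 0 < e -> \forall h \near (0 : 'rV[R]_n), `|f (h + x) - f x - L h| <= e * `|h|.
  have cL : continuous LL.
    apply: (continuous_big (op := +%R)); first exact: add_continuous.
    move=> i _ y; apply: (cvgM (F := nbhs y)); last exact: cvg_cst.
    exact: coord_continuous.
  have [D1 D2] := differentiable_of (df := LL) cL H.
  by split => // v; rewrite deriveE // D2.
move=> e e0.
pose e' := e / n.+1%:R.
have e'0 : 0 < e' by rewrite divr_gt0.
have near1 i : \forall y \near x, derivable f y 'e_i /\
    `|'D_('e_i) f x - 'D_('e_i) f y| <= e'.
  near=> y; split; first by near: y; exact: df.
  near: y; have /cvgrPdist_le := cf i; exact.
have near2 := filter_forall _ near1.
have [d /= d0 hd] := (nbhs_ballP _ _).1 (near2 _).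
apply/nbhs_dist; exists d => //= h; rewrite subr0 => hh.
(* The corners of the path: [p k] keeps the first [k] coordinates of [h]. *)
pose p k : 'rV[R]_n := \row_i (if (i < k)%N then h 0 i else 0).
have pS (k : 'I_n) : p k.+1 = h 0 k *: 'e_k + p k.
  apply/rowP => i; rewrite !mxE eqxx /=.
  have [-> | ik] := eqVneq i k; first by rewrite ltnSn ltnn mulr1 addr0.
  by rewrite mulr0 add0r ltnS leq_eqVlt (negbTE (ik : val i != val k)).
have step k : (k <= n)%N -> `|f (p k + x) - f x - \sum_(i < n | (i < k)%N) h 0 i * 'D_('e_i) f x| <= k%:R * e' * `|h|.
  elim: k => [_|k IH kn].
    rewrite (_ : p 0 = 0); last by apply/rowP => i; rewrite !mxE.
    by rewrite add0r subrr sub0r big_pred0 ?oppr0 ?normr0 ?mul0r.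
  pose K := Ordinal kn.
  rewrite (pS K) /=.
  have near_pt c : `|c| <= `|h 0 K| -> ball x d (c *: 'e_K + (p k + x)).
    move=> hc; rewrite -ball_normE /= addrA opprD addrCA subrr addr0 normrN.
    apply: le_lt_trans hh; apply: norm_row_le => // i; rewrite !mxE eqxx /=.
    have [-> | ik] := eqVneq i K; rewrite /= ?ltnn ?mulr1 ?addr0.
      exact: le_trans hc (coord_norm _ _).
    by rewrite mulr0 add0r; case: ifP => _; rewrite ?normr0 //; exact: coord_norm.
  have [|c hc E] := @MVT_line _ f (p k + x) 'e_K (h 0 K).
    by move=> t ht; have [] := hd _ (near_pt _ ht) K.
  rewrite (bigD1 K) ?ltnSn //=.
  rewrite (eq_bigl (fun i : 'I_n => (i < k)%N)); last first.
    move=> i /=; rewrite ltnS leq_eqVlt -(inj_eq val_inj) /=.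
    by case: ltngtP.
  have -> : f (h 0 K *: 'e_K + p k + x) = f (p k + x) + h 0 K * 'D_('e_K) f (c *: 'e_K + (p k + x)).
    by rewrite -E addrCA subrr addr0 addrA.
  have := IH (ltnW kn); set S := \sum_(i < n | _) _ => IH'.
  set A := 'D_ _ f (_ + _); set B := 'D_ _ f x.
  have -> : f (p k + x) + h 0 K * A - f x - (h 0 K * B + S) =
     (f (p k + x) - f x - S) - h 0 K * (B - A) by ring.
  apply: le_trans (ler_normB _ _) _.
  rewrite -natr1 2!mulrDl mul1r; apply: lerD => //.
  rewrite normrM mulrC; apply: ler_pM => //; last exact: coord_norm.
  by have [] := hd _ (near_pt _ hc) K.
have := step n (leqnn n).
rewrite (_ : p n = h); last by apply/rowP => i; rewrite !mxE ltn_ord.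
rewrite (eq_bigl xpredT); last by move=> i; rewrite ltn_ord.
move=> H; apply: le_trans H _; apply: ler_wpM2r => //.
rewrite /e' mulrCA; apply: ler_piMr; first exact: ltW.
rewrite ler_pdivrMr ?ltr0Sn // mul1r ler_nat.
exact: leqnSn.
Unshelve. all: by end_near. Qed.

Lemma MVT_segment01 (V : normedModType R) (f : V -> R) (x v : V) :
  (forall t : R, 0 <= t <= 1 -> derivable f (t *: v + x) v) ->
  exists2 c : R, 0 <= c <= 1 & f (v + x) - f x = 'D_v f (c *: v + x).
Proof.
move=> df; pose g := fun s : R => f (s *: v + x).
have dg (t : R) : 0 <= t <= 1 -> is_derive t 1 g ('D_v f (t *: v + x)).
  by move=> ht; apply: is_derive_line; exact: df.
have [|||c c01 E] := @MVT_segment R g (fun t => 'D_v f (t *: v + x)) 0 1.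
- exact: ler01.
- by move=> t; rewrite in_itv /= => /andP[t0 t1]; apply: dg; rewrite !ltW.
- apply: derivable_within_continuous => t; rewrite in_itv /= => /dg ht.
  exact: (@ex_derive _ _ _ _ _ _ _ ht).
exists c; first by move: c01; rewrite in_itv.
by move: E; rewrite /g scale1r scale0r add0r subr0 mulr1.
Qed.


End Partials.

(** * Functions of class C^k on open subsets of row vectors *)

Section CkTheory.
Context {R : realType}.

Definition pd n (i : 'I_n) (f : 'rV[R]_n -> R) : 'rV[R]_n -> R := 'D_('e_i) f.

(** Only coordinate directions occur, and continuity is asked at every level, so that
    [differentiable_partials] yields Frechet differentiability on an open set. Sums, products and
    composites then need a single induction on [k]; [smooth_on_Cinf] and [coord_smooth_on] give the
    way back to [smooth_on]. *)
Fixpoint Ck n k (U : set 'rV[R]_n) (f : 'rV[R]_n -> R) : Prop :=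
  (forall x, U x -> {for x, continuous f}) /\
  (if k is k'.+1 then
     forall i, (forall x, U x -> derivable f x 'e_i) /\ Ck k' U (pd i f)
   else True).

Definition Cinf n (U : set 'rV[R]_n) (f : 'rV[R]_n -> R) : Prop :=
  forall k, Ck k U f.

Lemma Ck_cont n k (U : set 'rV[R]_n) f x : Ck k U f -> U x -> {for x, continuous f}.
Proof. by case: k => [|k] [h _]; exact: h. Qed.

Lemma CkW n k (U : set 'rV[R]_n) f : Ck k.+1 U f -> Ck k U f.
Proof.
elim: k f => [|k IH] f [cf h]; split => // i.
by have [h1 h2] := h i; split => //; apply: IH.
Qed.

Lemma Ck_sub n k (U V : set 'rV[R]_n) f : V `<=` U -> Ck k U f -> Ck k V f.
Proof.
move=> VU; elim: k f => [|k IH] f [cf h]; split=> //=; first by move=> x /VU; exact: cf.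
  by move=> x /VU; exact: cf.
by move=> i; have [h1 h2] := h i; split; [move=> x /VU; exact: h1|exact: IH].
Qed.

Lemma near_open (T : topologicalType) (U : set T) (P : T -> Prop) x : open U -> U x ->
  (forall y, U y -> P y) -> \forall y \near x, P y.
Proof. by move=> oU Ux h; have := open_nbhs_nbhs (conj oU Ux); apply: filterS. Qed.

Lemma Ck_diff n k (U : set 'rV[R]_n) f x : open U -> Ck k.+1 U f -> U x ->
  differentiable f x /\ forall v, 'D_v f x = \sum_i v 0 i * pd i f x.
Proof.
move=> oU [cf h] Ux; apply: differentiable_partials => i; have [h1 h2] := h i.
  exact: near_open h1.
exact: Ck_cont h2 Ux.
Qed.

Lemma eq_pd n (U : set 'rV[R]_n) f g i x : open U -> (forall y, U y -> f y = g y) ->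
  U x -> pd i f x = pd i g x.
Proof. by move=> oU fg Ux; apply: near_eq_derive; exact: near_open fg. Qed.

Lemma near_eq_continuous (T W : topologicalType) (f g : T -> W) x :
  (\forall y \near x, f y = g y) -> {for x, continuous f} -> {for x, continuous g}.
Proof.
move=> fg cf; rewrite /prop_for /continuous_at -(nbhs_singleton fg).
apply: cvg_trans cf; apply: near_eq_cvg; move: fg; apply: filterS => y; exact.
Qed.

Lemma Ck_ext n k (U : set 'rV[R]_n) f g : open U -> (forall x, U x -> f x = g x) ->
  Ck k U f -> Ck k U g.
Proof.
move=> oU; elim: k f g => [|k IH] f g fg [cf h].
  by split=> // x Ux; apply: near_eq_continuous (cf _ Ux); exact: near_open oU Ux fg.
split=> [x Ux|i].
  by apply: near_eq_continuous (cf _ Ux); exact: near_open oU Ux fg.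
have [h1 h2] := h i; split.
  by move=> x Ux; apply: near_eq_derivable (h1 _ Ux); exact: near_open fg.
by apply: IH h2 => x Ux; exact: eq_pd fg Ux.
Qed.

Lemma Ck_cst n k (U : set 'rV[R]_n) (c : R) : Ck k U (fun=> c).
Proof.
elim: k c => [|k IH] c; (split => //; first by move=> x _; exact: cst_continuous).
move=> i; split; first by move=> x _; exact: derivable_cst.
rewrite (_ : pd i _ = fun=> 0) //; apply/funext => x; exact: derive_cst.
Qed.

Lemma pd_coord n (i j : 'I_n) x : pd i (fun y => y 0 j) x = (i == j)%:R.
Proof.
rewrite /pd deriveE; last exact: differentiable_coord.
have @f : {linear 'rV[R]_n -> R}.
  by exists (fun N : 'rV[R]_n => N 0 j); do 2![eexists]; do ?[constructor];
     rewrite ?mxE// => ? *; rewrite ?mxE//; move=> ?; rewrite !mxE.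
rewrite (_ : (fun _ => _) = f) // diff_lin /=; last exact: coord_continuous.
by rewrite mxE eqxx eq_sym.
Qed.

Lemma Ck_coord n k (U : set 'rV[R]_n) j : Ck k U (fun x => x 0 j).
Proof.
case: k => [|k]; (split => //; first by move=> x _; exact: coord_continuous).
move=> i; split; first by move=> x _; apply: diff_derivable; exact: differentiable_coord.
rewrite (_ : pd i _ = fun=> (i == j)%:R); first exact: Ck_cst.
by apply/funext => x; exact: pd_coord.
Qed.

Lemma pdD n i (f g : 'rV[R]_n -> R) x : derivable f x 'e_i -> derivable g x 'e_i ->
  pd i (fun y => f y + g y) x = pd i f x + pd i g x.
Proof. exact: deriveD. Qed.

Lemma pdN n i (f : 'rV[R]_n -> R) x : derivable f x 'e_i ->
  pd i (fun y => - f y) x = - pd i f x.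
Proof. exact: deriveN. Qed.

Lemma pdM n i (f g : 'rV[R]_n -> R) x : derivable f x 'e_i -> derivable g x 'e_i ->
  pd i (fun y => f y * g y) x = f x * pd i g x + g x * pd i f x.
Proof. exact: deriveM. Qed.

Lemma CkD n k (U : set 'rV[R]_n) f g : open U -> Ck k U f -> Ck k U g ->
  Ck k U (fun x => f x + g x).
Proof.
move=> oU; elim: k f g => [|k IH] f g [cf hf] [cg hg]; (split => //;
  first by move=> x Ux; apply: continuousD; [exact: cf|exact: cg]).
move=> i; have [f1 f2] := hf i; have [g1 g2] := hg i; split.
  by move=> x Ux; apply: derivableD; [exact: f1|exact: g1].
apply: (Ck_ext oU (f := fun x => pd i f x + pd i g x)); last exact: IH.
by move=> x Ux; rewrite pdD //; [exact: f1|exact: g1].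
Qed.

Lemma CkM n k (U : set 'rV[R]_n) f g : open U -> Ck k U f -> Ck k U g ->
  Ck k U (fun x => f x * g x).
Proof.
move=> oU; elim: k f g => [|k IH] f g cf' cg'; have [cf hf] := cf'; have [cg hg] := cg'; (split => //;
  first by move=> x Ux; apply: continuousM; [exact: cf|exact: cg]).
move=> i; have [f1 f2] := hf i; have [g1 g2] := hg i; split.
  by move=> x Ux; apply: derivableM; [exact: f1|exact: g1].
apply: (Ck_ext oU (f := fun x => f x * pd i g x + g x * pd i f x)).
  by move=> x Ux; rewrite pdM //; [exact: f1|exact: g1].
by apply: CkD => //; apply: IH => //; exact: CkW.
Qed.

Lemma CkN n k (U : set 'rV[R]_n) f : open U -> Ck k U f -> Ck k U (fun x => - f x).
Proof.
move=> oU cf; apply: (Ck_ext oU (f := fun x => (-1) * f x)).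
  by move=> x _; rewrite mulN1r.
by apply: CkM => //; exact: Ck_cst.
Qed.

Lemma CkB n k (U : set 'rV[R]_n) f g : open U -> Ck k U f -> Ck k U g ->
  Ck k U (fun x => f x - g x).
Proof. by move=> oU hf hg; apply: CkD => //; exact: CkN. Qed.

Lemma Ck_sum n k (U : set 'rV[R]_n) (I : Type) (r : seq I) (P : pred I) (F : I -> 'rV[R]_n -> R) :
  open U -> (forall i, P i -> Ck k U (F i)) -> Ck k U (fun x => \sum_(i <- r | P i) F i x).
Proof.
move=> oU h; elim: r => [|a r IH].
  by apply: (Ck_ext oU _ (Ck_cst k U 0)) => x _; rewrite big_nil.
case Pa: (P a); last by apply: (Ck_ext oU _ IH) => x _; rewrite big_cons Pa.
by apply: (Ck_ext oU _ (CkD oU (h _ Pa) IH)) => x _; rewrite big_cons Pa.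
Qed.

Lemma Ck_prod n k (U : set 'rV[R]_n) (I : Type) (r : seq I) (P : pred I) (F : I -> 'rV[R]_n -> R) :
  open U -> (forall i, P i -> Ck k U (F i)) -> Ck k U (fun x => \prod_(i <- r | P i) F i x).
Proof.
move=> oU h; elim: r => [|a r IH].
  by apply: (Ck_ext oU _ (Ck_cst k U 1)) => x _; rewrite big_nil.
case Pa: (P a); last by apply: (Ck_ext oU _ IH) => x _; rewrite big_cons Pa.
by apply: (Ck_ext oU _ (CkM oU (h _ Pa) IH)) => x _; rewrite big_cons Pa.
Qed.

Lemma pd_cst n (i : 'I_n) (c : R) (x : 'rV[R]_n) : pd i (fun=> c) x = 0.
Proof. exact: derive_cst. Qed.

Lemma pdZ n (i : 'I_n) (c : R) (f : 'rV[R]_n -> R) x : derivable f x 'e_i ->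
  pd i (fun y => c * f y) x = c * pd i f x.
Proof. by move=> df; rewrite pdM ?pd_cst ?mulr0 ?addr0 //; exact: derivable_cst. Qed.

Lemma pd_sum n (I : finType) (i : 'I_n) (f : I -> 'rV[R]_n -> R) x :
  (forall a, derivable (f a) x 'e_i) -> pd i (fun y => \sum_a f a y) x = \sum_a pd i (f a) x.
Proof.
move=> df.
suff : is_derive x 'e_i (fun y => \sum_a f a y) (\sum_a pd i (f a) x).
  by move=> d; exact: (@derive_val _ _ _ _ _ _ _ d).
elim: (index_enum I) => [|a r IH].
  rewrite big_nil (_ : (fun y => _) = fun=> 0); first exact: is_derive_cst.
  by apply/funext => y; rewrite big_nil.
rewrite big_cons (_ : (fun y => _) = f a + (fun y => \sum_(a <- r) f a y)); last first.
  by apply/funext => y; rewrite big_cons.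
by apply: is_deriveD; apply: derivableP.
Qed.

Lemma Ck_derivable n k (U : set 'rV[R]_n) f x i : Ck k.+1 U f -> U x ->
  derivable f x 'e_i.
Proof. by move=> [_ /(_ i)[h _]]; exact: h. Qed.

Lemma Ck_det n p k (U : set 'rV[R]_n) (A : 'rV[R]_n -> 'M[R]_p) : open U ->
  (forall i j, Ck k U (fun x => A x i j)) -> Ck k U (fun x => \det (A x)).
Proof.
move=> oU cA; rewrite /determinant; apply: Ck_sum => // s _; apply: (CkM oU).
  exact: Ck_cst.
by apply: Ck_prod => // i _; exact: cA.
Qed.

Lemma continuous_row (T : topologicalType) p (g : T -> 'rV[R]_p) x :
  (forall j, {for x, continuous (fun y => g y 0 j : R)}) -> {for x, continuous g}.
Proof.
move=> h; apply/cvgrPdist_le => e e0.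
have H j : \forall y \near x, `|g x 0 j - g y 0 j| <= e.
  by have /cvgrPdist_le := h j; exact.
have H' := filter_forall _ H.
near=> y; have Hy : forall j, `|g x 0 j - g y 0 j| <= e by near: y; exact: H' _.
by apply: norm_row_le => [|j]; [exact: ltW|rewrite !mxE].
Unshelve. all: by end_near. Qed.

Lemma continuous_sum_at (T : topologicalType) (I : finType) (f : I -> T -> R) x :
  (forall i, {for x, continuous (f i)}) -> {for x, continuous (fun y => \sum_i f i y)}.
Proof.
move=> cf; apply: (cvg_big (op := +%R)); first exact: add_continuous.
by move=> i _; exact: cf.
Qed.

Lemma differentiable_row (V : normedModType R) p (g : V -> 'rV[R]_p) x :
  (forall j, differentiable (fun y => g y 0 j : R) x) -> differentiable g x.
Proof.
move=> h.
rewrite (_ : g = \sum_j (fun y => g y 0 j *: ('e_j : 'rV[R]_p))).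
  apply: differentiable_sum => j; exact: differentiableZl.
by apply/funext => y; rewrite fct_sumE {1}[g y]row_sum_delta.
Qed.

Lemma derive_coord (V : normedModType R) p (g : V -> 'rV[R]_p) x v j :
  differentiable g x -> 'D_v g x 0 j = 'D_v (fun y => g y 0 j : R) x.
Proof. by move=> dg; rewrite derive_mx ?mxE //; exact: diff_derivable. Qed.

Lemma derive_comp (V : normedModType R) p (f : 'rV[R]_p -> R) (g : V -> 'rV[R]_p) x v :
  differentiable f (g x) -> (forall j, differentiable (fun y => g y 0 j : R) x) ->
  'D_v (fun y => f (g y)) x = \sum_j 'D_('e_j) f (g x) * 'D_v (fun y => g y 0 j : R) x.
Proof.
move=> df dg; have dg' := differentiable_row dg.
rewrite deriveE; last exact: differentiable_comp.
rewrite [X in 'd X _](_ : _ = f \o g) // diff_comp //=.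
rewrite -(deriveE v dg') [X in 'd f (g x) X]row_sum_delta linear_sum.
apply: eq_bigr => j _; rewrite linearZ /= -derive_coord // mulrC.
by congr (_ * _); rewrite deriveE.
Qed.

Lemma Ck_comp n p k (U : set 'rV[R]_n) (V : set 'rV[R]_p) (f : 'rV[R]_p -> R) (g : 'rV[R]_n -> 'rV[R]_p) :
  open U -> open V -> (forall x, U x -> V (g x)) -> Ck k V f ->
  (forall j, Ck k U (fun x => g x 0 j)) -> Ck k U (fun x => f (g x)).
Proof.
move=> oU oV gV; elim: k f => [|k IH] f cf cg.
  split => // x Ux; apply: continuous_comp; last exact: (Ck_cont cf (gV _ Ux)).
  by apply: continuous_row => j; exact: (Ck_cont (cg j) Ux).
have dg x : U x -> forall j, differentiable (fun y => g y 0 j) x.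
  by move=> Ux j; have [] := Ck_diff oU (cg j) Ux.
have df x : U x -> differentiable f (g x).
  by move=> Ux; have [] := Ck_diff oV cf (gV _ Ux).
have [cf1 hf] := cf.
have dfg x : U x -> differentiable (fun y => f (g y)) x.
  by move=> Ux; apply: differentiable_comp; [exact: differentiable_row (dg _ Ux)|exact: df].
split=> [x Ux|i]; first exact: differentiable_continuous (dfg _ Ux).
split=> [x Ux|]; first exact: diff_derivable (dfg _ Ux).
apply: (Ck_ext oU (f := fun x => \sum_j pd j f (g x) * pd i (fun y => g y 0 j) x)).
  by move=> x Ux; rewrite /pd derive_comp //; [exact: df|exact: dg].
apply: Ck_sum => // j _; apply: CkM => //.
  by apply: IH; [have [] := hf j|move=> l; exact: CkW].
by have [_ h] := cg j; have [] := h i.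
Qed.

Lemma smooth_on_pd n (W : normedModType R) (U : set 'rV[R]_n) (f : 'rV[R]_n -> W) v :
  smooth_on U f -> smooth_on U ('D_v f).
Proof.
(* [foldr] applies the last direction of the list first, hence [rcons]. *)
move=> h s x Ux; have := h (rcons s v) x Ux.
by rewrite /iter_derive -cats1 foldr_cat.
Qed.

Lemma smooth_on_coord n p (U : set 'rV[R]_n) (f : 'rV[R]_n -> 'rV[R]_p) j : open U ->
  smooth_on U f -> Cinf U (fun x => f x 0 j).
Proof.
move=> oU sf k; elim: k f sf => [|k IH] f sf.
  split=> // x Ux; apply: differentiable_continuous.
  apply: (differentiable_comp (g := fun x : 'rV[R]_p => x 0 j)).
    exact: (sf [::] x Ux).
  exact: differentiable_coord.
have df x : U x -> differentiable f x by exact: (sf [::] x).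
have dfj x : U x -> differentiable (fun y => f y 0 j) x.
  move=> Ux; apply: (differentiable_comp (g := fun x : 'rV[R]_p => x 0 j)); first exact: df.
  exact: differentiable_coord.
split=> [x Ux|i]; first exact: differentiable_continuous (dfj _ Ux).
split=> [x Ux|]; first exact: diff_derivable (dfj _ Ux).
apply: (Ck_ext oU (f := fun x => 'D_('e_i) f x 0 j)).
  by move=> x Ux; rewrite derive_coord //; exact: df.
by apply: IH; exact: smooth_on_pd.
Qed.

Lemma Cinf_derivable n (U : set 'rV[R]_n) f x i : Cinf U f -> U x -> derivable f x 'e_i.
Proof. by move=> cf; exact: (Ck_derivable (cf 1%N)). Qed.

(** Each clause of [Ck] concerns the germ of the total function [f] at one point. *)
Lemma Cinf_local n (U : set 'rV[R]_n) (f : 'rV[R]_n -> R) :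
  (forall x, U x -> exists V, V x /\ Cinf V f) -> Cinf U f.
Proof.
move=> h k; elim: k f h => [|k IH] f h.
  by split=> // x /h[V [Vx cf]]; exact: Ck_cont (cf 0%N) Vx.
split=> [x /h[V [Vx cf]]|i]; first exact: Ck_cont (cf 0%N) Vx.
split=> [x /h[V [Vx cf]]|]; first exact: Cinf_derivable cf Vx.
apply: IH => x /h[V [Vx cf]]; exists V; split => // j.
by have [_ /(_ i)[]] := cf j.+1.
Qed.

Lemma Cinf_D n (U : set 'rV[R]_n) (f : 'rV[R]_n -> R) v : open U ->
  Cinf U f -> Cinf U ('D_v f).
Proof.
move=> oU cf k; apply: (Ck_ext oU (f := fun x => \sum_i v 0 i * pd i f x)).
  by move=> x Ux; have [_ ->] := Ck_diff oU (cf 1%N) Ux.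
apply: Ck_sum => // i _; apply: CkM => //; first exact: Ck_cst.
by have [_ h] := cf k.+1; have [] := h i.
Qed.

Lemma coord_smooth_on n p (U : set 'rV[R]_n) (f : 'rV[R]_n -> 'rV[R]_p) : open U ->
  (forall j, Cinf U (fun x => f x 0 j)) -> smooth_on U f.
Proof.
move=> oU cf s.
have dr (h : 'rV[R]_n -> 'rV[R]_p) : (forall j, Cinf U (fun x => h x 0 j)) ->
    forall x, U x -> differentiable h x.
  by move=> ch x Ux; apply: differentiable_row => j; have [] := Ck_diff oU (ch j 1%N) Ux.
suff h : forall j, Cinf U (fun x => iter_derive s f x 0 j) by exact: dr.
elim: s => [|v s IH] j //= k.
apply: (Ck_ext oU (f := 'D_v (fun x => iter_derive s f x 0 j))).
  by move=> x Ux; rewrite -derive_coord //; exact: dr.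
exact: Cinf_D.
Qed.

Lemma smooth_on_Cinf n (U : set 'rV[R]_n) (f : 'rV[R]_n -> R) : open U ->
  smooth_on U f <-> Cinf U f.
Proof.
move=> oU; split=> [sf k|cf s x Ux].
  elim: k f sf => [|k IH] f sf.
    by split=> // x Ux; apply: differentiable_continuous; exact: (sf [::] x Ux).
  have df x : U x -> differentiable f x by exact: (sf [::] x).
  split=> [x Ux|i]; first exact: differentiable_continuous (df _ Ux).
  split=> [x Ux|]; first exact: diff_derivable (df _ Ux).
  by apply: IH; exact: smooth_on_pd.
suff h : Cinf U (iter_derive s f) by have [] := Ck_diff oU (h 1%N) Ux.
by elim: s => [|v s IH] //=; exact: Cinf_D.
Qed.

End CkTheory.

(** * Averages along a coordinate *)

Section Mean.
Context {R : realType}.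

Lemma continuous_dist (V W : normedModType R) (f : V -> W) (x : V) :
  (forall e : R, 0 < e -> exists2 d : R, 0 < d &
     forall y, `|y - x| < d -> `|f y - f x| <= e) -> {for x, continuous f}.
Proof.
move=> h; apply/cvgrPdist_le => e /h[d d0 hd]; apply/nbhs_dist; exists d => // y /hd.
by rewrite distrC.
Qed.

Lemma withinB (f g : R -> R) : {within `[0, 1], continuous f} ->
  {within `[0, 1], continuous g} -> {within `[0, 1], continuous (fun t => f t - g t)}.
Proof. by move=> cf cg t; apply: cvgB; [exact: cf|exact: cg]. Qed.

Lemma withinZ (c : R) (f : R -> R) : {within `[0, 1], continuous f} ->
  {within `[0, 1], continuous (fun t => c * f t)}.
Proof. by move=> cf t; apply: cvgM; [exact: cvg_cst|exact: cf]. Qed.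

Notation mu := (@lebesgue_measure R).

Definition mean (f : R -> R) : R := (\int[mu]_(t in `[0%R, 1%R]) f t)%R.

Lemma mean_integrable (f : R -> R) : {within `[0, 1], continuous f} ->
  mu.-integrable `[0%R, 1%R] (EFin \o f).
Proof. by move=> cf; apply: continuous_compact_integrable => //; exact: segment_compact. Qed.

Lemma meanB (f g : R -> R) : {within `[0, 1], continuous f} ->
  {within `[0, 1], continuous g} -> mean (fun t => f t - g t) = mean f - mean g.
Proof. by move=> cf cg; apply: RintegralB => //; exact: mean_integrable. Qed.

Lemma meanZ (c : R) (f : R -> R) : {within `[0, 1], continuous f} ->
  mean (fun t => c * f t) = c * mean f.
Proof. by move=> cf; apply: RintegralZl => //; exact: mean_integrable. Qed.

Lemma eq_mean (f g : R -> R) : (forall t, 0 <= t <= 1 -> f t = g t) -> mean f = mean g.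
Proof. by move=> h; apply: eq_Rintegral => t; rewrite inE /= in_itv /= => /h. Qed.

Lemma mean_cst (c : R) : mean (fun=> c) = c.
Proof.
rewrite /mean Rintegral_cst //= lebesgue_measure_itv /= lte_fin ltr01.
by rewrite -EFinD /= subr0 mulr1.
Qed.

Lemma le_mean (f : R -> R) e : {within `[0, 1], continuous f} ->
  (forall t, 0 <= t <= 1 -> `|f t| <= e) -> `|mean f| <= e.
Proof.
move=> cf h; apply: le_trans (le_normr_Rintegral _ (mean_integrable cf)) _ => //.
rewrite -[leRHS](mean_cst e); apply: le_Rintegral => //.
- exact: integrable_norm (mean_integrable cf).
- apply: mean_integrable; move=> x; exact: cst_continuous.
Qed.

Lemma mean_FTC (F f : R -> R) : {within `[0, 1], continuous f} ->
  (forall t : R, 0 <= t <= 1 -> derivable F t 1 /\ 'D_1 F t = f t) ->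
  mean f = F 1 - F 0.
Proof.
move=> cf dF.
have cF (t : R) : 0 <= t <= 1 -> {for t, continuous F}.
  by move=> /dF[d _]; apply: differentiable_continuous; apply/derivable1_diffP.
rewrite /mean /Rintegral (@continuous_FTC2 R f F 0 1) //.
- split.
  + by move=> t; rewrite in_itv /= => /andP[t0 t1]; apply: (dF t _).1; rewrite !ltW.
  + by apply: cvg_at_right_filter; apply: cF; rewrite lexx ler01.
  + by apply: cvg_at_left_filter; apply: cF; rewrite lexx ler01.
- move=> t; rewrite in_itv /= => /andP[t0 t1]; rewrite derive1E.
  by apply: (dF t _).2; rewrite !ltW.
Qed.

End Mean.

Section Average.
Context {R : realType} {m : nat} (l : 'I_m).
Implicit Types (x : 'rV[R]_m) (U : set 'rV[R]_m) (h : 'rV[R]_m -> R).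

Definition rescale (t : R) x : 'rV[R]_m :=
  \row_i (if i == l then t * x 0 i else x 0 i).

(** The weight makes the family stable under partial derivatives: each derivative along [e_l] brings
    out one more factor [t], see [pd_avg]. With [s] the coordinate [l], [avg 0 h] is the solution of
    [s w' + w = h] that stays bounded at [s = 0], see [avg_ode]. *)
Definition avg (j : nat) h x : R := mean (fun t => t ^+ j * h (rescale t x)).

Definition star U := forall x t, U x -> 0 <= t <= 1 -> U (rescale t x).

Lemma rescale1 x : rescale 1 x = x.
Proof. by apply/rowP => i; rewrite mxE mul1r; case: ifP. Qed.

Lemma rescale_line t x : rescale t x = t *: (x 0 l *: 'e_l) + rescale 0 x.
Proof.
apply/rowP => i; rewrite !mxE eqxx /=; have [->|il] := eqVneq i l.
  by rewrite mulr1 mul0r addr0.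
by rewrite !mulr0 add0r.
Qed.

Lemma rescale_shift t x s i : rescale t (s *: 'e_i + x) =
  (s * t ^+ (i == l)) *: 'e_i + rescale t x.
Proof.
apply/rowP => k; rewrite !mxE eqxx /=.
have [->|kl] := eqVneq k l; last first.
  have [ki|ki] := eqVneq k i; last by rewrite !mulr0.
  by rewrite -ki (negbTE kl) expr0 !mulr1.
have [->|li] := eqVneq l i; last by rewrite !mulr0 !add0r.
by rewrite expr1 !mulr1 mulrDr (mulrC t s).
Qed.

Lemma rescale_dist t x y : 0 <= t <= 1 -> `|rescale t y - rescale t x| <= `|y - x|.
Proof.
move=> /andP[t0 t1]; apply: norm_row_le => // i; rewrite !mxE.
apply: le_trans (coord_norm _ i); rewrite !mxE; case: ifP => // _.
by rewrite -mulrBr normrM ger0_norm // ler_piMl.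
Qed.

Lemma is_derive_rescale U h x (t : R) : open U -> star U -> Ck 1 U h -> U x -> 0 <= t <= 1 ->
  is_derive t 1 (fun s => h (rescale s x)) (x 0 l * pd l h (rescale t x)).
Proof.
move=> oU sU ch Ux t01; have Ut := sU _ _ Ux t01.
have [dh Dh] := Ck_diff oU ch Ut.
have -> : (fun s => h (rescale s x)) = (fun s => h (s *: (x 0 l *: 'e_l) + rescale 0 x)).
  by apply/funext => s; rewrite -rescale_line.
have -> : x 0 l * pd l h (rescale t x) =
    'D_(x 0 l *: 'e_l) h (t *: (x 0 l *: 'e_l) + rescale 0 x).
  rewrite -rescale_line Dh (bigD1 l) //= big1 ?addr0 ?mxE ?eqxx ?mulr1 // => i il.
  by rewrite !mxE (negbTE il) mulr0 mul0r.
by apply: is_derive_line; rewrite -rescale_line; exact: diff_derivable.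
Qed.

Lemma continuous_rescale x : continuous (fun t : R => rescale t x).
Proof.
move=> t; apply: continuous_row => j.
rewrite (_ : (fun s => _) = (fun s => if j == l then s * x 0 j else x 0 j)); last first.
  by apply/funext => s; rewrite mxE.
case: (j == l); last exact: cst_continuous.
by apply: continuousM; [exact: id|exact: cst_continuous].
Qed.

Lemma within_continuous01 (f : R -> R) : (forall t : R, 0 <= t <= 1 -> {for t, continuous f}) ->
  {within `[0, 1], continuous f}.
Proof.
by move=> h; apply: continuous_in_subspaceT => t; rewrite inE /= in_itv /= => /h.
Qed.

Lemma within_rescale U h x j : star U -> (forall y, U y -> {for y, continuous h}) -> U x ->
  {within `[0, 1], continuous (fun t => t ^+ j * h (rescale t x))}.
Proof.
move=> sU ch Ux; apply: within_continuous01 => t t01; apply: continuousM.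
  exact: exprn_continuous.
apply: (@continuous_comp _ _ _ (fun t => rescale t x) h); first exact: continuous_rescale.
exact/ch/sU.
Qed.

(** Compactness of [[0, 1]] gives one [d] for all points of the segment from [rescale 0 x] to [x].
    This uniformity is what allows limits to pass under the integral. *)
Lemma rescale_tube U h x (e : R) : open U -> star U -> (forall y, U y -> {for y, continuous h}) ->
  U x -> 0 < e -> exists2 d : R, 0 < d & forall t z, 0 <= t <= 1 ->
    `|z - rescale t x| < d -> U z /\ `|h z - h (rescale t x)| <= e.
Proof.
move=> oU sU ch Ux e0.
pose P (v : 'rV[R]_m) (t : R) := U (v + rescale t x) /\ `|h (v + rescale t x) - h (rescale t x)| <= e.
have /compact_near_coveringP/(_ _ (nbhs (0 : 'rV[R]_m)) P) := @segment_compact R 0 1.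
have H (t : R) : `[0, 1]%classic t -> \forall t' \near t & v \near (0 : 'rV[R]_m), P v t'.
  rewrite /= in_itv /= => t01.
  have Ut := sU _ _ Ux t01.
  have e20 : 0 < e / 2 by rewrite divr_gt0.
  have H1 : \forall z \near rescale t x, U z /\ `|h (rescale t x) - h z| <= e / 2.
    have /cvgrPdist_le/(_ _ e20) H := ch _ Ut.
    have := open_nbhs_nbhs (conj oU Ut); apply: filterS2 H => z; by [].
  have [d d0 Hd] := (nbhs_dist _ _).1 H1.
  have d20 : 0 < d / 2 by rewrite divr_gt0.
  have /cvgrPdist_lt/(_ _ d20) Ht := @continuous_rescale x t.
  exists ([set t' : R | `|rescale t x - rescale t' x| < d / 2], [set v : 'rV[R]_m | `|v| < d / 2]) => /=.
    split; first exact: Ht.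
    by apply/nbhs_dist; exists (d / 2) => // y; rewrite subr0.
  move=> [t' v] [/= h1 h2].
  have [|U1 B1] := Hd (v + rescale t' x).
    rewrite -addrA (splitr d); apply: le_lt_trans (ler_normD _ _) _.
    by apply: ltrD; rewrite // distrC.
  have [|U2 B2] := Hd (rescale t' x).
    by rewrite distrC; apply: lt_trans h1 _; rewrite gtr_pMr // invf_lt1 // ltr1n.
  split => //; rewrite (splitr e) -(subrKA (h (rescale t x))) addrC.
  by apply: le_trans (ler_normD _ _) _; apply: lerD; rewrite // distrC.
move=> /(_ _ H) /nbhs_dist[d d0 Hd]; exists d => // t z t01 zd.
have := Hd (z - rescale t x); rewrite subr0 => /(_ zd t).
by rewrite /P subrK; apply; rewrite /= in_itv.
Qed.

Lemma avg_dist U j h1 h2 x (e : R) : star U ->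
  (forall y, U y -> {for y, continuous h1}) -> (forall y, U y -> {for y, continuous h2}) ->
  (forall y, U y -> `|h1 y - h2 y| <= e) -> U x -> `|avg j h1 x - avg j h2 x| <= e.
Proof.
move=> sU c1 c2 h Ux.
have w1 := within_rescale (j := j) sU c1 Ux; have w2 := within_rescale (j := j) sU c2 Ux.
rewrite -meanB //; apply: le_mean.
  exact: withinB.
move=> t /andP[t0 t1]; rewrite -mulrBr normrM ger0_norm ?exprn_ge0 //.
apply: le_trans (h _ (sU _ t Ux _)); last by rewrite t0.
by rewrite ler_piMl // exprn_ile1.
Qed.

Lemma is_derive_dist (V : normedModType R) (f : V -> R) (x v : V) (L : R) :
  (forall e : R, 0 < e -> exists2 d : R, 0 < d &
    forall s : R, s != 0 -> `|s| < d -> `|s^-1 * (f (s *: v + x) - f x) - L| <= e) ->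
  is_derive x v f L.
Proof.
move=> H.
have C : (fun s : R => s^-1 *: ((f \o shift x) (s *: v) - f x)) @ 0^' --> L.
  apply/cvgrPdist_le => e /H[d d0 hd].
  exists d => //= s; rewrite /ball_ /= sub0r normrN => sd s0.
  by rewrite distrC; exact: hd.
split; first by apply/cvg_ex; exists L.
exact: (cvg_lim _ C).
Qed.

(** Differentiation under the integral sign: for each [t] the difference quotient of the integrand
    is, by the mean value theorem, its derivative at a point of the tube of [rescale_tube], hence
    within [e] of the derivative at [rescale t x]. *)
Lemma is_derive_avg U j h i x : open U -> star U -> Ck 1 U h -> U x ->
  is_derive x 'e_i (avg j h) (avg (j + (i == l)) (pd i h) x).
Proof.
move=> oU sU ch Ux; apply: is_derive_dist => e e0.
have ch0 y : U y -> {for y, continuous h} by exact: Ck_cont ch.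
have dh : forall y, U y -> derivable h y 'e_i by have [_ /(_ i)[]] := ch.
have cdh : forall y, U y -> {for y, continuous (pd i h)} by have [_ /(_ i)[_ []]] := ch.
have [d d0 Hd] := rescale_tube oU sU cdh Ux e0.
have nei (s : R) : `|s *: ('e_i : 'rV[R]_m)| <= `|s|.
  apply: norm_row_le => // k; rewrite !mxE normrM ler_piMr //.
  by case: (_ && _); rewrite ?normr1 ?normr0.
exists d => // s s0 sd.
have Uxs : U (s *: 'e_i + x).
  have [] := Hd 1 (s *: 'e_i + x) _ _; rewrite ?rescale1 ?ler01 ?lexx //.
  by rewrite addrK; exact: le_lt_trans sd.
have w1 := within_rescale (j := j) sU ch0 Ux; have w2 := within_rescale (j := j) sU ch0 Uxs.
have w3 := within_rescale (j := (j + (i == l))) sU cdh Ux.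
rewrite -meanB // -meanZ; last exact: withinB.
rewrite -meanB //; last first.
  by apply: withinZ; exact: withinB.
apply: le_mean.
  by apply: withinB => //; apply: withinZ; exact: withinB.
move=> t t01; have /andP[t0 t1] := t01.
rewrite rescale_shift; set c := t ^+ (i == l).
have c0 : 0 <= c by rewrite exprn_ge0.
have c1 : c <= 1 by rewrite exprn_ile1.
have scs : `|s * c| <= `|s| by rewrite normrM (ger0_norm c0) ler_piMr.
have inU b : `|b| <= `|s * c| -> U (b *: 'e_i + rescale t x) /\
    `|pd i h (b *: 'e_i + rescale t x) - pd i h (rescale t x)| <= e.
  move=> hb; apply: Hd => //; rewrite addrK; apply: le_lt_trans (nei _) _.
  by apply: le_lt_trans sd; exact: le_trans scs.
have [|b hb E] := @MVT_line R _ h (rescale t x) 'e_i (s * c).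
  by move=> b hb; apply: dh; have [] := inU b hb.
rewrite -mulrBr E exprD -/c.
have -> : s^-1 * (t ^+ j * (s * c * 'D_('e_i) h (b *: 'e_i + rescale t x))) -
   t ^+ j * c * pd i h (rescale t x) =
   t ^+ j * c * ('D_('e_i) h (b *: 'e_i + rescale t x) - pd i h (rescale t x)).
  by field.
rewrite normrM ger0_norm ?mulr_ge0 ?exprn_ge0 //.
have [_ B] := inU _ hb; apply: le_trans B.
by rewrite ler_piMl // mulr_ile1 ?exprn_ge0 ?exprn_ile1.
Qed.

Lemma avg_Ck U j h k : open U -> star U -> Ck k U h -> Ck k U (avg j h).
Proof.
move=> oU sU; elim: k h j => [|k IH] h j ch.
  have c0 y : U y -> {for y, continuous h} by exact: Ck_cont ch.
  split=> // x Ux; apply: continuous_dist => e e0.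
  have [d d0 Hd] := rescale_tube oU sU c0 Ux e0.
  exists d => // y yd.
  have Uy : U y by have [] := Hd 1 y; rewrite ?rescale1 ?ler01 ?lexx.
  have w1 := within_rescale (j := j) sU c0 Ux; have w2 := within_rescale (j := j) sU c0 Uy.
  rewrite -meanB //; apply: le_mean.
    exact: withinB.
  move=> t t01; have /andP[t0 t1] := t01; rewrite -mulrBr normrM ger0_norm ?exprn_ge0 //.
  have [|_] := Hd t (rescale t y) t01.
    exact: le_lt_trans (rescale_dist _ _ t01) yd.
  by apply: le_trans; rewrite ler_piMl // exprn_ile1.
have ch1 : Ck 1 U h by elim: k {IH} ch => // k IH /CkW.
have der i x : U x -> is_derive x 'e_i (avg j h) (avg (j + (i == l)) (pd i h) x).
  exact: is_derive_avg.
have c0 := IH h j (CkW ch).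
split=> [x Ux|i]; first exact: (Ck_cont c0 Ux).
split=> [x Ux|]; first exact: (@ex_derive _ _ _ _ _ _ _ (der i x Ux)).
apply: (Ck_ext oU (f := avg (j + (i == l)) (pd i h))).
  by move=> x Ux; rewrite /pd (@derive_val _ _ _ _ _ _ _ (der i x Ux)).
by apply: IH; have [_ /(_ i)[]] := ch.
Qed.

Lemma pd_avg U j h i x : open U -> star U -> Ck 1 U h -> U x ->
  pd i (avg j h) x = avg (j + (i == l)) (pd i h) x.
Proof.
move=> oU sU ch Ux; have d := is_derive_avg j i oU sU ch Ux.
exact: (@derive_val _ _ _ _ _ _ _ d).
Qed.

(** The fundamental theorem of calculus for [t -> h (rescale t x)]. It divides a function vanishing
    on the hyperplane by the coordinate [l], with a smooth quotient. *)
Lemma Hadamard U h x : open U -> star U -> Ck 1 U h -> U x ->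
  h x = h (rescale 0 x) + x 0 l * avg 0 (pd l h) x.
Proof.
move=> oU sU ch Ux.
have cdh : forall y, U y -> {for y, continuous (pd l h)} by have [_ /(_ l)[_ []]] := ch.
have w := within_rescale (j := 0) sU cdh Ux.
rewrite -meanZ //.
rewrite (@mean_FTC R (fun t => h (rescale t x)) (fun t => x 0 l * (t ^+ 0 * pd l h (rescale t x)))).
- by rewrite rescale1 addrC subrK.
- exact: withinZ.
- move=> t t01; rewrite expr0 mul1r.
  by have d := is_derive_rescale oU sU ch Ux t01; split; [|exact: derive_val].
Qed.

(** The left side is the integral over [[0, 1]] of the derivative of [t * h (rescale t x)]. This
    turns a fixed point of an averaged operator into a solution of the singular differential
    equation. *)
Lemma avg_ode U h x : open U -> star U -> Ck 1 U h -> U x ->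
  x 0 l * pd l (avg 0 h) x + avg 0 h x = h x.
Proof.
move=> oU sU ch Ux; rewrite (pd_avg 0 _ oU sU ch Ux) eqxx.
have ch0 y : U y -> {for y, continuous h} by exact: Ck_cont ch.
have cdh : forall y, U y -> {for y, continuous (pd l h)} by have [_ /(_ l)[_ []]] := ch.
have w := within_rescale (j := 1) sU cdh Ux; have w0 := within_rescale (j := 0) sU ch0 Ux.
(* The sum is put in the form of a difference, to which [meanB] applies. *)
have -> : avg 0 h x = - - avg 0 h x by rewrite opprK.
rewrite -[- avg 0 h x]mulN1r -meanZ // -meanZ // -meanB.
- rewrite (@mean_FTC R (fun t => t * h (rescale t x))
    (fun t => x 0 l * (t ^+ 1 * pd l h (rescale t x)) - -1 * (t ^+ 0 * h (rescale t x)))).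
  + by rewrite rescale1 mul1r mul0r subr0.
  + by apply: withinB; exact: withinZ.
  + move=> t t01; have d := is_derive_rescale oU sU ch Ux t01.
    have D : is_derive t 1 (fun t => t * h (rescale t x))
        (x 0 l * (t ^+ 1 * pd l h (rescale t x)) - -1 * (t ^+ 0 * h (rescale t x))).
      by apply: is_derive_eq; rewrite expr0 expr1 /GRing.scale /=; ring.
    by split; [|exact: derive_val].
- exact: withinZ.
- exact: withinZ.
Qed.

End Average.

(** * A smooth fixed point theorem *)

Section UniformLimits.
Context {R : realType} {m : nat} (B : set 'rV[R]_m).
Hypothesis oB : open B.

(** A geometric Cauchy condition on all partial derivatives up to order [k]. The constants [C] and
    [q] may change with the derivative, because every prolongation of a system has its own
    contraction constant. *)
Fixpoint UCk k (f : nat -> 'rV[R]_m -> R) : Prop :=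
  (exists C q : R, [/\ 0 <= q, q < 1 & forall n x, B x -> `|f n.+1 x - f n x| <= C * q ^+ n]) /\
  (if k is k'.+1 then forall i, UCk k' (fun n => pd i (f n)) else True).

Definition ulim (f : nat -> 'rV[R]_m -> R) (g : 'rV[R]_m -> R) : Prop :=
  forall e : R, 0 < e -> exists n0, forall n x, (n0 <= n)%N -> B x -> `|f n x - g x| <= e.

(** Removes the factor [s] that [prolong] puts on the derivatives. *)
Lemma UCk_scale k (f g : nat -> 'rV[R]_m -> R) (c : R) :
  (forall n, Ck k B (f n)) -> (forall n x, B x -> g n x = c * f n x) ->
  UCk k f -> UCk k g.
Proof.
have base f' g' : (forall n x, B x -> g' n x = c * f' n x) ->
    (exists C q : R, [/\ 0 <= q, q < 1 & forall n x, B x -> `|f' n.+1 x - f' n x| <= C * q ^+ n]) ->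
    exists C q : R, [/\ 0 <= q, q < 1 & forall n x, B x -> `|g' n.+1 x - g' n x| <= C * q ^+ n].
  move=> gf [C [q [q0 q1 H]]]; exists (`|c| * C), q; split => // n x Bx.
  by rewrite !gf // -mulrBr normrM -mulrA ler_wpM2l // H.
elim: k f g => [|k IH] f g cf gf [b h]; split => //; [exact: base b|exact: base b|].
move=> i; apply: (IH (fun n => pd i (f n))); last exact: h.
  by move=> n; have [_ /(_ i)[]] := cf n.
move=> n x Bx; rewrite (eq_pd i oB (gf n) Bx).
rewrite /pd (_ : (fun y => c * f n y) = c \*: f n) // deriveZ //.
by have [_ /(_ i)[h1 _]] := cf n; exact: h1.
Qed.

Lemma geometric_le (a : nat -> R) (C q : R) : 0 <= q -> q < 1 ->
  (forall n, `|a n.+1 - a n| <= C * q ^+ n) ->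
  forall n d, `|a (n + d)%N - a n| <= C * q ^+ n / (1 - q).
Proof.
move=> q0 q1 h.
have C0 : 0 <= C by have := h 0; rewrite expr0 mulr1; apply: le_trans.
have q10 : 0 < 1 - q by rewrite subr_gt0.
(* The exact partial sum of the geometric series, which, unlike the final bound, reproduces itself
   in the induction. *)
move=> n d; suff H : `|a (n + d)%N - a n| <= C * q ^+ n * (1 - q ^+ d) / (1 - q).
  apply: le_trans H _; rewrite ler_pM2r ?invr_gt0 // ler_piMr ?mulr_ge0 ?exprn_ge0 //.
  by rewrite gerBl exprn_ge0.
elim: d => [|d IH]; first by rewrite addn0 subrr normr0 expr0 subrr mulr0 mul0r.
rewrite addnS -(subrKA (a (n + d)%N)).
apply: le_trans (ler_normD _ _) _; apply: le_trans (lerD (h _) IH) _.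
rewrite le_eqVlt; apply/orP; left; apply/eqP; rewrite exprD exprS; field.
by rewrite gt_eqF.
Qed.

Lemma geometric_small (C q e : R) : 0 <= q -> q < 1 -> 0 < e ->
  exists n0, forall n, (n0 <= n)%N -> C * q ^+ n / (1 - q) <= e.
Proof.
move=> q0 q1 e0.
have q10 : 0 < 1 - q by rewrite subr_gt0.
have : (fun n => C / (1 - q) * q ^+ n) @ \oo --> C / (1 - q) * 0.
  by apply: cvgM; [exact: cvg_cst|apply: cvg_expr; rewrite ger0_norm].
rewrite mulr0 => /cvgrPdist_le/(_ _ e0)[n0 _ H]; exists n0 => n /H /=.
by rewrite sub0r normrN mulrAC; apply: le_trans; exact: ler_norm.
Qed.

Lemma UC_ulim k f : UCk k f -> exists g, ulim f g.
Proof.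
move=> h; have [C [q [q0 q1 H]]] : exists C q : R,
    [/\ 0 <= q, q < 1 & forall n x, B x -> `|f n.+1 x - f n x| <= C * q ^+ n].
  by case: k h => [|k] [].
have G x : B x -> forall n d, `|f (n + d)%N x - f n x| <= C * q ^+ n / (1 - q).
  by move=> Bx; apply: (geometric_le (a := fun n => f n x)) => // n; exact: H.
have cv x : B x -> cvg ((fun n => f n x) @ \oo).
  move=> Bx; apply/cauchy_cvgP/cauchy_exP => e e0.
  have [n0 Hn] := geometric_small C q0 q1 (divr_gt0 e0 (ltr0Sn R 1)).
  exists (f n0 x); exists n0 => // n /= n0n.
  rewrite -ball_normE /= distrC -(subnKC n0n); apply: le_lt_trans (G _ Bx _ _) _.
  by apply: le_lt_trans (Hn _ (leqnn _)) _; rewrite ltr_pdivrMr // ltr_pMr // ltr1n.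
exists (fun x => lim ((fun n => f n x) @ \oo)) => e e0.
have [n0 Hn] := geometric_small C q0 q1 e0; exists n0 => n x n0n Bx.
apply/ler_addgt0Pr => d d0.
have /cvgrPdist_le/(_ _ d0)[n1 _ H1] := cv x Bx.
have := H1 (maxn n n1) (leq_maxr _ _); set L := lim _ => /= H2.
rewrite -(subrKA (f (maxn n n1) x)); apply: le_trans (ler_normD _ _) _.
apply: lerD; last by rewrite distrC.
rewrite distrC -(subnKC (leq_maxl n n1)); apply: le_trans (G _ Bx _ _) _.
exact: Hn.
Qed.

Lemma ulim_cont f g : (forall n x, B x -> {for x, continuous (f n)}) -> ulim f g ->
  forall x, B x -> {for x, continuous g}.
Proof.
move=> cf fg x Bx; apply: continuous_dist => e e0.
have e30 : 0 < e / 3 by rewrite divr_gt0.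
have [n0 H0] := fg _ e30.
have H : \forall y \near x, B y /\ `|f n0 x - f n0 y| <= e / 3.
  have /cvgrPdist_le/(_ _ e30) H1 := cf n0 _ Bx.
  by have := open_nbhs_nbhs (conj oB Bx); apply: filterS2 H1 => y; by [].
have [d d0 Hd] := (nbhs_dist _ _).1 H; exists d => // y /Hd[By fy].
have -> : g y - g x = (f n0 x - g x) - (f n0 x - f n0 y) - (f n0 y - g y) by ring.
rewrite (_ : e = e / 3 + e / 3 + e / 3); last by field.
apply: le_trans (ler_normB _ _) _; apply: lerD; last exact: H0.
by apply: le_trans (ler_normB _ _) _; apply: lerD => //; exact: H0.
Qed.

(** The difference quotient of [f n] is a value of [pd i (f n)] at a point near [x]. For a fixed
    step [s], a large [n] brings it close both to a value of [gi] near [x] and to the difference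
    quotient of [g]. *)
Lemma ulim_derive f g gi i : (forall n, Cinf B (f n)) -> ulim f g ->
  ulim (fun n => pd i (f n)) gi -> forall x, B x -> is_derive x 'e_i g (gi x).
Proof.
move=> cf fg fgi x Bx; apply: is_derive_dist => e e0.
have cgi : forall y, B y -> {for y, continuous gi}.
  apply: ulim_cont fgi => n y By; have [_ /(_ i)[_ h]] := cf n 1%N.
  exact: (@Ck_cont R m 0 B _ y h By).
have H : \forall y \near x, B y /\ `|gi x - gi y| <= e.
  have /cvgrPdist_le/(_ _ e0) H1 := cgi _ Bx.
  by have := open_nbhs_nbhs (conj oB Bx); apply: filterS2 H1 => y; by [].
have [d d0 Hd] := (nbhs_dist _ _).1 H; exists d => // s s0 sd.
have nei (t : R) : `|t| <= `|s| -> `|t *: 'e_i + x - x| < d.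
  move=> ts; rewrite addrK; apply: le_lt_trans sd; apply: le_trans ts.
  apply: norm_row_le => // k; rewrite !mxE normrM ler_piMr //.
  by case: (_ && _); rewrite ?normr1 ?normr0.
have Bs : B (s *: 'e_i + x) by have [] := Hd _ (nei s (lexx _)).
apply/ler_addgt0Pr => e' e'0.
have e30 : 0 < e' / 3 by rewrite divr_gt0.
(* This tolerance contains [|s|] since the error on [f n] will be divided by [s]. *)
have es : 0 < `|s| * (e' / 3) by rewrite mulr_gt0 // normr_gt0.
have [n1 H1] := fg _ es; have [n2 H2] := fgi _ e30.
pose n := maxn n1 n2.
have dfn y : B y -> derivable (f n) y 'e_i.
  by move=> By; have [_ /(_ i)[h _]] := cf n 1%N; exact: h.
have [|c hc E] := @MVT_line R _ (f n) x 'e_i s.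
  by move=> t /nei/Hd[By _]; exact: dfn.
have [Bc Hc] := Hd _ (nei _ hc).
set y := c *: 'e_i + x in E Bc Hc.
have -> : s^-1 * (g (s *: 'e_i + x) - g x) - gi x =
   (pd i (f n) y - gi y) - (gi x - gi y) - s^-1 * (f n (s *: 'e_i + x) - g (s *: 'e_i + x))
   + s^-1 * (f n x - g x).
  have -> : pd i (f n) y = s^-1 * (f n (s *: 'e_i + x) - f n x) by rewrite E mulKf.
  by ring.
have B3 z : B z -> `|s^-1 * (f n z - g z)| <= e' / 3.
  move=> Bz; rewrite normrM normfV mulrC ler_pdivrMr ?normr_gt0 // mulrC.
  by apply: H1 => //; exact: leq_maxl.
rewrite (_ : e + e' = e' / 3 + e + e' / 3 + e' / 3); last by field.
apply: le_trans (ler_normD _ _) _; apply: lerD; last exact: B3.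
apply: le_trans (ler_normB _ _) _; apply: lerD; last exact: B3.
apply: le_trans (ler_normB _ _) _; apply: lerD; last exact: Hc.
by apply: H2 => //; exact: leq_maxr.
Qed.

Lemma UC_Ck k f g : (forall n, Cinf B (f n)) -> UCk k f -> ulim f g -> Ck k B g.
Proof.
elim: k f g => [|k IH] f g cf ucf fg.
  split=> //; apply: ulim_cont fg => n x Bx; exact: (Ck_cont (cf n 0%N) Bx).
split; first by apply: ulim_cont fg => n x Bx; exact: (Ck_cont (cf n 0%N) Bx).
move=> i; have [_ /(_ i) ui] := ucf; have [gi Hgi] := UC_ulim ui.
have D := ulim_derive cf fg Hgi.
split=> [x Bx|]; first exact: (@ex_derive _ _ _ _ _ _ _ (D x Bx)).
apply: (Ck_ext oB (f := gi)).
  by move=> x Bx; rewrite /pd (@derive_val _ _ _ _ _ _ _ (D x Bx)).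
by apply: IH ui Hgi => n; exact: Cinf_D.
Qed.

End UniformLimits.

Section Operator.
Context {R : realType} {m : nat} (l : 'I_m).
Implicit Types (x : 'rV[R]_m) (U : set 'rV[R]_m) (h : 'rV[R]_m -> R).

(** The index [0] stands for no averaging and [j.+1] for [avg j], so that averaged and purely
    algebraic equations can occur in one system. [shift_weight] records how a derivative changes the
    index. *)
Definition smoother (j : nat) h : 'rV[R]_m -> R := if j is j'.+1 then avg l j' h else h.

Definition shift_weight (i : 'I_m) (j : nat) : nat :=
  if j is j'.+1 then (j' + (i == l)).+1 else 0.

Definition origin_ball (d : R) : set 'rV[R]_m := [set x | `|x| < d].

Lemma open_origin_ball d : open (origin_ball d).
Proof.
rewrite openE => x xd; apply/nbhs_dist; exists (d - `|x|); first by rewrite subr_gt0.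
move=> y; rewrite ltrBrDr; apply: le_lt_trans.
by rewrite -[X in `|X| <= _](subrK x); exact: ler_normD.
Qed.

Lemma star_origin_ball d : star l (origin_ball d).
Proof.
move=> x t xd t01; apply: le_lt_trans xd.
have -> : rescale l t x = rescale l t x - rescale l t 0.
  by rewrite (_ : rescale l t 0 = 0) ?subr0 //; apply/rowP => i; rewrite !mxE mulr0 if_same.
by apply: le_trans (rescale_dist _ _ _ t01) _; rewrite subr0.
Qed.

Lemma smoother_Ck U j h k : open U -> star l U -> Ck k U h -> Ck k U (smoother j h).
Proof. by case: j => // j; exact: avg_Ck. Qed.

Lemma pd_smoother U j h i x : open U -> star l U -> Ck 1 U h -> U x ->
  pd i (smoother j h) x = smoother (shift_weight i j) (pd i h) x.
Proof. by case: j => // j; exact: pd_avg. Qed.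

Lemma eq_smoother U j h1 h2 x : star l U -> (forall y, U y -> h1 y = h2 y) -> U x ->
  smoother j h1 x = smoother j h2 x.
Proof.
case: j => [|j] sU h Ux /=; first exact: h.
by apply: eq_mean => t t01; rewrite h //; exact: sU.
Qed.

Lemma smootherZ U j h c x : star l U -> (forall y, U y -> {for y, continuous h}) -> U x ->
  smoother j (fun y => c * h y) x = c * smoother j h x.
Proof.
case: j => [|j] sU ch Ux //=; rewrite /avg -meanZ; last exact: within_rescale sU ch Ux.
by apply: eq_mean => t _; rewrite mulrCA.
Qed.

Lemma smoother_dist U j h1 h2 x (e : R) : star l U ->
  (forall y, U y -> {for y, continuous h1}) -> (forall y, U y -> {for y, continuous h2}) ->
  (forall y, U y -> `|h1 y - h2 y| <= e) -> U x ->
  `|smoother j h1 x - smoother j h2 x| <= e.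
Proof. by case: j => [|j] sU c1 c2 h Ux /=; [exact: h|exact: avg_dist sU c1 c2 h Ux]. Qed.

Lemma smoother_le U j h x (e : R) : star l U -> (forall y, U y -> {for y, continuous h}) ->
  (forall y, U y -> `|h y| <= e) -> U x -> `|smoother j h x| <= e.
Proof.
move=> sU ch he Ux.
have -> : smoother j h x = smoother j h x - smoother j (fun=> 0) x.
  suff -> : smoother j (fun=> 0) x = 0 by rewrite subr0.
  case: j => //= j; rewrite /avg (eq_mean (g := fun=> 0)) ?mean_cst // => t _.
  by rewrite mulr0.
apply: smoother_dist sU ch _ _ Ux; first by move=> y _; exact: cst_continuous.
by move=> y /he; rewrite subr0.
Qed.

End Operator.

Section Box.
Context {R : realType} {m N : nat}.

(** One radius per unknown, because in a prolonged system the derivatives get a radius of their own.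
    The box is closed, so continuous functions are bounded on it. *)
Definition box (d : R) (r : 'I_N -> R) : set 'rV[R]_(m + N) :=
  [set u | (forall i, `|u 0 (lshift N i)| <= d) /\ (forall a, `|u 0 (rshift m a)| <= r a)].

Lemma box_row d r (x : 'rV[R]_m) (w : 'rV[R]_N) : `|x| < d -> (forall a, `|w 0 a| <= r a) ->
  box d r (row_mx x w).
Proof.
move=> xd wr; split=> [i|a]; rewrite ?row_mxEl ?row_mxEr //.
by apply: le_trans (coord_norm _ _) _; exact: ltW.
Qed.

Lemma compact_box d r : compact (box d r).
Proof.
have -> : box d r = [set v : 'rV[R]_(m + N) | forall j,
    (match fintype.split j with inl _ => `[- d, d]%classic | inr a => `[- r a, r a]%classic end) (v ord0 j)].
  apply/seteqP; split => v /=.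
    move=> [h1 h2] j; case: splitP => k jk /=; rewrite in_itv /= -ler_norml.
      by rewrite (_ : j = lshift N k) ?h1 //; exact: val_inj.
    by rewrite (_ : j = rshift m k) ?h2 //; exact: val_inj.
  move=> h; split=> [i|a].
    have := h (lshift N i); rewrite (unsplitK (inl i : 'I_m + 'I_N)%type) /=.
    by rewrite in_itv /= -ler_norml.
  have := h (rshift m a); rewrite (unsplitK (inr a : 'I_m + 'I_N)%type) /=.
  by rewrite in_itv /= -ler_norml.
apply: (@rV_compact _ _ (fun j => match fintype.split j with inl _ => `[- d, d]%classic | inr a => `[- r a, r a]%classic end)).
by move=> j; case: fintype.split => *; exact: segment_compact.
Qed.

Lemma box_bound d r (I : finType) (f : I -> 'rV[R]_(m + N) -> R) :
  (forall i u, box d r u -> {for u, continuous (f i)}) ->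
  exists C : R, 0 <= C /\ forall i u, box d r u -> `|f i u| <= C.
Proof.
move=> cf.
have H i : exists C : R, forall u, box d r u -> `|f i u| <= C.
  have [[u0 Bu0]|/forallNP nB] := pselect (exists u, box d r u); last first.
    by exists 0 => u /nB.
  have [||c _ hc] := @EVT_max_rV R _ (fun u => `|f i u|) (box d r) _ (@compact_box d r).
  - by exists u0.
  - apply: continuous_in_subspaceT => u; rewrite inE => Bu.
    by apply: continuous_comp; [exact: cf|exact: norm_continuous].
  - by exists `|f i c| => u Bu; apply: hc; rewrite inE.
have [C HC] := choice H.
exists (\sum_i `|C i|); split; first exact: sumr_ge0.
move=> i u Bu; apply: le_trans (HC i u Bu) _; apply: le_trans (ler_norm _) _.
by rewrite (bigD1 i) //= lerDl sumr_ge0.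
Qed.

Lemma box_segment d r (u v : 'rV[R]_(m + N)) (t : R) : box d r u -> box d r v -> 0 <= t <= 1 ->
  box d r (t *: (u - v) + v).
Proof.
move=> [u1 u2] [v1 v2] /andP[t0 t1].
have H (a b e : R) : `|a| <= e -> `|b| <= e -> `|t * (a - b) + b| <= e.
  move=> ae be; have -> : t * (a - b) + b = t * a + (1 - t) * b by ring.
  apply: le_trans (ler_normD _ _) _; rewrite !normrM (ger0_norm t0).
  have t10 : 0 <= 1 - t by rewrite subr_ge0.
  rewrite (ger0_norm t10) (_ : e = t * e + (1 - t) * e); last by ring.
  by apply: lerD; exact: ler_wpM2l.
by split=> i; rewrite !mxE; exact: H.
Qed.

Lemma box_lipschitz d r (O : set 'rV[R]_(m + N)) (f : 'rV[R]_(m + N) -> R) (k e : R)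
    (x : 'rV[R]_m) (w w' : 'rV[R]_N) :
  0 <= e -> open O -> box d r `<=` O -> Cinf O f ->
  (forall u, box d r u -> \sum_b `|pd (rshift m b) f u| <= k) ->
  box d r (row_mx x w) -> box d r (row_mx x w') -> (forall b, `|w 0 b - w' 0 b| <= e) ->
  `|f (row_mx x w) - f (row_mx x w')| <= k * e.
Proof.
move=> e0 oO bO cf hk b1 b2 he.
have D u : box d r u -> differentiable f u /\ forall v, 'D_v f u = \sum_i v 0 i * pd i f u.
  by move=> /bO; exact: Ck_diff oO (cf 1%N).
have [|c c01 E] := @MVT_segment01 _ _ f (row_mx x w') (row_mx x w - row_mx x w').
  by move=> t t01; apply: diff_derivable; apply: (D _ _).1; exact: box_segment.
have bc := box_segment b1 b2 c01.
rewrite -[X in f X - _](subrK (row_mx x w')) E (D _ bc).2 big_split_ord /= big1 ?add0r; last first.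
  by move=> i _; rewrite mxE [X in _ + X]mxE !row_mxEl subrr mul0r.
apply: le_trans (ler_norm_sum _ _ _) _.
apply: (@le_trans _ _ (\sum_b `|pd (rshift m b) f (c *: (row_mx x w - row_mx x w') + row_mx x w')| * e)).
  apply: ler_sum => b _; rewrite normrM mulrC ler_wpM2l //.
  by rewrite mxE [X in _ + X]mxE !row_mxEr.
by rewrite -mulr_suml ler_wpM2r // hk.
Qed.

End Box.

Section Graph.
Context {R : realType} {m N : nat}.

Lemma Ck_graph k (U : set 'rV[R]_m) (O : set 'rV[R]_(m + N)) (f : 'rV[R]_(m + N) -> R)
    (w : 'rV[R]_m -> 'rV[R]_N) : open U -> open O ->
  (forall x, U x -> O (row_mx x (w x))) -> Ck k O f ->
  (forall a, Ck k U (fun x => w x 0 a)) -> Ck k U (fun x => f (row_mx x (w x))).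
Proof.
move=> oU oO wO cf cw; apply: (Ck_comp oU oO wO cf) => j.
case: (split_ordP j) => i ->.
  by apply: (Ck_ext oU _ (Ck_coord _ _ i)) => x _; rewrite row_mxEl.
by apply: (Ck_ext oU _ (cw i)) => x _; rewrite row_mxEr.
Qed.

Lemma pd_graph (U : set 'rV[R]_m) (O : set 'rV[R]_(m + N)) (f : 'rV[R]_(m + N) -> R)
    (w : 'rV[R]_m -> 'rV[R]_N) i x : open U -> open O ->
  (forall x, U x -> O (row_mx x (w x))) -> Ck 1 O f ->
  (forall a, Ck 1 U (fun x => w x 0 a)) -> U x ->
  pd i (fun x => f (row_mx x (w x))) x = pd (lshift N i) f (row_mx x (w x)) +
    \sum_b pd (rshift m b) f (row_mx x (w x)) * pd i (fun y => w y 0 b) x.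
Proof.
move=> oU oO wO cf cw Ux.
have El j : (fun y => row_mx y (w y) 0 (lshift N j)) = (fun y : 'rV[R]_m => y 0 j).
  by apply/funext => y; rewrite row_mxEl.
have Er b : (fun y => row_mx y (w y) 0 (rshift m b)) = (fun y : 'rV[R]_m => w y 0 b).
  by apply/funext => y; rewrite row_mxEr.
rewrite /pd (derive_comp (g := fun x => row_mx x (w x))) /=; first last.
- move=> j; case: (split_ordP j) => a ->.
    by rewrite El; exact: differentiable_coord.
  by rewrite Er; have [] := Ck_diff oU (cw a) Ux.
- by have [] := Ck_diff oO cf (wO _ Ux).
rewrite big_split_ord /=; congr (_ + _); last by apply: eq_bigr => b _; rewrite Er.
rewrite (bigD1 i) //= El -[X in _ * X + _]/(pd i _ x) pd_coord eqxx mulr1.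
rewrite big1 ?addr0 // => j ji.
by rewrite El -[X in _ * X]/(pd i _ x) pd_coord eq_sym (negbTE ji) mulr0.
Qed.

End Graph.

(** * Picard iteration and prolonged systems *)

Section Picard.
Context {R : realType} {m : nat} (l : 'I_m) (d : R).
Notation B := (origin_ball d : set 'rV[R]_m).

(** [ctr_lip] bounds the row sums of [D_w F], so that by the mean value theorem [F] is [k]-Lipschitz
    in [w] for the sup norm. Smoothness on a neighbourhood of the compact box bounds the higher
    derivatives there, which [prolong_contractive] uses. *)
Record contractive N (F : 'I_N -> 'rV[R]_(m + N) -> R) (r : 'I_N -> R) (k : R) : Prop := {
  ctr_ge0 : 0 <= k;
  ctr_lt1 : k < 1;
  ctr_radius : forall a, 0 <= r a;
  ctr_smooth : exists O : set 'rV[R]_(m + N),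
    [/\ open O, box d r `<=` O & forall a, Cinf O (F a)];
  ctr_self : forall a u, box d r u -> `|F a u| <= r a;
  ctr_lip : forall a u, box d r u -> \sum_b `|pd (rshift m b) (F a) u| <= k }.

Fixpoint picard N (F : 'I_N -> 'rV[R]_(m + N) -> R) (t : 'I_N -> nat) (n : nat) :
    'rV[R]_m -> 'rV[R]_N :=
  if n is n'.+1 then
    fun x => \row_a smoother l (t a) (fun y => F a (row_mx y (picard F t n' y))) x
  else fun=> 0.

Definition in_box N (r : 'I_N -> R) (w : 'rV[R]_m -> 'rV[R]_N) : Prop :=
  (forall a, Cinf B (fun x => w x 0 a)) /\ (forall x, B x -> forall a, `|w x 0 a| <= r a).

Lemma graph_smooth N (F : 'I_N -> 'rV[R]_(m + N) -> R) r k w a : contractive F r k ->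
  in_box r w -> Cinf B (fun y => F a (row_mx y (w y))).
Proof.
move=> [_ _ _ [W [oO bO cF]] _ _] [cw wr] j.
apply: (Ck_graph (O := W)) => //; first exact: open_origin_ball.
- by move=> x Bx; apply: bO; apply: box_row => //; exact: wr.
- exact: cF.
- by move=> b; exact: cw.
Qed.

Lemma graph_box N (r : 'I_N -> R) w x : in_box r w -> B x -> box d r (row_mx x (w x)).
Proof. by move=> [_ wr] Bx; apply: box_row => //; exact: wr. Qed.

Lemma picard_in_box N (F : 'I_N -> 'rV[R]_(m + N) -> R) t r k n : contractive F r k ->
  in_box r (picard F t n).
Proof.
move=> HF; elim: n => [|n IH].
  split=> [a j|x _ a]; last by rewrite mxE normr0; exact: ctr_radius HF a.
  by apply: (Ck_ext (@open_origin_ball _ _ _) _ (Ck_cst _ _ 0)) => x _; rewrite mxE.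
have cg a := graph_smooth a HF IH.
split=> [a j|x Bx a].
  apply: (Ck_ext (@open_origin_ball _ _ _) (f := smoother l (t a) (fun y => F a (row_mx y (picard F t n y))))).
    by move=> x _; rewrite mxE.
  by apply: smoother_Ck; [exact: open_origin_ball|exact: star_origin_ball|exact: cg].
rewrite mxE; apply: (smoother_le (U := B)) => //; first exact: star_origin_ball.
- by move=> y By; exact: Ck_cont (cg a 0%N) By.
- by move=> y By; apply: ctr_self HF _ _ (graph_box IH By).
Qed.

Lemma graph_contract N (F : 'I_N -> 'rV[R]_(m + N) -> R) t r k e w w' : contractive F r k ->
  in_box r w -> in_box r w' -> 0 <= e ->
  (forall x, B x -> forall a, `|w x 0 a - w' x 0 a| <= e) ->
  forall x, B x -> forall a,
  `|smoother l (t a) (fun y => F a (row_mx y (w y))) x -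
    smoother l (t a) (fun y => F a (row_mx y (w' y))) x| <= k * e.
Proof.
move=> HF hw hw' e0 he x Bx a.
have cg := graph_smooth a HF hw; have cg' := graph_smooth a HF hw'.
apply: (smoother_dist (U := B)) => //; first exact: star_origin_ball.
- by move=> y By; exact: Ck_cont (cg 0%N) By.
- by move=> y By; exact: Ck_cont (cg' 0%N) By.
move=> y By; have [_ _ _ [W [oO bO cF]] _ hl] := HF.
apply: box_lipschitz oO bO (cF a) (hl a) (graph_box hw By) (graph_box hw' By) _ => //.
by move=> b; exact: he.
Qed.

Lemma picard_geometric N (F : 'I_N -> 'rV[R]_(m + N) -> R) t r k : contractive F r k ->
  forall n x, B x -> forall a,
    `|picard F t n.+1 x 0 a - picard F t n x 0 a| <= (\sum_b r b) * k ^+ n.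
Proof.
move=> HF; elim=> [|n IH] x Bx a.
  rewrite expr0 mulr1 [X in _ - X]mxE subr0.
  apply: le_trans ((picard_in_box t 1 HF).2 x Bx a) _.
  by rewrite (bigD1 a) //= lerDl; apply: sumr_ge0 => b _; exact: ctr_radius HF b.
rewrite mxE [X in _ - X]mxE exprS mulrCA.
apply: (graph_contract t HF (picard_in_box t n.+1 HF) (picard_in_box t n HF)) => //.
rewrite mulr_ge0 ?exprn_ge0 ?(ctr_ge0 HF) //.
by apply: sumr_ge0 => b _; exact: ctr_radius HF b.
Qed.

Section Prolong.
Context {N : nat} (F : 'I_N -> 'rV[R]_(m + N) -> R) (t : 'I_N -> nat) (r : 'I_N -> R) (k : R).
Hypothesis HF : contractive F r k.
Variable (i : 'I_m).

(** A point of the prolonged system is [(x, (w, v))], with [v] standing for [s] times the derivative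
    of [w] along [e_i]; [base_point] forgets [v]. *)
Definition base_index (j : 'I_(m + N)) : 'I_(m + (N + N)) :=
  match fintype.split j with inl i => lshift _ i | inr a => rshift m (lshift N a) end.

Definition base_point (u : 'rV[R]_(m + (N + N))) : 'rV[R]_(m + N) := \row_j u 0 (base_index j).

(* [s] rescales the derivative so that the prolonged system is still contractive *)
Definition prolong (s : R) (c : 'I_(N + N)) (u : 'rV[R]_(m + (N + N))) : R :=
  match fintype.split c with
  | inl a => F a (base_point u)
  | inr a => s * pd (lshift N i) (F a) (base_point u) +
      \sum_b pd (rshift m b) (F a) (base_point u) * u 0 (rshift m (rshift N b))
  end.

Definition prolong_weight (c : 'I_(N + N)) : nat :=
  match fintype.split c with inl a => t a | inr a => shift_weight l i (t a) end.

Definition prolong_radius (s : R) (c : 'I_(N + N)) : R :=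
  match fintype.split c with inl a => r a | inr _ => s end.

Lemma base_indexl j : base_index (lshift N j) = lshift _ j.
Proof. by rewrite /base_index (unsplitK (inl j : 'I_m + 'I_N)%type). Qed.

Lemma base_indexr a : base_index (rshift m a) = rshift m (lshift N a).
Proof. by rewrite /base_index (unsplitK (inr a : 'I_m + 'I_N)%type). Qed.

Lemma split_l a : fintype.split (lshift N a : 'I_(N + N)) = inl a.
Proof. exact: (unsplitK (inl a : 'I_N + 'I_N)%type). Qed.

Lemma split_r a : fintype.split (rshift N a : 'I_(N + N)) = inr a.
Proof. exact: (unsplitK (inr a : 'I_N + 'I_N)%type). Qed.

Lemma base_row (x : 'rV[R]_m) (w v : 'rV[R]_N) : base_point (row_mx x (row_mx w v)) = row_mx x w.
Proof.
apply/rowP => j; rewrite mxE; case: (split_ordP j) => a ->.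
  by rewrite base_indexl !row_mxEl.
by rewrite base_indexr !row_mxEr row_mxEl.
Qed.

Lemma base_box s u : box d (prolong_radius s) u -> box d r (base_point u) /\
  forall b, `|u 0 (rshift m (rshift N b))| <= s.
Proof.
move=> [h1 h2]; split; last by move=> b; have := h2 (rshift N b); rewrite /prolong_radius split_r.
split=> [j|a]; rewrite mxE ?base_indexl ?base_indexr //.
by have := h2 (lshift N a); rewrite /prolong_radius split_l.
Qed.

Lemma open_base (O : set 'rV[R]_(m + N)) : open O -> open (base_point @^-1` O).
Proof.
apply: open_comp => u _; apply: continuous_row => j.
rewrite (_ : (fun y => _) = fun u : 'rV[R]_(m + (N + N)) => u 0 (base_index j)).
  exact: coord_continuous.
by apply/funext => y; rewrite mxE.
Qed.

Lemma Ck_base (O : set 'rV[R]_(m + N)) f j : open O -> Ck j O f ->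
  Ck j (base_point @^-1` O) (fun u => f (base_point u)).
Proof.
move=> oO cf; apply: (Ck_comp _ oO) => //; first exact: open_base.
move=> a; apply: (Ck_ext (open_base oO) _ (Ck_coord _ _ (base_index a))) => u _.
by rewrite mxE.
Qed.

Lemma pd_base (O : set 'rV[R]_(m + N)) f u c : open O -> Ck 1 O f -> O (base_point u) ->
  pd c (fun u => f (base_point u)) u = \sum_j pd j f (base_point u) * (c == base_index j)%:R.
Proof.
move=> oO cf Ou.
have E j : (fun y => base_point y 0 j) = (fun u : 'rV[R]_(m + (N + N)) => u 0 (base_index j)).
  by apply/funext => y; rewrite mxE.
rewrite /pd derive_comp /=.
- by apply: eq_bigr => j _; rewrite E -[X in _ * X]/(pd c _ u) pd_coord.
- by have [] := Ck_diff oO cf Ou.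
- by move=> j; rewrite E; exact: differentiable_coord.
Qed.

Lemma pd_basel (O : set 'rV[R]_(m + N)) f u b : open O -> Ck 1 O f -> O (base_point u) ->
  pd (rshift m (lshift N b)) (fun u => f (base_point u)) u = pd (rshift m b) f (base_point u).
Proof.
move=> oO cf Ou; rewrite (pd_base _ oO cf Ou) (bigD1 (rshift m b)) //= base_indexr eqxx mulr1.
rewrite big1 ?addr0 // => j; case: (split_ordP j) => a -> => [_|].
  by rewrite base_indexl eq_rlshift mulr0.
by rewrite base_indexr !eq_rshift eq_lshift eq_sym => /negbTE ->; rewrite mulr0.
Qed.

Lemma pd_baser (O : set 'rV[R]_(m + N)) f u b : open O -> Ck 1 O f -> O (base_point u) ->
  pd (rshift m (rshift N b)) (fun u => f (base_point u)) u = 0.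
Proof.
move=> oO cf Ou; rewrite (pd_base _ oO cf Ou) big1 // => j _; case: (split_ordP j) => a ->.
  by rewrite base_indexl eq_rlshift mulr0.
by rewrite base_indexr eq_rshift eq_rlshift mulr0.
Qed.

End Prolong.
End Picard.

Section Solution.
Context {R : realType} {m : nat} (l : 'I_m) (d : R).
Notation B := (origin_ball d : set 'rV[R]_m).

Lemma prolong_smooth N (F : 'I_N -> 'rV[R]_(m + N) -> R) (O : set 'rV[R]_(m + N)) i s c :
  open O -> (forall a, Cinf O (F a)) -> Cinf (base_point @^-1` O) (prolong F i s c).
Proof.
move=> oO cF j; rewrite /prolong; case: fintype.split => a; first by apply: Ck_base => //; exact: cF.
have oO' := open_base oO.
apply: CkD => //.
  by apply: CkM => //; [exact: Ck_cst|apply: Ck_base => //; exact: Cinf_D].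
apply: Ck_sum => // b _; apply: CkM => //; last exact: Ck_coord.
by apply: Ck_base => //; exact: Cinf_D.
Qed.

(** The Jacobian of the prolonged system in [(w, v)] is block lower triangular, with [D_w F] twice
    on the diagonal. The block below it is [s D_w d_i F + D_w^2 F . v], small once [s] and the
    radius [p] of [v] are small. The second equation is affine in [v] with linear part of norm at
    most [k], so it preserves [|v| <= p] if [s] is small compared with [p]. Hence [p] is chosen
    before [s]. *)
Lemma prolong_contractive N (F : 'I_N -> 'rV[R]_(m + N) -> R) r k i : contractive d F r k ->
  exists s p k' : R, 0 < s /\ contractive d (prolong F i s) (prolong_radius r p) k'.
Proof.
move=> HF; have [k0 k1 r0 [W [oW bW cF]] hself hlip] := HF.
have cont f u : Cinf W f -> box d r u -> {for u, continuous f}.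
  by move=> cf /bW; exact: (Ck_cont (cf 0%N)).
have [C1 [C10 HC1]] := @box_bound R m N d r 'I_N (fun a => pd (lshift N i) (F a))
  (fun a u bu => cont _ _ (Cinf_D _ oW (cF a)) bu).
have [C2 [C20 HC2]] := @box_bound R m N d r ('I_N * 'I_N)%type
  (fun ac => pd (rshift m ac.2) (pd (lshift N i) (F ac.1)))
  (fun a u bu => cont _ _ (Cinf_D _ oW (Cinf_D _ oW (cF a.1))) bu).
have [C3 [C30 HC3]] := @box_bound R m N d r ('I_N * ('I_N * 'I_N))%type
  (fun abc => pd (rshift m abc.2.2) (pd (rshift m abc.2.1) (F abc.1)))
  (fun a u bu => cont _ _ (Cinf_D _ oW (Cinf_D _ oW (cF a.1))) bu).
pose C := C1 + C2 + C3; pose n : R := N%:R.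
have n0 : 0 <= n by rewrite ler0n.
have C0 : 0 <= C by rewrite !addr_ge0.
have D0 : 0 < n * (n * C) * 4 + 4 by rewrite ltr_wpDl // !mulr_ge0.
(* The entries of [D_w^2 F . v] then contribute at most [(1 - k) / 4] to a row sum; the summand [4]
   keeps the denominator positive and gives [p <= (1 - k) / 4]. *)
pose p := (1 - k) / (n * (n * C) * 4 + 4).
have k10 : 0 < 1 - k by rewrite subr_gt0.
have p0 : 0 < p by rewrite divr_gt0.
have E0 : 0 < (n + 1) * (C + 1) by rewrite mulr_gt0 // ltr_wpDl.
(* Two constraints are met at once: [s C <= (1 - k) p], which keeps [v] in its radius, and
   [n s C <= (1 - k) / 4]. Row sums are thus at most [k + (1 - k) / 2 = (1 + k) / 2]. *)
pose s := (1 - k) * p / ((n + 1) * (C + 1)).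
have s0 : 0 < s by rewrite divr_gt0 // mulr_gt0.
have p4 : p <= (1 - k) / 4.
  rewrite /p ler_pM2l // lef_pV2 ?posrE //.
  by rewrite lerDr !mulr_ge0.
have sE : s * ((n + 1) * (C + 1)) = (1 - k) * p by rewrite /s divfK // gt_eqF.
have nC : 0 <= n * C by rewrite mulr_ge0.
have pk : (1 - k) * p <= p by apply: ler_piMl; [exact: ltW|lra].
have sC : s * C <= (1 - k) * p.
  rewrite -sE ler_pM2l //; nra.
have snC : n * (s * C) <= (1 - k) / 4.
  apply: le_trans p4; apply: le_trans pk; rewrite -sE mulrCA ler_pM2l //; nra.
have nnC : n * (n * (C * p)) <= (1 - k) / 4.
  have pE : p * (n * (n * C) * 4 + 4) = 1 - k by rewrite /p divfK // gt_eqF.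
  rewrite ler_pdivlMr // -pE; lra.
exists s, p, ((1 + k) / 2); split => //.
have Ole u : box d (prolong_radius r p) u -> W (base_point u).
  by move=> /base_box[/bW].
split.
- by rewrite divr_ge0 // addr_ge0.
- by rewrite ltr_pdivrMr //; lra.
- by move=> c; rewrite /prolong_radius; case: fintype.split => // _; exact: ltW.
- exists (base_point @^-1` W); split; [exact: open_base|exact: Ole|].
  by move=> c; exact: prolong_smooth.
- move=> c u /base_box[bu hu]; rewrite /prolong /prolong_radius; case: fintype.split => a.
    exact: hself.
  apply: le_trans (ler_normD _ _) _.
  have H1 : `|s * pd (lshift N i) (F a) (base_point u)| <= (1 - k) * p.
    rewrite normrM (gtr0_norm s0); apply: le_trans sC; rewrite ler_pM2l //.
    by apply: le_trans (HC1 a _ bu) _; rewrite /C -addrA lerDl addr_ge0.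
  have H2 : `|\sum_b pd (rshift m b) (F a) (base_point u) * u 0 (rshift m (rshift N b))| <= k * p.
    apply: le_trans (ler_norm_sum _ _ _) _.
    apply: (@le_trans _ _ (\sum_b `|pd (rshift m b) (F a) (base_point u)| * p)).
      by apply: ler_sum => b _; rewrite normrM ler_wpM2l.
    by rewrite -mulr_suml; apply: ler_wpM2r; [exact: ltW|exact: hlip].
  by apply: le_trans (lerD H1 H2) _; rewrite -mulrDl subrK mul1r.
move=> c u bu'; have Wu := Ole _ bu'; have [bu hu] := base_box bu'.
have sumk a : \sum_b `|pd (rshift m b) (F a) (base_point u)| <= k by exact: hlip.
rewrite big_split_ord /=.
case: (fintype.splitP c) => a ca.
  have -> : prolong F i s c = (fun u => F a (base_point u)).
    by apply/funext => v; rewrite /prolong (_ : c = lshift N a) ?split_l //; exact: val_inj.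
  under eq_bigr do rewrite (pd_basel _ oW (cF a 1%N) Wu).
  rewrite [X in _ + X]big1 ?addr0; last first.
    by move=> b _; rewrite (pd_baser _ oW (cF a 1%N) Wu) normr0.
  apply: le_trans (sumk a) _; rewrite ler_pdivlMr //; lra.
have -> : prolong F i s c = (fun u => s * pd (lshift N i) (F a) (base_point u) +
      \sum_b pd (rshift m b) (F a) (base_point u) * u 0 (rshift m (rshift N b))).
  by apply/funext => v; rewrite /prolong (_ : c = rshift N a) ?split_r //; exact: val_inj.
pose f0 v := s * pd (lshift N i) (F a) (base_point v).
pose f1 b v := pd (rshift m b) (F a) (base_point v) * (v : 'rV[R]_(m + (N + N))) 0 (rshift m (rshift N b)).
have oW' := open_base oW.
have cpd j : Ck 1 W (pd j (F a)) by exact: Cinf_D.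
have dbase j e : derivable (fun v => pd j (F a) (base_point v)) u 'e_e.
  apply: diff_derivable.
  by have [] := Ck_diff oW' (Ck_base oW (cpd j)) Wu.
have dcoord (b e : 'I_(m + (N + N))) : derivable (fun v : 'rV[R]_(m + (N + N)) => v 0 b : R) u 'e_e.
  by apply: diff_derivable; exact: differentiable_coord.
have df0 e : derivable f0 u 'e_e by apply: derivableM => //; exact: derivable_cst.
have df1 b e : derivable (f1 b) u 'e_e by exact: derivableM.
have pdE e : pd e (fun v => f0 v + \sum_b f1 b v) u =
    s * pd e (fun v => pd (lshift N i) (F a) (base_point v)) u +
    \sum_b (pd (rshift m b) (F a) (base_point u) * (e == rshift m (rshift N b))%:R +
       u 0 (rshift m (rshift N b)) * pd e (fun v => pd (rshift m b) (F a) (base_point v)) u).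
  rewrite pdD //; last first.
    rewrite (_ : (fun v => \sum_b f1 b v) = \sum_b f1 b); first exact: derivable_sum.
    by apply/funext => v; rewrite fct_sumE.
  congr (_ + _).
    by rewrite /f0 pdM ?[pd e (fun=> s) u]derive_cst ?mulr0 ?addr0 //; exact: derivable_cst.
  rewrite (_ : (fun v => \sum_b f1 b v) = \sum_b f1 b); last first.
    by apply/funext => v; rewrite fct_sumE.
  rewrite /pd derive_sum //; apply: eq_bigr => b _.
  by rewrite -[LHS]/(pd e (f1 b) u) /f1 pdM // pd_coord.
have bound1 b : `|pd (rshift m (lshift N b)) (fun v => f0 v + \sum_b f1 b v) u| <= s * C + n * (C * p).
  rewrite pdE; apply: le_trans (ler_normD _ _) _; apply: lerD.
    rewrite (pd_basel _ oW (cpd _) Wu) normrM (gtr0_norm s0) ler_pM2l //.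
    apply: le_trans (HC2 (a, b) _ bu) _; rewrite /C; lra.
  apply: le_trans (ler_norm_sum _ _ _) _.
  apply: (@le_trans _ _ (\sum_(e < N) C * p)); last first.
    by rewrite sumr_const card_ord -mulr_natl.
  apply: ler_sum => e _.
  rewrite eq_rshift eq_lrshift mulr0 add0r (pd_basel _ oW (cpd _) Wu) normrM mulrC.
  apply: ler_pM => //.
  apply: le_trans (HC3 (a, (e, b)) _ bu) _; rewrite /C; lra.
have bound2 b : pd (rshift m (rshift N b)) (fun v => f0 v + \sum_b f1 b v) u =
    pd (rshift m b) (F a) (base_point u).
  rewrite pdE (pd_baser _ oW (cpd _) Wu) mulr0 add0r (bigD1 b) //= eqxx mulr1.
  rewrite (pd_baser _ oW (cpd _) Wu) mulr0 addr0 big1 ?addr0 // => e eb.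
  by rewrite (pd_baser _ oW (cpd _) Wu) mulr0 addr0 !eq_rshift eq_sym (negbTE eb) mulr0.
apply: (@le_trans _ _ (\sum_(b < N) (s * C + n * (C * p)) + k)).
  apply: lerD; first by apply: ler_sum => b _; exact: bound1.
  by apply: le_trans (sumk a); apply: ler_sum => b _; rewrite bound2.
rewrite sumr_const card_ord -mulr_natl -/n; lra.
Qed.

(** Both iterations start from 0. A derivative passes through [smoother] at the cost of
    [shift_weight], and the chain rule applied to [F a (row_mx y (w y))] produces exactly the second
    half of [prolong], up to the factor [s]. *)
Lemma picard_prolong N (F : 'I_N -> 'rV[R]_(m + N) -> R) t r k i s : contractive d F r k ->
  forall n x, B x ->
  (forall a, picard l (prolong F i s) (prolong_weight l t i) n x 0 (lshift N a) = picard l F t n x 0 a) /\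
  (forall a, picard l (prolong F i s) (prolong_weight l t i) n x 0 (rshift N a) =
     s * pd i (fun y => picard l F t n y 0 a) x).
Proof.
move=> HF; have [k0 k1 r0 [W [oW bW cF]] hself hlip] := HF.
have sB := @star_origin_ball R m l d; have oB := @open_origin_ball R m d.
elim=> [|n IH] x Bx.
  split=> a /=; first by rewrite !mxE.
  rewrite mxE (_ : (fun y => _) = fun=> 0) ?[pd i _ x]derive_cst ?mulr0 //.
  by apply/funext => y; rewrite mxE.
have [cw wr] := picard_in_box l t n HF.
have gW y : B y -> W (row_mx y (picard l F t n y)).
  by move=> By; apply: bW; apply: box_row => //; exact: wr.
have Ebase y : B y -> base_point (row_mx y (picard l (prolong F i s) (prolong_weight l t i) n y)) =
    row_mx y (picard l F t n y).
  move=> /IH[h1 h2]; rewrite -[X in row_mx y X]hsubmxK base_row; congr row_mx.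
  by apply/rowP => a; rewrite mxE h1.
split=> a.
  rewrite [LHS]mxE [RHS]mxE /prolong_weight split_l; apply: (eq_smoother (U := B)) => // y By.
  by rewrite /prolong split_l Ebase.
have cg := graph_smooth a HF (conj cw wr).
rewrite [LHS]mxE /prolong_weight split_r.
rewrite [X in pd i X](_ : _ = smoother l (t a) (fun y => F a (row_mx y (picard l F t n y)))); last first.
  by apply/funext => y; rewrite mxE.
rewrite (pd_smoother _ _ oB sB (cg 1%N) Bx) -(smootherZ (U := B)) //; last first.
  by move=> y By; apply: (Ck_cont (Cinf_D _ oB cg 0%N) By).
apply: (eq_smoother (U := B)) => // y By.
rewrite /prolong split_r Ebase // (pd_graph i oB oW gW (cF a 1%N) (fun b => cw b 1%N) By).
rewrite mulrDr mulr_sumr; congr (_ + _); apply: eq_bigr => b _.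
by rewrite !row_mxEr (IH y By).2 mulrCA.
Qed.

(** Quantified over all systems, because the induction on the order of differentiation replaces a
    system by its prolongation, which has twice as many unknowns: a first derivative of the iterates
    is a component of the prolonged iterates divided by [s]. *)
Lemma picard_UC j : forall N (F : 'I_N -> 'rV[R]_(m + N) -> R) t r k, contractive d F r k ->
  forall a, UCk B j (fun n x => picard l F t n x 0 a).
Proof.
elim: j => [|j IH] N F t r k HF a.
  split=> //; exists (\sum_b r b), k; split; [exact: ctr_ge0 HF|exact: ctr_lt1 HF|].
  by move=> n x Bx; exact: picard_geometric HF n x Bx a.
split=> [|i].
  exists (\sum_b r b), k; split; [exact: ctr_ge0 HF|exact: ctr_lt1 HF|].
  by move=> n x Bx; exact: picard_geometric HF n x Bx a.
have [s [p [k' [s0 HF']]]] := prolong_contractive i HF.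
have := IH _ _ (prolong_weight l t i) _ _ HF' (rshift N a).
apply: (UCk_scale (@open_origin_ball _ _ _) (c := s^-1)).
  by move=> n; exact: (picard_in_box l (prolong_weight l t i) n HF').1.
move=> n x Bx; rewrite (picard_prolong t i s HF n Bx).2 mulKf //.
by rewrite gt_eqF.
Qed.

Theorem contractive_solution N (F : 'I_N -> 'rV[R]_(m + N) -> R) t r k : contractive d F r k ->
  exists w : 'rV[R]_m -> 'rV[R]_N, in_box d r w /\
    forall x, B x -> forall a, w x 0 a = smoother l (t a) (fun y => F a (row_mx y (w y))) x.
Proof.
move=> HF.
have oB := @open_origin_ball R m d.
have UC j a : UCk B j (fun n x => picard l F t n x 0 a) by exact: picard_UC HF a.
have pb n := picard_in_box l t n HF.
have [g Hg] := choice (fun a => UC_ulim (UC 0%N a)).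
pose w x := \row_a g a x.
have wE a x : w x 0 a = g a x by rewrite mxE.
have wb : in_box d r w.
  split=> [a j|x Bx a].
    apply: (Ck_ext oB (f := g a)); first by move=> x _; rewrite wE.
    by apply: (UC_Ck oB _ (UC j a) (Hg a)) => n; exact: (pb n).1.
  rewrite wE; apply/ler_addgt0Pr => e e0; have [n0 H] := Hg a e e0.
  have := H n0 x (leqnn _) Bx; rewrite distrC => h.
  rewrite -[g a x](subrK (picard l F t n0 x 0 a)) addrC.
  by apply: le_trans (ler_normD _ _) _; apply: lerD => //; exact: (pb n0).2.
exists w; split => // x Bx a.
apply/eqP; rewrite -subr_eq0 -normr_le0; apply/ler_addgt0Pr => e e0; rewrite add0r.
have e20 : 0 < e / 2 by rewrite divr_gt0.
have [n1 H1] : exists n0, forall b n x, (n0 <= n)%N -> B x -> `|picard l F t n x 0 b - g b x| <= e / 2.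
  have [n0 Hn0] := choice (fun b => Hg b _ e20).
  exists (\max_b n0 b) => b n y nn By; apply: Hn0 => //; apply: leq_trans nn.
  exact: leq_bigmax.
have HC := graph_contract l t HF (pb n1) wb (ltW e20) _ Bx a.
rewrite -(subrKA (picard l F t n1.+1 x 0 a)) (splitr e).
apply: le_trans (ler_normD _ _) _; apply: lerD.
  by rewrite distrC wE; apply: H1.
rewrite [picard _ _ _ _ _ _ _]mxE; apply: le_trans (HC _) _.
  by move=> y By b; rewrite wE; exact: H1.
by rewrite ler_piMl ?ltW // (ctr_lt1 HF).
Qed.

End Solution.

(** * Fixed points of systems with triangular linear part *)

Section Triangular.
Context {R : realType} {m N : nat} (l : 'I_m).
Variables (F : 'I_N -> 'rV[R]_(m + N) -> R) (t : 'I_N -> nat) (O : set 'rV[R]_(m + N)).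

Let sc (e : R) (j : 'I_(m + N)) : R :=
  match fintype.split j with inl _ => 1 | inr b => e ^- b end.
Let sm (e : R) (u : 'rV[R]_(m + N)) : 'rV[R]_(m + N) := \row_j (sc e j * u 0 j).
Let G (e : R) (a : 'I_N) (u : 'rV[R]_(m + N)) : R := e ^+ a * F a (sm e u).

(* Replacing the a-th unknown by e^a times itself multiplies the entries of
   D_w F(0) below the diagonal by powers of e, so that for small e only the
   diagonal limits the contraction constant. *)
Lemma triangular_solution (a0 : 'I_N) : open O -> O 0 -> (forall a, Cinf O (F a)) ->
  (forall a, F a 0 = 0) ->
  (forall a b : 'I_N, (a < b)%N -> pd (rshift m b) (F a) 0 = 0) ->
  (forall a, `|pd (rshift m a) (F a) 0| <= 1 / 2) ->
  exists (d : R) (w : 'rV[R]_m -> 'rV[R]_N), [/\ 0 < d,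
    forall a, Cinf (origin_ball d) (fun x => w x 0 a),
    forall x, origin_ball d x -> O (row_mx x (w x)) &
    forall x, origin_ball d x -> forall a,
      w x 0 a = smoother l (t a) (fun y => F a (row_mx y (w y))) x].
Proof.
move=> oO O0 cF F0 Ftri Fdiag.
pose C := \sum_a \sum_b `|pd (rshift m b) (F a) 0|.
have C0 : 0 <= C by apply: sumr_ge0 => a _; exact: sumr_ge0.
(* Row sums of the rescaled Jacobian are then at most [1/2 + e C <= 5/8] at the origin and [3/4] on
   a small box; the remaining quarter of the radius absorbs the value of [G] at zero unknowns. *)
pose e : R := (8 * (C + 1))^-1.
have e0 : 0 < e by rewrite invr_gt0 mulr_gt0 // ltr_wpDl.
have eC : e * C <= 1 / 8.
  have E : e * (8 * (C + 1)) = 1 by rewrite mulVf // gt_eqF // mulr_gt0 // ltr_wpDl.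
  nra.
have e1 : e <= 1.
  have E : e * (8 * (C + 1)) = 1 by rewrite mulVf // gt_eqF // mulr_gt0 // ltr_wpDl.
  nra.
have scl j : sc e (lshift N j) = 1 by rewrite /sc (unsplitK (inl j : 'I_m + 'I_N)%type).
have scr b : sc e (rshift m b) = e ^- b by rewrite /sc (unsplitK (inr b : 'I_m + 'I_N)%type).
have smE j : (fun u => sm e u 0 j) = (fun u => sc e j * u 0 j).
  by apply/funext => u; rewrite mxE.
have sm0 : sm e 0 = 0 by apply/rowP => j; rewrite !mxE mulr0.
pose O' := sm e @^-1` O.
have csm j k U : open U -> Ck k U (fun u => sm e u 0 j).
  by move=> oU; rewrite smE; apply: CkM => //; [exact: Ck_cst|exact: Ck_coord].
have oO' : open O'.
  apply: open_comp oO => u _; apply: continuous_row => j.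
  exact: (Ck_cont (csm j 0%N _ openT)).
have cG a : Cinf O' (G e a).
  move=> k; apply: CkM => //; first exact: Ck_cst.
  by apply: (Ck_comp oO' oO _ (cF a k)) => // j; exact: csm.
have pdG a j u : O' u -> pd j (G e a) u = e ^+ a * (sc e j * pd j (F a) (sm e u)).
  move=> Ou; have [dF _] := Ck_diff oO (cF a 1%N) Ou.
  have dsm i : differentiable (fun u => sm e u 0 i : R) u.
    by have [] := Ck_diff openT (csm i 1%N _ openT) (I : setT u).
  have dFs : differentiable (fun u => F a (sm e u)) u.
    by apply: differentiable_comp => //; exact: differentiable_row.
  rewrite /G pdZ; last exact: diff_derivable.
  congr (_ * _); rewrite /pd (derive_comp (f := F a) (g := sm e)) // (bigD1 j) //= big1 ?addr0; last first.
    move=> i ij; rewrite smE -[X in _ * X]/(pd j _ u) pdZ ?pd_coord.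
      by rewrite eq_sym (negbTE ij) !mulr0.
    exact/diff_derivable/differentiable_coord.
  rewrite smE -[X in _ * X = _]/(pd j _ u) pdZ ?pd_coord ?eqxx ?mulr1 1?mulrC //.
  exact/diff_derivable/differentiable_coord.
have O'0 : O' 0 by rewrite /O' /= sm0.
have sum0 a : \sum_b `|pd (rshift m b) (G e a) 0| <= 5 / 8.
  apply: (@le_trans _ _ (1 / 2 + \sum_b e * `|pd (rshift m b) (F a) 0|)); last first.
    rewrite -mulr_sumr; apply: (@le_trans _ _ (1 / 2 + e * C)); last lra.
    rewrite lerD2l ler_pM2l // /C [leRHS](bigD1 a) //= lerDl.
    by apply: sumr_ge0 => b _; exact: sumr_ge0.
  rewrite (bigD1 a) //= [X in _ <= _ + X](bigD1 a) //= addrA; apply: lerD.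
    rewrite pdG // sm0 scr mulrA mulfV ?mul1r ?expf_neq0 ?gt_eqF //.
    have := Fdiag a; have := mulr_ge0 (ltW e0) (normr_ge0 (pd (rshift m a) (F a) 0)); lra.
  apply: ler_sum => b ba; rewrite pdG // sm0 scr.
  case: (ltngtP a b) => [ab|ba'|ab]; last by move: ba; rewrite (val_inj ab) eqxx.
    by rewrite Ftri // !mulr0 normr0 mulr0.
  rewrite mulrA normrM; apply: ler_wpM2r => //.
  rewrite -(subnK (ltnW ba')) exprD mulfK ?expf_neq0 ?gt_eqF //.
  rewrite ger0_norm; last by rewrite exprn_ge0 // ltW.
  move: ba'; rewrite -subn_gt0; case: (a - b)%N => // k _; rewrite exprS ler_piMr //.
    exact: ltW.
  by apply: exprn_ile1 => //; exact: ltW.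
have near1 a : \forall u \near (0 : 'rV[R]_(m + N)), O' u /\ \sum_b `|pd (rshift m b) (G e a) u| <= 3 / 4.
  have cs : {for 0, continuous (fun u => \sum_b `|pd (rshift m b) (G e a) u|)}.
    apply: continuous_sum_at => b; apply: continuous_comp; last exact: norm_continuous.
    exact: (Ck_cont (Cinf_D _ oO' (cG a) 0%N) O'0).
  have /cvgrPdist_le/(_ (1 / 8)) H := cs.
  have := open_nbhs_nbhs (conj oO' O'0); apply: filterS2 (H _) => //.
  move=> u /= h1 h2; split => //; have := sum0 a; have := ler_norm (- (\sum_b `|pd (rshift m b) (G e a) 0| -
     \sum_b `|pd (rshift m b) (G e a) u|)); rewrite normrN; lra.
have [d1 d10 H1] := (nbhs_dist _ _).1 (filter_forall _ near1).
pose r := d1 / 2.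
have r0 : 0 < r by rewrite divr_gt0.
have near2 a : \forall u \near (0 : 'rV[R]_(m + N)), `|G e a u| <= r / 4.
  have /cvgrPdist_le/(_ (r / 4)) := Ck_cont (cG a 0%N) O'0.
  rewrite /G sm0 F0 mulr0 divr_gt0 // => /(_ isT); apply: filterS => u.
  by rewrite sub0r normrN.
have [d2 d20 H2] := (nbhs_dist _ _).1 (filter_forall _ near2).
(* The radius [r] of the unknowns is fixed first. Shrinking the range of [x] afterwards keeps the
   contraction and makes the values at zero unknowns at most [r / 4]. *)
pose d := Num.min d1 d2 / 2.
have d0 : 0 < d by rewrite divr_gt0 // lt_min d10.
have dd1 : d < d1.
  rewrite /d; apply: le_lt_trans (_ : d1 / 2 < _); last by rewrite ltr_pdivrMr // ltr_pMr // ltr1n.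
  by rewrite ler_pM2r // ge_min lexx.
have dd2 : d < d2.
  rewrite /d; apply: le_lt_trans (_ : d2 / 2 < _); last by rewrite ltr_pdivrMr // ltr_pMr // ltr1n.
  by rewrite ler_pM2r // ge_min lexx orbT.
have rd1 : r < d1 by rewrite /r ltr_pdivrMr // ltr_pMr // ltr1n.
have boxin u : box d (fun=> r) u -> forall a, O' u /\ \sum_b `|pd (rshift m b) (G e a) u| <= 3 / 4.
  move=> [h1 h2]; apply: H1; rewrite subr0; apply: norm_row_lt => // j.
  case: (split_ordP j) => i ->.
    exact: le_lt_trans (h1 i) dd1.
  exact: le_lt_trans (h2 i) rd1.
have boxO' : box d (fun=> r) `<=` O' by move=> u /boxin/(_ a0)[].
have HG : contractive d (G e) (fun=> r) (3 / 4).
  split=> //.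
  - by lra.
  - by move=> a; exact: ltW.
  - by exists O'.
  - move=> a u bu.
    have bu0 : box d (fun=> r) (row_mx (lsubmx u) (0 : 'rV[R]_N)).
      have [h1 _] := bu; split=> [i|b]; first by rewrite row_mxEl mxE.
      by rewrite row_mxEr mxE normr0 ltW.
    have hlip v : box d (fun=> r) v -> \sum_b `|pd (rshift m b) (G e a) v| <= 3 / 4.
      by move=> /boxin/(_ a)[].
    have := box_lipschitz (ltW r0) oO' boxO' (cG a) hlip (w := rsubmx u) (w' := 0) (x := lsubmx u).
    rewrite hsubmxK => /(_ bu bu0).
    have hb b : `|rsubmx u 0 b - (0 : 'rV[R]_N) 0 b| <= r.
      by rewrite [X in _ - X]mxE subr0 mxE; have [_ ] := bu; exact.
    move=> /(_ hb) L.
    have G0 : `|G e a (row_mx (lsubmx u) (0 : 'rV[R]_N))| <= r / 4.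
      apply: H2; rewrite subr0; apply: norm_row_lt => // j.
      case: (split_ordP j) => i ->.
        have [h1 _] := bu0; exact: le_lt_trans (h1 i) dd2.
      by rewrite row_mxEr mxE normr0.
    rewrite -[G e a u](subrK (G e a (row_mx (lsubmx u) 0))).
    apply: le_trans (ler_normD _ _) _; lra.
  - by move=> a u /boxin/(_ a)[].
have [w [[cw wr] weq]] := contractive_solution l t HG.
have oB := @open_origin_ball R m d; have sB := @star_origin_ball R m l d.
pose w' x : 'rV[R]_N := \row_b (e ^- b * w x 0 b).
have smw x : sm e (row_mx x (w x)) = row_mx x (w' x).
  apply/rowP => j; rewrite mxE; case: (split_ordP j) => i ->.
    by rewrite scl mul1r !row_mxEl.
  by rewrite scr !row_mxEr mxE.
have cw' a : Cinf (origin_ball d) (fun x => w' x 0 a).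
  move=> k; apply: (Ck_ext oB (f := fun x => e ^- a * w x 0 a)); first by move=> x _; rewrite mxE.
  by apply: CkM => //; [exact: Ck_cst|exact: cw].
have Ow x : origin_ball d x -> O (row_mx x (w' x)).
  by move=> xd; have : O' (row_mx x (w x)); [apply: boxO'; apply: box_row|rewrite /O' /= smw] => //; exact: wr.
exists d, w'; split => // x xd a.
rewrite mxE weq //.
have -> : smoother l (t a) (fun y => G e a (row_mx y (w y))) x =
    smoother l (t a) (fun y => e ^+ a * F a (row_mx y (w' y))) x.
  by apply: (eq_smoother (U := origin_ball d)) => // y yd; rewrite /G smw.
rewrite (smootherZ (U := origin_ball d)) // ?mulKf ?expf_neq0 ?gt_eqF //.
move=> y yd; apply: (@Ck_cont _ _ 0 (origin_ball d) (fun y => F a (row_mx y (w' y)))) => //.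
by apply: (Ck_graph oB oO Ow); [exact: cF|move=> b; exact: cw'].
Qed.

End Triangular.

(** * The inverse function theorem *)

Section InverseFunction.
Context {R : realType} {m : nat}.

Lemma continuous_at_ball (f : 'rV[R]_m -> 'rV[R]_m) (x : 'rV[R]_m) (e : R) :
  {for x, continuous f} -> 0 < e -> \forall y \near x, `|f y - f x| < e.
Proof.
by move=> /cvgrPdist_lt h /h; apply: filterS => y; rewrite distrC.
Qed.

(** A point [v] with [f (x0 + v) = f x0 + z] is a fixed point of [F (z, v)], the Newton step with
    the Jacobian frozen at [x0]. The derivative of [F] in [v] vanishes at 0, so
    [triangular_solution] applies, with all indices of [smoother] equal to 0. As [J i j] is the
    derivative of the [j]-th component along [e_i], increments are row vectors and [A] acts on the
    right. *)
Lemma inverse_function (f : 'rV[R]_m -> 'rV[R]_m) (U : set 'rV[R]_m) x0 :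
  open U -> U x0 -> (forall j, Cinf U (fun x => f x 0 j)) ->
  \matrix_(i, j) pd i (fun x => f x 0 j) x0 \in unitmx -> 'I_m ->
  exists (U' V : set 'rV[R]_m) (g : 'rV[R]_m -> 'rV[R]_m),
    [/\ open U', open V, U' x0 & U' `<=` U] /\
    [/\ forall x, U' x -> V (f x) /\ g (f x) = x,
        forall y, V y -> U' (g y) /\ f (g y) = y &
        forall j, Cinf V (fun y => g y 0 j)].
Proof.
move=> oU Ux0 cf; set J := \matrix_(i, j) _ => uJ a0.
pose A := invmx J.
pose D (u : 'rV[R]_(m + m)) b := f (x0 + rsubmx u) 0 b - f x0 0 b - u 0 (lshift m b).
pose F a (u : 'rV[R]_(m + m)) := u 0 (rshift m a) - \sum_b A b a * D u b.
pose W := [set u : 'rV[R]_(m + m) | U (x0 + rsubmx u)].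
have crs k V j : open V -> Ck k V (fun u : 'rV[R]_(m + m) => (x0 + rsubmx u) 0 j).
  move=> oV; apply: (Ck_ext oV (f := fun u => x0 0 j + u 0 (rshift m j))).
    by move=> u _; rewrite !mxE.
  by apply: CkD => //; [exact: Ck_cst|exact: Ck_coord].
have oW : open W.
  apply: open_comp oU => u _; apply: continuous_row => j.
  exact: (Ck_cont (crs 0%N _ j openT)).
have rs0 : rsubmx (0 : 'rV[R]_(m + m)) = 0 by apply/rowP => j; rewrite !mxE.
have W0 : W 0 by rewrite /W /= rs0 addr0.
have cfx b : Cinf W (fun u => f (x0 + rsubmx u) 0 b).
  move=> k; apply: (Ck_comp (f := fun x => f x 0 b) (g := fun u => x0 + rsubmx u) oW oU _ (cf b k)) => // j.
  exact: crs.
have cD b : Cinf W (D ^~ b).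
  move=> k; apply: CkB => //; last exact: Ck_coord.
  by apply: CkB => //; [exact: cfx|exact: Ck_cst].
have cF a : Cinf W (F a).
  move=> k; apply: CkB => //; first exact: Ck_coord.
  by apply: Ck_sum => // b _; apply: CkM => //; [exact: Ck_cst|exact: cD].
have D0 b : D 0 b = 0 by rewrite /D rs0 addr0 subrr mxE subrr.
have F0 a : F a 0 = 0.
  by rewrite /F mxE sub0r big1 ?oppr0 // => b _; rewrite D0 mulr0.
have pdF a c : pd (rshift m c) (F a) 0 = 0.
  have pdD0 b : pd (rshift m c) (D ^~ b) 0 = J c b.
    have dcf : differentiable (fun x => f x 0 b) (x0 + rsubmx (0 : 'rV[R]_(m + m))).
      by rewrite rs0 addr0; have [] := Ck_diff oU (cf b 1%N) Ux0.
    have drs j : differentiable (fun u : 'rV[R]_(m + m) => (x0 + rsubmx u) 0 j : R) 0.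
      by have [] := Ck_diff openT (crs 1%N setT j openT) (I : setT 0).
    have E : pd (rshift m c) (fun u => f (x0 + rsubmx u) 0 b) 0 = J c b.
      rewrite /pd (derive_comp (f := fun x => f x 0 b) (g := fun u => x0 + rsubmx u)) //.
      have Ej j : 'D_('e_(rshift m c)) (fun u : 'rV[R]_(m + m) => (x0 + rsubmx u) 0 j : R) 0 = (c == j)%:R.
        rewrite (_ : (fun u => _) = fun u : 'rV[R]_(m + m) => x0 0 j + u 0 (rshift m j)); last first.
          by apply/funext => u; rewrite !mxE.
        rewrite -[LHS]/(pd _ _ 0) pdD; [|exact: derivable_cst|exact/diff_derivable/differentiable_coord].
        by rewrite pd_cst add0r pd_coord eq_rshift.
      rewrite (bigD1 c) // Ej eqxx mulr1 big1 ?addr0.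
        by rewrite /= !addr0 rs0 addr0 mxE.
      by move=> j /= jc; rewrite Ej eq_sym (negbTE jc) mulr0.
    have dd := Ck_derivable (i := rshift m c) (cfx b 1%N) W0.
    rewrite /D (_ : (fun u => _) = fun u => f (x0 + rsubmx u) 0 b + (- f x0 0 b + - u 0 (lshift m b))); last first.
      by apply/funext => u; rewrite addrA.
    have dc : derivable (fun u : 'rV[R]_(m + m) => u 0 (lshift m b) : R) 0 'e_(rshift m c).
      exact/diff_derivable/differentiable_coord.
    have dN := derivableN dc.
    have d1 : derivable (fun u : 'rV[R]_(m + m) => - f x0 0 b + - u 0 (lshift m b)) 0 'e_(rshift m c).
      by apply: derivableD; [exact: derivable_cst|exact: dN].
    rewrite (pdD dd d1) pdD; [|exact: derivable_cst|exact: dN].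
    by rewrite pd_cst (pdN dc) pd_coord eq_rlshift oppr0 !addr0.
  have dD b := Ck_derivable (i := rshift m c) (cD b 1%N) W0.
  have dAD b : derivable (fun u => A b a * D u b) 0 'e_(rshift m c).
    by apply: derivableM; [exact: derivable_cst|exact: dD].
  have cS : Ck 1 W (fun u => \sum_b A b a * D u b).
    by apply: Ck_sum => // b _; apply: CkM => //; [exact: Ck_cst|exact: cD].
  have dS := Ck_derivable (i := rshift m c) cS W0.
  have dca : derivable (fun u : 'rV[R]_(m + m) => u 0 (rshift m a) : R) 0 'e_(rshift m c).
    exact/diff_derivable/differentiable_coord.
  rewrite /F (pdD dca (derivableN dS)) (pdN dS) pd_coord (pd_sum dAD).
  rewrite (eq_bigr (fun b => J c b * A b a)); last first.
    by move=> b _; rewrite (pdZ _ (dD b)) pdD0 mulrC.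
  have := mulmxV uJ => /matrixP/(_ c a); rewrite !mxE => ->.
  by rewrite eq_rshift subrr.
have near1 a : \forall u \near (0 : 'rV[R]_(m + m)), W u /\ \sum_b `|pd (rshift m b) (F a) u| <= 1 / 2.
  have cs : {for 0, continuous (fun u => \sum_b `|pd (rshift m b) (F a) u|)}.
    apply: continuous_sum_at => b; apply: continuous_comp; last exact: norm_continuous.
    exact: (Ck_cont (Cinf_D _ oW (cF a) 0%N) W0).
  have /cvgrPdist_le/(_ (1 / 2)) H := cs.
  have := open_nbhs_nbhs (conj oW W0); apply: filterS2 (H _) => //.
  move=> u /= h1 h2; split => //; move: h1.
  rewrite big1 ?sub0r ?normrN; last by move=> b _; rewrite pdF normr0.
  by apply: le_trans; exact: ler_norm.
have [p p0 Hp] := (nbhs_dist _ _).1 (filter_forall _ near1).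
pose O := [set u : 'rV[R]_(m + m) | `|u| < p].
have OW : O `<=` W by move=> u up; have [] := Hp u _ a0; rewrite ?subr0.
have oO : open O by exact: (@open_origin_ball R (m + m) p).
have [||||||d [w [d0 cw wO weq]]] := @triangular_solution R m m a0 F (fun=> 0) O a0.
- exact: oO.
- by rewrite /O /= normr0.
- by move=> a k; exact: (Ck_sub OW (cF a k)).
- exact: F0.
- by move=> a b _; exact: pdF.
- by move=> a; rewrite pdF normr0 divr_ge0.
have wp z : `|z| < d -> `|w z| < p.
  move=> /wO; rewrite /O /=; apply: le_lt_trans; apply: norm_row_le => // i.
  by rewrite -(row_mxEr z); exact: coord_norm.
have fw z : `|z| < d -> f (x0 + w z) = f x0 + z.
  move=> zd; have E a : \sum_b D (row_mx z (w z)) b * A b a = 0.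
    have := weq z zd a; rewrite /= /F row_mxEr; set S := \sum_b _ => H.
    have S0 : S = 0 by lra.
    by rewrite -[RHS]S0 /S; apply: eq_bigr => b _; rewrite mulrC.
  have E2 : (\row_b D (row_mx z (w z)) b) *m A = 0.
    by apply/rowP => a; rewrite !mxE -[RHS](E a); apply: eq_bigr => b _; rewrite mxE.
  have E3 : \row_b D (row_mx z (w z)) b = 0.
    by rewrite -[LHS](mulmxK uJ) -/A -mulmxA -[X in X *m _](mulmxKV uJ) -/A E2 !mul0mx.
  apply/rowP => b; have /rowP/(_ b) := E3; rewrite mxE [RHS]mxE /D row_mxKr row_mxEl => /eqP.
  by rewrite -addrA -opprD subr_eq0 => /eqP ->; rewrite mxE.
(* Uniqueness comes from the contraction estimate at [z = 0]: if the two values of [f] agree,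
   [F (0, v) - F (0, v')] equals [v - v'], yet its norm is at most half of that of [v - v']. The
   radius [r] fits a closed box containing both points inside the open ball of radius [p]. *)
have inj v v' : `|v| < p -> `|v'| < p -> f (x0 + v) = f (x0 + v') -> v = v'.
  move=> vp vp' fv; pose r := (Num.max `|v| `|v'| + p) / 2.
  have M0 : 0 <= Num.max `|v| `|v'| by rewrite le_max normr_ge0.
  have Mp : Num.max `|v| `|v'| < p by rewrite gt_max vp.
  have r0 : 0 < r by rewrite /r; lra.
  have rp : r < p by rewrite /r; lra.
  have Mr : Num.max `|v| `|v'| <= r by rewrite /r; lra.
  have boxp (u : 'rV[R]_(m + m)) : box r (fun=> r) u -> `|u - 0| < p.
    move=> [h1 h2]; rewrite subr0; apply: norm_row_lt => // j.
    case: (split_ordP j) => i ->.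
      exact: le_lt_trans (h1 i) rp.
    exact: le_lt_trans (h2 i) rp.
  have bv (x : 'rV[R]_m) : `|x| <= Num.max `|v| `|v'| -> box r (fun=> r) (row_mx (0 : 'rV[R]_m) x).
    move=> xM; apply: box_row; rewrite ?normr0 // => a.
    by apply: le_trans (coord_norm _ _) _; exact: le_trans Mr.
  apply/eqP; rewrite -subr_eq0 -normr_le0.
  suff : `|v - v'| <= 1 / 2 * `|v - v'| by lra.
  apply: norm_row_le => [|a]; first by rewrite mulr_ge0 // divr_ge0.
  have FE : F a (row_mx 0 v) - F a (row_mx 0 v') = (v - v') 0 a.
    rewrite /F /D !row_mxEr mxE [X in _ = _ + X]mxE.
    set S := \sum_b _; set S' := \sum_b _.
    have -> : S = S' by apply: eq_bigr => b _; rewrite !row_mxKr !row_mxEl fv.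
    by ring.
  rewrite -FE; apply: (box_lipschitz (O := W) (d := r) (r := fun=> r)) => //.
  - by move=> u /boxp/Hp/(_ a)[].
  - by move=> u /boxp/Hp/(_ a)[].
  - by apply: bv; rewrite le_max lexx.
  - by apply: bv; rewrite le_max lexx orbT.
  - by move=> b; have := coord_norm (v - v') b; rewrite mxE [X in _ + X]mxE.
(* The first condition makes [inj] applicable, the second one puts [f x] in the second set. *)
exists [set x | `|x - x0| < p /\ `|f x - f x0| < d], [set y | `|y - f x0| < d],
  (fun y => x0 + w (y - f x0)).
have Usub x : `|x - x0| < p -> U x.
  move=> xp; have := OW (row_mx 0 (x - x0)); rewrite /W /= row_mxKr (addrC x0) subrK; apply.
  rewrite /O /=; apply: norm_row_lt => // j.
  case: (split_ordP j) => i ->.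
    by rewrite row_mxEl mxE normr0.
  by rewrite row_mxEr; apply: le_lt_trans (coord_norm _ _) xp.
have ball_open (c : 'rV[R]_m) (e : R) : open [set y | `|y - c| < e].
  rewrite openE => y yc; apply/nbhs_dist; exists (e - `|y - c|); first by rewrite subr_gt0.
  move=> z; rewrite ltrBrDr; apply: le_lt_trans.
  by rewrite -(subrKA y); exact: ler_normD.
split; split.
- rewrite openE => x [xp fx].
  have /continuous_at_ball : {for x, continuous f}.
    apply: continuous_row => j; exact: (Ck_cont (cf j 0%N) (Usub _ xp)).
  move=> /(_ (d - `|f x - f x0|)); rewrite subr_gt0 => /(_ fx).
  have := open_nbhs_nbhs (conj (ball_open x0 p) xp).
  apply: filterS2 => y /= yp; rewrite ltrBrDr => fy; split => //.
  by apply: le_lt_trans fy; rewrite -(subrKA (f x)); exact: ler_normD.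
- exact: ball_open.
- by rewrite /= !subrr !normr0.
- by move=> x [/Usub].
- move=> x [xp fx]; split => //=.
  have := inj (w (f x - f x0)) (x - x0) (wp _ fx) xp.
  by rewrite fw // ![in f (x0 + (x - x0))]addrC !subrK => -> //; rewrite addrC subrK.
- move=> y yd; rewrite /= fw // [x0 + _]addrC addrK [f x0 + _]addrC subrK.
  by split => //; split => //; exact: wp.
- move=> j k.
  have cyf i V : open V -> Ck k V (fun y : 'rV[R]_m => (y - f x0) 0 i).
    move=> oV; apply: (Ck_ext oV (f := fun y => y 0 i - f x0 0 i)); first by move=> y _; rewrite !mxE.
    by apply: CkB => //; [exact: Ck_coord|exact: Ck_cst].
  apply: (Ck_ext (ball_open _ _) (f := fun y => x0 0 j + w (y - f x0) 0 j)).
    by move=> y _; rewrite mxE.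
  apply: CkD => //; [exact: Ck_cst|].
  apply: (Ck_comp (f := fun z => w z 0 j) (g := fun y => y - f x0) (ball_open _ _) (@open_origin_ball _ _ d) _ (cw j k)) => //.
  by move=> i; exact: cyf.
Qed.

End InverseFunction.

(** * Geodesics issued from a polar hyperplane *)

Section Schwarz.
Context {R : realType} {m : nat} (l : 'I_m).

(* Since f = f|_(x_l = 0) + x_l avg(d_l f), and likewise for d_c f, [avg_ode]
   computes d_l d_c f. *)
Lemma schwarz (U : set 'rV[R]_m) (f : 'rV[R]_m -> R) c x : open U -> star l U ->
  Cinf U f -> c != l -> U x -> pd l (pd c f) x = pd c (pd l f) x.
Proof.
move=> oU sU cf cl Ux.
have clf : Cinf U (pd l f) by exact: Cinf_D.
pose g := pd c (pd l f); have cg : Cinf U g by exact: Cinf_D.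
pose f0 y := f (rescale l 0 y).
have ca : Cinf U (avg l 0 (pd l f)) by move=> k; apply: avg_Ck => //; exact: clf.
have cag : Cinf U (avg l 0 g) by move=> k; apply: avg_Ck => //; exact: cg.
have cxl k : Ck k U (fun y => y 0 l) by exact: Ck_coord.
have fE y : U y -> f y = f0 y + y 0 l * avg l 0 (pd l f) y.
  by move=> Uy; apply: Hadamard oU sU (cf 1%N) Uy.
have cf0 : Cinf U f0.
  move=> k; apply: (Ck_ext oU (f := fun y => f y - y 0 l * avg l 0 (pd l f) y)).
    by move=> y Uy; rewrite fE // addrK.
  by apply: (CkB oU); [exact: cf|apply: (CkM oU); [exact: cxl|exact: ca]].
have pcE y : U y -> pd c f y = pd c f0 y + y 0 l * avg l 0 g y.
  move=> Uy; rewrite (eq_pd c oU fE Uy) pdD; [|exact: (Cinf_derivable cf0 Uy)|].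
    rewrite pdM; [|exact/diff_derivable/differentiable_coord|exact: (Cinf_derivable ca Uy)].
    rewrite pd_coord (negbTE cl) mulr0 addr0 (pd_avg _ _ oU sU (clf 1%N) Uy).
    by rewrite (negbTE cl).
  apply: derivableM; [exact/diff_derivable/differentiable_coord|exact: (Cinf_derivable ca Uy)].
have cc0 : Cinf U (pd c f0) by exact: Cinf_D.
have f0_shift (t : R) y : f0 (t *: 'e_l + y) = f0 y.
  congr f; apply/rowP => i; rewrite !mxE eqxx /=.
  by have [->|il] := eqVneq i l; rewrite ?mul0r // mulr0 add0r.
have p0 : pd l (pd c f0) x = 0.
  have E (t : R) y : pd c f0 (t *: 'e_l + y) = pd c f0 y.
    have D : (fun h : R => h^-1 *: ((f0 \o shift (t *: 'e_l + y)) (h *: 'e_c) - f0 (t *: 'e_l + y))) =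
        (fun h : R => h^-1 *: ((f0 \o shift y) (h *: 'e_c) - f0 y)).
      by apply/funext => h /=; rewrite addrCA !f0_shift.
    by rewrite /pd /derive D.
  rewrite /pd {1}/derive (_ : (fun h => _) = fun=> 0); first exact: lim_cst.
  by apply/funext => h /=; rewrite -!/(pd _ _ _) E subrr scaler0.
have ddx : derivable (fun y : 'rV[R]_m => y 0 l : R) x 'e_l by exact/diff_derivable/differentiable_coord.
have ddag := Cinf_derivable (i := l) cag Ux.
rewrite (eq_pd l oU pcE Ux) (pdD (Cinf_derivable cc0 Ux) (derivableM ddx ddag)) p0 add0r.
rewrite (pdM ddx ddag) pd_coord eqxx mulr1.
exact: avg_ode oU sU (cg 1%N) Ux.
Qed.

End Schwarz.

Section Geodesic.
Context {R : realType} {n : nat}.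
Notation m := n.+1.
Notation l := (ord_max : 'I_n.+1).
Notation lo := (lift (ord_max : 'I_n.+1)).
Variables (W B : set 'rV[R]_m) (G : 'I_m -> 'I_m -> 'rV[R]_m -> R) (b : 'I_m -> 'rV[R]_m -> R).
Hypothesis oW : open W.
Hypothesis oB : open B.
Hypothesis sB : star l B.
Hypothesis cG : forall i j, Cinf W (G i j).
Hypothesis symG : forall i j x, W x -> G i j x = G j i x.
Hypothesis cb : forall i, Cinf W (b i).
Hypothesis Gb : forall i x, W x -> G l i x = x 0 l * b i x.
Variables (x0 : 'rV[R]_m) (eta Y : 'rV[R]_m -> R) (zeta X : 'I_n -> 'rV[R]_m -> R).
Hypothesis ceta : Cinf B eta.
Hypothesis cY : Cinf B Y.
Hypothesis czeta : forall k, Cinf B (zeta k).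
Hypothesis cX : forall k, Cinf B (X k).

Definition geo_point (th : 'rV[R]_m) : 'rV[R]_m :=
  \row_i (if unlift l i is Some k then x0 0 i + th 0 i + th 0 l * X k th else th 0 l * Y th).
Definition geo_momentum (i : 'I_m) (th : 'rV[R]_m) : R :=
  if unlift l i is Some k then th 0 l * zeta k th else eta th.
Notation Phi := geo_point.
Notation P := geo_momentum.

Hypothesis WPhi : forall th, B th -> W (Phi th).

Let Q k th := \sum_i \sum_j pd k (G i j) (Phi th) * (P i th * P j th).
Let V i th := \sum_j G i j (Phi th) * P j th.

(** In these equations [s w' + w] is the left side of [avg_ode]. The equation of [eta] is half of
    [2 s eta' = eta - Q l] with [eta] added; that of [zeta] is the momentum equation of [s zeta]
    divided by [2 s], and that of [X] is [s x' = V] divided by [s]. The divisions are possible since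
    [Gb] gives a factor [s] in every entry of [G] with index [l]. *)
Hypothesis eqeta : forall th, B th -> th 0 l * pd l eta th + eta th = 3 / 2 * eta th - 1 / 2 * Q l th.
(* The first integral g*(P, P) = s divided by s, see [energy]. *)
Hypothesis eqY : forall th, B th ->
  Y th * (b l (Phi th) * eta th ^+ 2 + 2 * th 0 l * \sum_k b (lo k) (Phi th) * zeta k th * eta th) +
  th 0 l * \sum_k \sum_k' G (lo k) (lo k') (Phi th) * (zeta k th * zeta k' th) = 1.
Hypothesis eqzeta : forall k th, B th -> th 0 l * pd l (zeta k) th + zeta k th =
  1 / 2 * zeta k th - 1 / 2 * (th 0 l * \sum_i \sum_j pd (lo k) (G (lo i) (lo j)) (Phi th) * (zeta i th * zeta j th)
    + 2 * Y th * th 0 l * (\sum_i pd (lo k) (b (lo i)) (Phi th) * zeta i th * eta th)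
    + Y th * pd (lo k) (b l) (Phi th) * eta th ^+ 2).
Hypothesis eqX : forall k th, B th -> th 0 l * pd l (X k) th + X k th =
  \sum_j G (lo k) (lo j) (Phi th) * zeta j th + Y th * b (lo k) (Phi th) * eta th.
Hypothesis Qneq0 : forall th, B th -> Q l th != 0.

Lemma PhiE k : (fun th => Phi th 0 (lo k)) = (fun th => x0 0 (lo k) + th 0 (lo k) + th 0 l * X k th).
Proof. by apply/funext => th; rewrite mxE liftK. Qed.

Lemma PhilE : (fun th => Phi th 0 l) = (fun th => th 0 l * Y th).
Proof. by apply/funext => th; rewrite mxE unlift_none. Qed.

Lemma momE k : P (lo k) = fun th => th 0 l * zeta k th.
Proof. by apply/funext => th; rewrite /P liftK. Qed.

Lemma momlE : P l = eta.
Proof. by apply/funext => th; rewrite /P unlift_none. Qed.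

Lemma cPhi i : Cinf B (fun th => Phi th 0 i).
Proof.
move=> k; case: (unliftP l i) => [j ->|->].
  rewrite PhiE; apply: (CkD oB); last by apply: (CkM oB); [exact: Ck_coord|exact: cX].
  by apply: (CkD oB); [exact: Ck_cst|exact: Ck_coord].
by rewrite PhilE; apply: (CkM oB); [exact: Ck_coord|exact: cY].
Qed.

Lemma cP i : Cinf B (P i).
Proof.
move=> k; case: (unliftP l i) => [j ->|->]; last by rewrite momlE; exact: ceta.
by rewrite momE; apply: (CkM oB); [exact: Ck_coord|exact: czeta].
Qed.

Lemma cWPhi f : Cinf W f -> Cinf B (fun th => f (Phi th)).
Proof. by move=> cf k; apply: (Ck_comp oB oW WPhi (cf k)) => j; exact: cPhi. Qed.

Lemma pd_Phi c f th : Cinf W f -> B th ->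
  pd c (fun th => f (Phi th)) th = \sum_k pd k f (Phi th) * pd c (fun th => Phi th 0 k) th.
Proof.
move=> cf Bth; rewrite /pd (derive_comp (f := f) (g := Phi)) //.
  by have [] := Ck_diff oW (cf 1%N) (WPhi Bth).
by move=> j; have [] := Ck_diff oB (cPhi j 1%N) Bth.
Qed.

Lemma sum_lo (F : 'I_m -> R) : \sum_i F i = F l + \sum_k F (lo k).
Proof. by rewrite (bigD1_ord l). Qed.

Lemma pdG_last k i x : W x -> pd (lo k) (G l i) x = x 0 l * pd (lo k) (b i) x.
Proof.
move=> Wx; rewrite (eq_pd _ oW (Gb i) Wx).
rewrite pdM; [|exact/diff_derivable/differentiable_coord|exact: (Cinf_derivable (cb i) Wx)].
by rewrite pd_coord eq_sym (negbTE (neq_lift _ _)) mulr0 addr0.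
Qed.

Lemma pdG_sym k i j x : W x -> pd k (G i j) x = pd k (G j i) x.
Proof. by move=> Wx; apply: eq_pd oW _ Wx => y Wy; exact: symG. Qed.

Lemma quad_split (H : 'I_m -> 'I_m -> R) th : (forall i j, H i j = H j i) ->
  \sum_i \sum_j H i j * (P i th * P j th) = H l l * eta th ^+ 2 +
   2 * th 0 l * (\sum_k H l (lo k) * zeta k th * eta th) +
   th 0 l ^+ 2 * \sum_k \sum_k' H (lo k) (lo k') * (zeta k th * zeta k' th).
Proof.
move=> symH; rewrite sum_lo sum_lo momlE.
rewrite (eq_bigr (fun k => th 0 l * (H l (lo k) * zeta k th * eta th))); last first.
  by move=> k _; rewrite momE /=; ring.
rewrite -mulr_sumr; set S := \sum_k H l (lo k) * _ * _.
rewrite [X in _ + X = _](eq_bigr (fun k => th 0 l * (H l (lo k) * zeta k th * eta th) +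
   th 0 l ^+ 2 * \sum_k' H (lo k) (lo k') * (zeta k th * zeta k' th))); last first.
  move=> k _; rewrite sum_lo momlE momE /= symH; congr (_ + _); first by ring.
  by rewrite mulr_sumr; apply: eq_bigr => k' _; rewrite momE /=; ring.
rewrite big_split /= -!mulr_sumr -/S; ring.
Qed.

Lemma energy th : B th -> \sum_i \sum_j G i j (Phi th) * (P i th * P j th) = th 0 l.
Proof.
move=> Bth; have Wth := WPhi Bth.
rewrite (quad_split (H := fun i j => G i j (Phi th))); last by move=> i j; exact: symG.
have PlE : Phi th 0 l = th 0 l * Y th by rewrite mxE unlift_none.
rewrite Gb // (eq_bigr (fun k => th 0 l * Y th * (b (lo k) (Phi th) * zeta k th * eta th))); last first.
  by move=> k _; rewrite Gb // PlE; ring.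
rewrite -mulr_sumr PlE -[RHS]mulr1 -[in RHS](eqY Bth); ring.
Qed.

Lemma momentum_eq k th : B th -> 2 * (th 0 l * pd l (P k) th) = P k th - Q k th.
Proof.
move=> Bth; have Wth := WPhi Bth.
case: (unliftP l k) => [j ->|->]; last first.
  rewrite momlE; have := eqeta Bth; set A := _ * pd l eta th; lra.
rewrite momE pdM; [|exact/diff_derivable/differentiable_coord|exact: (Cinf_derivable (czeta j) Bth)].
rewrite pd_coord eqxx mulr1 (eqzeta j Bth).
have PlE : Phi th 0 l = th 0 l * Y th by rewrite mxE unlift_none.
have -> : Q (lo j) th = th 0 l * Y th * pd (lo j) (b l) (Phi th) * eta th ^+ 2 +
   2 * th 0 l * (th 0 l * Y th * \sum_k pd (lo j) (b (lo k)) (Phi th) * zeta k th * eta th) +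
   th 0 l ^+ 2 * \sum_k \sum_k' pd (lo j) (G (lo k) (lo k')) (Phi th) * (zeta k th * zeta k' th).
  rewrite /Q (quad_split (H := fun i j' => pd (lo j) (G i j') (Phi th))); last by move=> *; exact: pdG_sym.
  rewrite pdG_last // PlE [in RHS]mulr_sumr; congr (_ + _ * _ + _).
  by apply: eq_bigr => i _; rewrite pdG_last // PlE; ring.
by field.
Qed.

Lemma velocity_lo k th : B th -> th 0 l * pd l (fun th => Phi th 0 (lo k)) th = V (lo k) th.
Proof.
move=> Bth; have Wth := WPhi Bth.
have dc j : derivable (fun th : 'rV[R]_m => th 0 j : R) th 'e_l by exact/diff_derivable/differentiable_coord.
have dX := Cinf_derivable (i := l) (cX k) Bth.
have dcst := derivable_cst (x0 0 (lo k)) th 'e_l.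
rewrite PhiE (pdD (derivableD dcst (dc (lo k))) (derivableM (dc l) dX)) (pdD dcst (dc (lo k))).
rewrite pd_cst pd_coord (negbTE (neq_lift _ _)) !add0r (pdM (dc l) dX) pd_coord eqxx mulr1 eqX //.
have PlE : Phi th 0 l = th 0 l * Y th by rewrite mxE unlift_none.
rewrite /V sum_lo momlE symG // Gb // PlE mulrDr mulr_sumr addrC; congr (_ + _); first by ring.
by apply: eq_bigr => j _; rewrite momE; ring.
Qed.

(** The first integral differentiated along [e_c], by the product rule and the symmetry of [G]. The
    case [c = l] recovers the missing velocity; the cases [c != l] enter the orthogonality argument
    of [om_ode]. *)
Lemma energy_derive c th : B th ->
  (c == l)%:R = \sum_k Q k th * pd c (fun th => Phi th 0 k) th + 2 * \sum_j V j th * pd c (P j) th.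
Proof.
move=> Bth; have Wth := WPhi Bth.
rewrite -(pd_coord c l th) -(eq_pd c oB energy Bth).
have dG i j : derivable (fun th => G i j (Phi th)) th 'e_c by exact: (Cinf_derivable (cWPhi (cG i j)) Bth).
have dP i : derivable (P i) th 'e_c by exact: (Cinf_derivable (cP i) Bth).
have dPP i j : derivable (fun th => P i th * P j th) th 'e_c by exact: derivableM.
have dt i j : derivable (fun th => G i j (Phi th) * (P i th * P j th)) th 'e_c by exact: derivableM.
have ds i : derivable (fun th => \sum_j G i j (Phi th) * (P i th * P j th)) th 'e_c.
  rewrite (_ : (fun th => _) = \sum_j (fun th => G i j (Phi th) * (P i th * P j th))); last first.
    by apply/funext => y; rewrite fct_sumE.
  by apply: derivable_sum => j; exact: dt.
rewrite pd_sum //.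
have E i j : pd c (fun th => G i j (Phi th) * (P i th * P j th)) th =
    \sum_k pd k (G i j) (Phi th) * (P i th * P j th) * pd c (fun th => Phi th 0 k) th +
    (G i j (Phi th) * P i th * pd c (P j) th + G i j (Phi th) * P j th * pd c (P i) th).
  rewrite (pdM (dG i j) (dPP i j)) (pdM (dP i) (dP j)) pd_Phi //.
  rewrite mulr_sumr addrC; congr (_ + _); last by ring.
  by apply: eq_bigr => k _; ring.
under eq_bigr => i _ do (rewrite pd_sum; [|by move=> j; exact: dt]).
rewrite (eq_bigr (fun i => \sum_j \sum_k pd k (G i j) (Phi th) * (P i th * P j th) * pd c (fun th => Phi th 0 k) th +
   (\sum_j G i j (Phi th) * P i th * pd c (P j) th + \sum_j G i j (Phi th) * P j th * pd c (P i) th))); last first.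
  by move=> i _; rewrite -!big_split /=; apply: eq_bigr => j _; exact: E.
rewrite !big_split /=; congr (_ + _).
  rewrite (eq_bigr (fun i => \sum_k \sum_j pd k (G i j) (Phi th) * (P i th * P j th) * pd c (fun th => Phi th 0 k) th)).
    rewrite exchange_big /=; apply: eq_bigr => k _; rewrite /Q mulr_suml.
    by apply: eq_bigr => i _; rewrite mulr_suml.
  by move=> i _; rewrite exchange_big.
rewrite mulr_natl mulr2n; congr (_ + _).
  rewrite exchange_big /=; apply: eq_bigr => j _; rewrite /V mulr_suml.
  by apply: eq_bigr => i _; rewrite symG.
by apply: eq_bigr => i _; rewrite /V mulr_suml.
Qed.

Lemma sum_VP th : B th -> \sum_j V j th * P j th = th 0 l.
Proof.
move=> Bth; rewrite -(energy Bth); apply: eq_bigr => i _.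
by rewrite /V mulr_suml; apply: eq_bigr => j _; ring.
Qed.

(* The last component is obtained by differentiating [energy] along e_l. *)
Lemma velocity i th : B th -> th 0 l * pd l (fun th => Phi th 0 i) th = V i th.
Proof.
move=> Bth; case: (unliftP l i) => [k ->|->]; first exact: velocity_lo.
have E := energy_derive l Bth; rewrite eqxx in E.
(* [th 0 l] times the differentiated energy, after substituting [2 s p' = p - Q] and
   [\sum_j V j * P j = s]; the terms [s] cancel. Every summand but the last is then known to vanish,
   and [Q l] is nonzero. *)
have E2 : \sum_k Q k th * (th 0 l * pd l (fun th => Phi th 0 k) th - V k th) = 0.
  rewrite (eq_bigr (fun k => th 0 l * (Q k th * pd l (fun th => Phi th 0 k) th) - Q k th * V k th)); last first.
    by move=> k _; ring.
  rewrite big_split /= -mulr_sumr sumrN.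
  have E3 : 2 * (th 0 l * \sum_j V j th * pd l (P j) th) = th 0 l - \sum_k Q k th * V k th.
    rewrite -(sum_VP Bth) -sumrB !mulr_sumr; apply: eq_bigr => j _.
    rewrite (sum_VP Bth).
    have -> : 2 * (th 0 l * (V j th * pd l (P j) th)) = V j th * (2 * (th 0 l * pd l (P j) th)) by ring.
    by rewrite momentum_eq //; ring.
  move: E E3; set S1 := \sum_k _ * pd _ _ _; set S2 := \sum_j _; set S3 := \sum_k _ => E E3.
  have : th 0 l * 1 = th 0 l * (S1 + 2 * S2) by rewrite -E.
  lra.
move: E2; rewrite sum_lo big1 ?addr0; last by move=> k _; rewrite velocity_lo // subrr mulr0.
by move=> /eqP; rewrite mulf_eq0 (negbTE (Qneq0 Bth)) /= subr_eq0 => /eqP.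
Qed.

Lemma momentum_velocity th : B th -> th 0 l != 0 ->
  \sum_i P i th * pd l (fun th => Phi th 0 i) th = 1.
Proof.
move=> Bth s0; apply: (mulfI s0); rewrite mulr1 -[RHS](sum_VP Bth) mulr_sumr.
by apply: eq_bigr => i _; rewrite -velocity //; ring.
Qed.

(** [om c] is the component along [e_c] of the covector field [P] pulled back by [Phi], and [Om c]
    is its quotient by [s] for [c != l], which is smooth up to the hyperplane. *)
Let om c th := \sum_i P i th * pd c (fun th => Phi th 0 i) th.
Let Om c th := \sum_k zeta k th * pd c (fun th => Phi th 0 (lo k)) th + eta th * pd c Y th.

Lemma cpdPhi c i : Cinf B (pd c (fun th => Phi th 0 i)).
Proof. by apply: Cinf_D => //; exact: cPhi. Qed.

Lemma cOm c : Cinf B (Om c).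
Proof.
move=> k; apply: (CkD oB).
  by apply: Ck_sum => // i _; apply: (CkM oB); [exact: czeta|exact: cpdPhi].
by apply: (CkM oB); [exact: ceta|exact: (Cinf_D _ oB cY)].
Qed.

Lemma omE c th : c != l -> B th -> om c th = th 0 l * Om c th.
Proof.
move=> cl Bth; rewrite /om sum_lo momlE PhilE.
rewrite pdM; [|exact/diff_derivable/differentiable_coord|exact: (Cinf_derivable cY Bth)].
rewrite pd_coord (negbTE cl) mulr0 addr0 /Om mulrDr addrC mulr_sumr; congr (_ + _).
  by apply: eq_bigr => k _; rewrite momE; ring.
by ring.
Qed.

(** The Gauss lemma in this parametrization. After exchanging the mixed derivatives of [Phi] and
    inserting the equations of [P] and [Phi], what remains besides [om c] is the right side of
    [energy_derive c], which is zero because [s] does not vary along [e_c]. *)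
Lemma om_ode c th : c != l -> B th -> 2 * (th 0 l * pd l (om c) th) = om c th.
Proof.
move=> cl Bth; have Wth := WPhi Bth.
have dP d i : derivable (P i) th 'e_d by exact: (Cinf_derivable (cP i) Bth).
have dpPhi d d' i : derivable (pd d (fun th => Phi th 0 i)) th 'e_d'.
  exact: (Cinf_derivable (cpdPhi d i) Bth).
have dG i j : derivable (fun th => G i j (Phi th)) th 'e_c by exact: (Cinf_derivable (cWPhi (cG i j)) Bth).
have pV i : th 0 l * pd l (pd c (fun th => Phi th 0 i)) th =
    \sum_j (G i j (Phi th) * pd c (P j) th +
     P j th * \sum_k pd k (G i j) (Phi th) * pd c (fun th => Phi th 0 k) th).
  rewrite (schwarz oB sB (cPhi i) cl Bth).
  transitivity (pd c (V i) th).
    rewrite -(eq_pd c oB (velocity i) Bth) pdM; [|exact/diff_derivable/differentiable_coord|exact: dpPhi].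
    by rewrite pd_coord (negbTE cl) mulr0 addr0.
  rewrite /V pd_sum; last by move=> j; apply: derivableM; [exact: dG|exact: dP].
  apply: eq_bigr => j _; rewrite (pdM (dG i j) (dP c j)); congr (_ + _ * _).
  by rewrite pd_Phi.
rewrite /om pd_sum; last by move=> i; apply: derivableM; [exact: dP|exact: dpPhi].
rewrite !mulr_sumr.
rewrite (eq_bigr (fun i => (P i th * pd c (fun th => Phi th 0 i) th - Q i th * pd c (fun th => Phi th 0 i) th)
   + 2 * (P i th * (th 0 l * pd l (pd c (fun th => Phi th 0 i)) th)))); last first.
  move=> i _; rewrite (pdM (dP l i) (dpPhi c l i)) -mulrBl -momentum_eq //; ring.
rewrite big_split /= sumrB -[RHS]addr0 -addrA; congr (_ + _).
have E := energy_derive c Bth; rewrite (negbTE cl) mulr0n in E.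
rewrite -mulr_sumr.
suff -> : \sum_i P i th * (th 0 l * pd l (pd c (fun th => Phi th 0 i)) th) =
    \sum_k Q k th * pd c (fun th => Phi th 0 k) th + \sum_j V j th * pd c (P j) th.
  move: E; set S1 := \sum_k _; set S2 := \sum_j _; lra.
rewrite (eq_bigr (fun i => \sum_j G i j (Phi th) * P i th * pd c (P j) th +
   \sum_k \sum_j pd k (G i j) (Phi th) * (P i th * P j th) * pd c (fun th => Phi th 0 k) th)); last first.
  move=> i _; rewrite pV exchange_big /= -big_split /= mulr_sumr; apply: eq_bigr => j _.
  rewrite mulrDr; congr (_ + _); first by ring.
  by rewrite !mulr_sumr; apply: eq_bigr => k _; ring.
rewrite big_split /= addrC; congr (_ + _).
  rewrite exchange_big /=; apply: eq_bigr => k _; rewrite /Q mulr_suml.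
  by apply: eq_bigr => i _; rewrite mulr_suml.
rewrite exchange_big /=; apply: eq_bigr => j _; rewrite /V mulr_suml.
by apply: eq_bigr => i _; rewrite symG.
Qed.

(* The sum is s Om c, and s (Om c)^2 is constant along the rays s -> 0. *)
Lemma momentum_tangent c th : c != l -> B th -> th 0 l != 0 ->
  \sum_i P i th * pd c (fun th => Phi th 0 i) th = 0.
Proof.
move=> cl Bth s0; rewrite -/(om c th) omE //.
have ode y : B y -> y 0 l != 0 -> 2 * (y 0 l * pd l (Om c) y) = - Om c y.
  move=> By y0; have := om_ode cl By.
  rewrite (eq_pd l oB (fun y By => omE cl By) By) omE //.
  rewrite pdM; [|exact/diff_derivable/differentiable_coord|exact: (Cinf_derivable (cOm c) By)].
  rewrite pd_coord eqxx mulr1 => E; apply: (mulfI y0).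
  by move: E; lra.
pose f (t : R) := t * (Om c (rescale l t th)) ^+ 2.
have dOm (t : R) : 0 <= t <= 1 -> is_derive t 1 (fun s => Om c (rescale l s th))
    (th 0 l * pd l (Om c) (rescale l t th)).
  exact: (is_derive_rescale oB sB (cOm c 1%N) Bth).
have df (t : R) : 0 <= t <= 1 -> is_derive t 1 f (Om c (rescale l t th) ^+ 2 +
   t * (2 * Om c (rescale l t th) * (th 0 l * pd l (Om c) (rescale l t th)))).
  move=> t01; have d := dOm _ t01; apply: is_derive_eq.
  rewrite /GRing.scale /=; ring.
(* The derivative of [f] vanishes, and [f 0 = 0] because [Om c] is finite on the hyperplane. This
   finiteness excludes the other solutions of the equation of [Om c], which grow like [s^(-1/2)]. *)
have [|||t t01 E] := @MVT R f (fun t => Om c (rescale l t th) ^+ 2 +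
   t * (2 * Om c (rescale l t th) * (th 0 l * pd l (Om c) (rescale l t th)))) 0 1.
- exact: ltr01.
- by move=> t; rewrite in_itv /= => /andP[t0 t1]; apply: df; rewrite !ltW.
- apply: derivable_within_continuous => t; rewrite in_itv /= => /df d.
  exact: (@ex_derive _ _ _ _ _ _ _ d).
move: t01; rewrite in_itv /= => /andP[t0 t1].
have Bt : B (rescale l t th) by apply: sB; rewrite ?ltW.
have rt : rescale l t th 0 l = t * th 0 l by rewrite mxE eqxx.
have t_neq0 : t != 0 by rewrite gt_eqF.
have := ode _ Bt; rewrite rt mulf_neq0 // => /(_ isT) O1.
move: E; rewrite /f mul0r subr0 mul1r rescale1 subr0 mulr1.
have -> : Om c (rescale l t th) ^+ 2 + t * (2 * Om c (rescale l t th) *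
   (th 0 l * pd l (Om c) (rescale l t th))) = 0.
  have -> : t * (2 * Om c (rescale l t th) * (th 0 l * pd l (Om c) (rescale l t th))) =
    Om c (rescale l t th) * (2 * (t * th 0 l * pd l (Om c) (rescale l t th))) by ring.
  by rewrite O1; ring.
by move=> /eqP; rewrite sqrf_eq0 => /eqP ->; rewrite mulr0.
Qed.

End Geodesic.

(** * The geodesic system as a triangular fixed point problem *)

Section GeodesicSystem.
Context {R : realType} {n : nat}.
Notation m := n.+1.
Notation l := (ord_max : 'I_n.+1).
Notation lo := (lift (ord_max : 'I_n.+1)).
Notation N := (2 + (n + n))%N.
Variables (W : set 'rV[R]_m) (G : 'I_m -> 'I_m -> 'rV[R]_m -> R) (b : 'I_m -> 'rV[R]_m -> R).
Hypothesis oW : open W.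
Hypothesis cG : forall i j, Cinf W (G i j).
Hypothesis symG : forall i j x, W x -> G i j x = G j i x.
Hypothesis cb : forall i, Cinf W (b i).
Hypothesis Gb : forall i x, W x -> G l i x = x 0 l * b i x.
Variable x0 : 'rV[R]_m.
Hypothesis Wx0 : W x0.
Hypothesis x0l : x0 0 l = 0.
Hypothesis b0 : b l x0 != 0.

Let iE : 'I_N := lshift (n + n) ord0.
Let iY : 'I_N := lshift (n + n) ord_max.
Let iZ (k : 'I_n) : 'I_N := rshift 2 (lshift n k).
Let iX (k : 'I_n) : 'I_N := rshift 2 (rshift n k).

(* The values at s = 0 forced by the equations. The unknowns are taken relative
   to them, in the order eta, Y, zeta, X, which makes D_w F(0) lower
   triangular. *)
Let e0 : R := (b l x0)^-1.
Let Y0 : R := b l x0.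
Let z0 (k : 'I_n) : R := - (b l x0)^-1 * pd (lo k) (b l) x0.
Let X0 (k : 'I_n) : R := \sum_j G (lo k) (lo j) x0 * z0 j + Y0 * b (lo k) x0 * e0.

Let sU (u : 'rV[R]_(m + N)) : R := u 0 (lshift N l).
Let EU (u : 'rV[R]_(m + N)) : R := e0 + u 0 (rshift m iE).
Let YU (u : 'rV[R]_(m + N)) : R := Y0 + u 0 (rshift m iY).
Let ZU (k : 'I_n) (u : 'rV[R]_(m + N)) : R := z0 k + u 0 (rshift m (iZ k)).
Let XU (k : 'I_n) (u : 'rV[R]_(m + N)) : R := X0 k + u 0 (rshift m (iX k)).

Let xU (u : 'rV[R]_(m + N)) : 'rV[R]_m :=
  \row_i (if unlift l i is Some k then x0 0 i + u 0 (lshift N i) + sU u * XU k u else sU u * YU u).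
Let pU (i : 'I_m) (u : 'rV[R]_(m + N)) : R :=
  if unlift l i is Some k then sU u * ZU k u else EU u.

Let FE u := 3 / 2 * EU u - 1 / 2 * (\sum_i \sum_j pd l (G i j) (xU u) * (pU i u * pU j u)) - e0.
(** The energy equation as a fixed point: subtracting [Y0 = 1 / (b e0^2)] times its defect is a
    frozen Newton step, which makes the derivative in [Y] vanish at the origin. *)
Let FY u := YU u - Y0 * (YU u * (b l (xU u) * EU u ^+ 2 +
    2 * sU u * \sum_k b (lo k) (xU u) * ZU k u * EU u) +
  sU u * (\sum_k \sum_k' G (lo k) (lo k') (xU u) * (ZU k u * ZU k' u)) - 1) - Y0.
Let FZ k u := 1 / 2 * ZU k u - 1 / 2 * (sU u * (\sum_i \sum_j pd (lo k) (G (lo i) (lo j)) (xU u) * (ZU i u * ZU j u))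
    + 2 * YU u * sU u * (\sum_i pd (lo k) (b (lo i)) (xU u) * ZU i u * EU u)
    + YU u * pd (lo k) (b l) (xU u) * EU u ^+ 2) - z0 k.
Let FX k u := \sum_j G (lo k) (lo j) (xU u) * ZU j u + YU u * b (lo k) (xU u) * EU u - X0 k.

Let F (a : 'I_N) (u : 'rV[R]_(m + N)) : R :=
  match fintype.split a with
  | inl c => if c == ord0 then FE u else FY u
  | inr c => match fintype.split c with inl k => FZ k u | inr k => FX k u end
  end.

Let FiE u : F iE u = FE u.
Proof. by rewrite /F (unsplitK (inl ord0 : 'I_2 + 'I_(n + n))%type). Qed.

Let FiY u : F iY u = FY u.
Proof. by rewrite /F (unsplitK (inl ord_max : 'I_2 + 'I_(n + n))%type). Qed.

Let FiZ k u : F (iZ k) u = FZ k u.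
Proof.
rewrite /F (unsplitK (inr (lshift n k) : 'I_2 + 'I_(n + n))%type).
by rewrite (unsplitK (inl k : 'I_n + 'I_n)%type).
Qed.

Let FiX k u : F (iX k) u = FX k u.
Proof.
rewrite /F (unsplitK (inr (rshift n k) : 'I_2 + 'I_(n + n))%type).
by rewrite (unsplitK (inr k : 'I_n + 'I_n)%type).
Qed.

Let index_cases (a : 'I_N) : [\/ a = iE, a = iY, exists k, a = iZ k | exists k, a = iX k].
Proof.
case: (fintype.splitP a) => c ac.
  case: (eqVneq c ord0) => [c0|c0].
    by apply: Or41; apply: val_inj; rewrite /= ac c0.
  apply: Or42; apply: val_inj; rewrite /= ac.
  by move: c0; rewrite -val_eqE /=; case: c {ac} => -[|[|]].
case: (fintype.splitP c) => k ck.
  by apply: Or43; exists k; apply: val_inj; rewrite /= ac ck.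
by apply: Or44; exists k; apply: val_inj; rewrite /= ac ck.
Qed.

Let O := xU @^-1` W.

Let csU k U : open U -> Ck k U sU. Proof. by move=> _; exact: Ck_coord. Qed.
Let cEU k U : open U -> Ck k U EU.
Proof. by move=> oU; apply: (CkD oU); [exact: Ck_cst|exact: Ck_coord]. Qed.
Let cYU k U : open U -> Ck k U YU.
Proof. by move=> oU; apply: (CkD oU); [exact: Ck_cst|exact: Ck_coord]. Qed.
Let cZU j k U : open U -> Ck k U (ZU j).
Proof. by move=> oU; apply: (CkD oU); [exact: Ck_cst|exact: Ck_coord]. Qed.
Let cXU j k U : open U -> Ck k U (XU j).
Proof. by move=> oU; apply: (CkD oU); [exact: Ck_cst|exact: Ck_coord]. Qed.

Let cxU k i U : open U -> Ck k U (fun u => xU u 0 i).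
Proof.
move=> oU; case: (unliftP l i) => [j ->|->].
  apply: (Ck_ext oU (f := fun u => x0 0 (lo j) + u 0 (lshift N (lo j)) + sU u * XU j u)).
    by move=> u _; rewrite mxE liftK.
  apply: (CkD oU); last by apply: (CkM oU); [exact: csU|exact: cXU].
  by apply: (CkD oU); [exact: Ck_cst|exact: Ck_coord].
apply: (Ck_ext oU (f := fun u => sU u * YU u)); first by move=> u _; rewrite mxE unlift_none.
by apply: (CkM oU); [exact: csU|exact: cYU].
Qed.

Let oO : open O.
Proof.
apply: open_comp oW => u _; apply: continuous_row => j.
exact: (Ck_cont (cxU 0 j openT)).
Qed.

Let cWU f k : Cinf W f -> Ck k O (fun u => f (xU u)).
Proof. by move=> cf; apply: (Ck_comp oO oW _ (cf k)) => // j; exact: cxU. Qed.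

Let cpU i k : Ck k O (pU i).
Proof.
rewrite /pU; case: unliftP => [j _|_]; last exact: cEU.
by apply: (CkM oO); [exact: csU|exact: cZU].
Qed.

Ltac ck := repeat first [apply: Ck_cst | exact: csU | exact: cEU | exact: cYU | exact: cZU
  | exact: cpU | (apply: cWU; first [exact: cG | exact: cb | (apply: Cinf_D => //; exact: cG) | (apply: Cinf_D => //; exact: cb)])
  | apply: (CkB oO) | apply: (CkD oO) | apply: (CkM oO) | (apply: Ck_sum => // ? ?) ].

Let cF a : Cinf O (F a).
Proof.
move=> k; case: (index_cases a) => [->|->|[j ->]|[j ->]].
- by apply: (Ck_ext oO (f := FE)); [move=> u _; rewrite FiE|rewrite /FE; ck].
- apply: (Ck_ext oO (f := FY)); first by move=> u _; rewrite FiY.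
  by rewrite /FY; under eq_fun do rewrite expr2; ck.
- apply: (Ck_ext oO (f := FZ j)); first by move=> u _; rewrite FiZ.
  by rewrite /FZ; under eq_fun do rewrite expr2; ck.
- by apply: (Ck_ext oO (f := FX j)); [move=> u _; rewrite FiX|rewrite /FX; ck].
Qed.

Let a0e0 : b l x0 * e0 = 1. Proof. by rewrite mulfV. Qed.

Let pdG_ll : pd l (G l l) x0 = b l x0.
Proof.
rewrite (eq_pd _ oW (Gb l) Wx0).
rewrite pdM; [|exact/diff_derivable/differentiable_coord|exact: (Cinf_derivable (cb l) Wx0)].
by rewrite pd_coord eqxx mulr1 x0l mul0r add0r.
Qed.

Section Axis.
Variable u : 'rV[R]_(m + N).
Hypothesis u0 : forall i, u 0 (lshift N i) = 0.

Let s_axis : sU u = 0. Proof. exact: u0. Qed.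

(** When the base variables are 0, so is [s], and the point stays at [x0] whatever the unknowns are.
    The functions [F a] become explicit polynomials in the unknowns, on which the entries of
    [D_w F(0)] can be read. *)
Lemma x_axis : xU u = x0.
Proof.
apply/rowP => i; rewrite mxE; case: unliftP => [j ->|->]; rewrite s_axis mul0r ?x0l //.
by rewrite u0 !addr0.
Qed.

Lemma FE_axis : FE u = 3 / 2 * EU u - 1 / 2 * (b l x0 * EU u ^+ 2) - e0.
Proof.
rewrite /FE x_axis; congr (_ - _ * _ - _).
have pl k : pU (lo k) u = 0 by rewrite /pU liftK s_axis mul0r.
have pL : pU l u = EU u by rewrite /pU unlift_none.
rewrite sum_lo [X in _ + X]big1 ?addr0; last first.
  by move=> k _; rewrite big1 // => j _; rewrite pl !(mul0r, mulr0).
rewrite sum_lo [X in _ + X]big1 ?addr0; last by move=> k _; rewrite pl !mulr0.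
by rewrite pL pdG_ll expr2.
Qed.

Lemma FY_axis : FY u = YU u - Y0 * (YU u * (b l x0 * EU u ^+ 2) - 1) - Y0.
Proof. by rewrite /FY x_axis s_axis !(mulr0, mul0r) !addr0. Qed.

Lemma FZ_axis k : FZ k u = 1 / 2 * ZU k u - 1 / 2 * (YU u * pd (lo k) (b l) x0 * EU u ^+ 2) - z0 k.
Proof. by rewrite /FZ x_axis s_axis !(mulr0, mul0r) !add0r. Qed.

Lemma FX_axis k : FX k u = \sum_j G (lo k) (lo j) x0 * ZU j u + YU u * b (lo k) x0 * EU u - X0 k.
Proof. by rewrite /FX x_axis. Qed.

End Axis.

Let zero_axis i : (0 : 'rV[R]_(m + N)) 0 (lshift N i) = 0. Proof. by rewrite mxE. Qed.

Let F0 a : F a 0 = 0.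
Proof.
have E0 : EU 0 = e0 by rewrite /EU mxE addr0.
have EY : YU 0 = Y0 by rewrite /YU mxE addr0.
have EZ k : ZU k 0 = z0 k by rewrite /ZU mxE addr0.
case: (index_cases a) => [->|->|[j ->]|[j ->]].
- by rewrite FiE (FE_axis zero_axis) E0 expr2 mulrA a0e0; field.
- by rewrite FiY (FY_axis zero_axis) E0 EY expr2 (mulrA (b l x0)) a0e0 mul1r a0e0; ring.
- rewrite FiZ (FZ_axis zero_axis) E0 EY EZ /z0 -/e0.
  have -> : Y0 * pd (lo j) (b l) x0 * e0 ^+ 2 = (b l x0 * e0) * (pd (lo j) (b l) x0 * e0) by rewrite /Y0; ring.
  by rewrite a0e0; field.
- rewrite FiX (FX_axis zero_axis) E0 EY; under eq_bigr do rewrite EZ.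
  by rewrite /X0 subrr.
Qed.

(** Here [k1] is an entry of [D_w F(0)] on or above the diagonal. The diagonal entries are
    [3/2 - b e0 = 1/2] for [eta], [1/2] for [zeta], and 0 for [Y] and [X]; the only quadratic term
    comes from [b eta^2] in the equation of [eta]. *)
Let F_line (a c : 'I_N) : (a <= c)%N -> exists k1 k2 : R,
  [/\ forall t : R, F a (t *: 'e_(rshift m c)) = k1 * t + k2 * t ^+ 2,
    (a < c)%N -> k1 = 0 & `|k1| <= 1 / 2].
Proof.
move=> ac.
have axis (t : R) i : (t *: ('e_(rshift m c) : 'rV[R]_(m + N))) 0 (lshift N i) = 0.
  by rewrite !mxE eq_lrshift /= mulr0.
have val (t : R) (i : 'I_N) : (t *: ('e_(rshift m c) : 'rV[R]_(m + N))) 0 (rshift m i) = (i == c)%:R * t.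
  by rewrite !mxE eq_rshift /= mulrC.
have lt_neq (i : 'I_N) : (i < a)%N -> (i == c) = false.
  by move=> ia; apply/negbTE; rewrite -val_eqE /= neq_ltn (leq_trans ia ac).
have lt0 : (a < c)%N -> (a == c)%:R = 0 :> R.
  by move=> ac'; rewrite -val_eqE /= ltn_eqF.
have le12 : `|1 / 2 * (a == c)%:R| <= 1 / 2 :> R.
  case: (a == c); first by rewrite mulr1 ger0_norm // divr_ge0.
  by rewrite mulr0 normr0 divr_ge0.
case: (index_cases a) => [aE|aY|[j aZ]|[j aX]].
- exists (1 / 2 * (a == c)%:R), (- (1 / 2) * b l x0 * (a == c)%:R ^+ 2); split => //.
  + move=> t; rewrite {1}aE FiE (FE_axis (axis t)) /EU val -aE.
    set d := (a == c)%:R.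
    have -> : b l x0 * (e0 + d * t) ^+ 2 = (b l x0 * e0) * e0 + 2 * (b l x0 * e0) * (d * t) + b l x0 * (d * t) ^+ 2 by ring.
    by rewrite a0e0; field.
  + by move=> /lt0 ->; rewrite mulr0.
- exists 0, 0; split => // [t|]; last by rewrite normr0 divr_ge0.
  rewrite {1}aY FiY (FY_axis (axis t)) /EU /YU !val (lt_neq iE) ?aY //= mul0r addr0.
  set d := (iY == c)%:R.
  have -> : (Y0 + d * t) * (b l x0 * e0 ^+ 2) = (Y0 + d * t) * ((b l x0 * e0) * e0) by ring.
  rewrite a0e0 mul1r mulrBr mulrCA [Y0 * e0]a0e0; ring.
- exists (1 / 2 * (a == c)%:R), 0; split => //; last by move=> /lt0 ->; rewrite mulr0.
  move=> t; rewrite {1}aZ FiZ (FZ_axis (axis t)) /EU /YU /ZU !val.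
  rewrite (lt_neq iE) ?aZ // (lt_neq iY) ?aZ // -aZ !mul0r !addr0.
  have -> : Y0 * pd (lo j) (b l) x0 * e0 ^+ 2 = (b l x0 * e0) * (pd (lo j) (b l) x0 * e0) by rewrite /Y0; ring.
  by rewrite a0e0 /z0 -/e0; field.
- exists 0, 0; split => // [t|]; last by rewrite normr0 divr_ge0.
  rewrite {1}aX FiX (FX_axis (axis t)) /EU /YU !val (lt_neq iE) ?aX // (lt_neq iY) ?aX // !mul0r !addr0.
  rewrite (eq_bigr (fun j' => G (lo j) (lo j') x0 * z0 j')); first by rewrite /X0 subrr.
  move=> i _; rewrite /ZU val (lt_neq (iZ i)) ?mul0r ?addr0 // aX /=.
  by rewrite ltn_add2l (leq_trans (ltn_ord i)) // leq_addr.
Qed.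

Let pdF (a c : 'I_N) : (a <= c)%N -> ((a < c)%N -> pd (rshift m c) (F a) 0 = 0) /\
  `|pd (rshift m c) (F a) 0| <= 1 / 2.
Proof.
move=> /F_line[k1 [k2 [Fl k10 k12]]].
have O0 : O 0.
  by rewrite /O /= (x_axis zero_axis).
suff -> : pd (rshift m c) (F a) 0 = k1 by split.
have dF : derivable (F a) (0 *: 'e_(rshift m c) + 0) 'e_(rshift m c).
  by rewrite scale0r addr0; exact: (Cinf_derivable (cF a) O0).
have d1 := is_derive_line dF.
have := @derive_val _ _ _ _ _ _ _ d1; rewrite scale0r addr0 /pd => <-.
rewrite (_ : (fun s => _) = (fun t => k1 * t + k2 * t ^+ 2)); last first.
  by apply/funext => t; rewrite addr0 Fl.
have d2 : is_derive (0 : R) 1 (fun t => k1 * t + k2 * t ^+ 2) k1.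
  by apply: is_derive_eq; rewrite /GRing.scale /=; ring.
exact: (@derive_val _ _ _ _ _ _ _ d2).
Qed.

Lemma geodesic_coordinates : exists (d : R) (Phi : 'rV[R]_m -> 'rV[R]_m) (P : 'I_m -> 'rV[R]_m -> R),
  [/\ 0 < d, forall i, Cinf (origin_ball d) (fun th => Phi th 0 i),
      forall th, origin_ball d th -> W (Phi th), Phi 0 = x0 &
      \matrix_(i, j) pd i (fun th => Phi th 0 j) 0 \in unitmx] /\
  [/\ forall th, origin_ball d th -> th 0 l = 0 -> Phi th 0 l = 0,
      forall th i, origin_ball d th ->
        th 0 l * pd l (fun th => Phi th 0 i) th = \sum_j G i j (Phi th) * P j th,
      forall th, origin_ball d th -> th 0 l != 0 ->
        \sum_i P i th * pd l (fun th => Phi th 0 i) th = 1 &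
      forall c th, c != l -> origin_ball d th -> th 0 l != 0 ->
        \sum_i P i th * pd c (fun th => Phi th 0 i) th = 0].
Proof.
(* The equation of [Y] is algebraic and is not averaged; the index [1] stands for [avg 0]. *)
pose t (a : 'I_N) : nat := if a == iY then 0 else 1.
have O0 : O 0 by rewrite /O /= (x_axis zero_axis).
have [||||||d1 [w [d10 cw wO weq]]] := @triangular_solution R m N l F t O iE.
- exact: oO.
- exact: O0.
- exact: cF.
- exact: F0.
- by move=> a c ac; have [h _] := pdF (ltnW ac); exact: h.
- by move=> a; have [_ h] := pdF (leqnn a); exact: h.
have oB1 := @open_origin_ball R m d1; have sB1 := @star_origin_ball R m l d1.
pose eta th := e0 + w th 0 iE; pose Y th := Y0 + w th 0 iY.
pose zeta k th := z0 k + w th 0 (iZ k); pose X k th := X0 k + w th 0 (iX k).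
have cc (c : R) a : Cinf (origin_ball d1) (fun th => c + w th 0 a).
  by move=> k; apply: (CkD oB1); [exact: Ck_cst|exact: cw].
have Es th : sU (row_mx th (w th)) = th 0 l by rewrite /sU row_mxEl.
have EE th : EU (row_mx th (w th)) = eta th by rewrite /EU row_mxEr.
have EY th : YU (row_mx th (w th)) = Y th by rewrite /YU row_mxEr.
have EZ k th : ZU k (row_mx th (w th)) = zeta k th by rewrite /ZU row_mxEr.
have EX k th : XU k (row_mx th (w th)) = X k th by rewrite /XU row_mxEr.
have Ex th : xU (row_mx th (w th)) = geo_point x0 Y X th.
  apply/rowP => i; rewrite mxE [RHS]mxE Es EY; case: unliftP => [j _|_] //.
  by rewrite EX row_mxEl.
have Ep i th : pU i (row_mx th (w th)) = geo_momentum eta zeta i th.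
  by rewrite /pU /geo_momentum; case: unliftP => [j _|_]; rewrite ?Es ?EZ ?EE.
have ode a c th : a != iY -> origin_ball d1 th ->
    th 0 l * pd l (fun th => c + w th 0 a) th + w th 0 a = F a (row_mx th (w th)).
  move=> aY Bth.
  have dw := Cinf_derivable (i := l) (cw a) Bth.
  rewrite (pdD (derivable_cst c th 'e_l) dw) pd_cst add0r.
  have weqa y : origin_ball d1 y -> w y 0 a = avg l 0 (fun y => F a (row_mx y (w y))) y.
    by move=> By; rewrite (weq _ By) /t (negbTE aY).
  rewrite (eq_pd _ oB1 weqa Bth) (weqa _ Bth).
  apply: (avg_ode (h := fun y => F a (row_mx y (w y))) oB1 sB1 _ Bth).
  by apply: (Ck_graph oB1 oO wO (cF a 1%N)) => b'; exact: cw.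
have WPhi th : origin_ball d1 th -> W (geo_point x0 Y X th).
  by move=> /wO; rewrite /O /= Ex.
have eqeta th : origin_ball d1 th -> th 0 l * pd l eta th + eta th =
   3 / 2 * eta th - 1 / 2 * \sum_i \sum_j pd l (G i j) (geo_point x0 Y X th) *
     (geo_momentum eta zeta i th * geo_momentum eta zeta j th).
  move=> Bth; have := ode iE e0 th isT Bth; rewrite FiE /FE EE Ex.
  rewrite (eq_bigr (fun i => \sum_j pd l (G i j) (geo_point x0 Y X th) *
     (geo_momentum eta zeta i th * geo_momentum eta zeta j th))); last first.
    by move=> i _; apply: eq_bigr => j _; rewrite !Ep.
  have -> : w th 0 iE = eta th - e0 by rewrite /eta addrC addKr.
  set A := th 0 l * pd _ _ _; lra.
have eqzeta k th : origin_ball d1 th -> th 0 l * pd l (zeta k) th + zeta k th =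
  1 / 2 * zeta k th - 1 / 2 * (th 0 l * \sum_i \sum_j pd (lo k) (G (lo i) (lo j)) (geo_point x0 Y X th) * (zeta i th * zeta j th)
    + 2 * Y th * th 0 l * (\sum_i pd (lo k) (b (lo i)) (geo_point x0 Y X th) * zeta i th * eta th)
    + Y th * pd (lo k) (b l) (geo_point x0 Y X th) * eta th ^+ 2).
  move=> Bth; have := ode (iZ k) (z0 k) th isT Bth; rewrite FiZ /FZ EE Ex Es EY EZ.
  rewrite (eq_bigr (fun i => \sum_j pd (lo k) (G (lo i) (lo j)) (geo_point x0 Y X th) * (zeta i th * zeta j th))); last first.
    by move=> i _; apply: eq_bigr => j _; rewrite !EZ.
  rewrite [X in 2 * _ * _ * X](eq_bigr (fun i => pd (lo k) (b (lo i)) (geo_point x0 Y X th) * zeta i th * eta th)); last first.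
    by move=> i _; rewrite EZ.
  have -> : w th 0 (iZ k) = zeta k th - z0 k by rewrite /zeta addrC addKr.
  set A := th 0 l * pd _ _ _; lra.
have eqX k th : origin_ball d1 th -> th 0 l * pd l (X k) th + X k th =
  \sum_j G (lo k) (lo j) (geo_point x0 Y X th) * zeta j th + Y th * b (lo k) (geo_point x0 Y X th) * eta th.
  move=> Bth; have := ode (iX k) (X0 k) th isT Bth; rewrite FiX /FX EE Ex EY.
  rewrite (eq_bigr (fun j => G (lo k) (lo j) (geo_point x0 Y X th) * zeta j th)); last first.
    by move=> i _; rewrite EZ.
  have -> : w th 0 (iX k) = X k th - X0 k by rewrite /X addrC addKr.
  set A := th 0 l * pd _ _ _; lra.
have eqY th : origin_ball d1 th ->
  Y th * (b l (geo_point x0 Y X th) * eta th ^+ 2 + 2 * th 0 l * \sum_k b (lo k) (geo_point x0 Y X th) * zeta k th * eta th) +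
  th 0 l * \sum_k \sum_k' G (lo k) (lo k') (geo_point x0 Y X th) * (zeta k th * zeta k' th) = 1.
  move=> Bth; have := weq _ Bth iY; rewrite /t eqxx /= FiY /FY EE Ex Es EY.
  rewrite (eq_bigr (fun k => b (lo k) (geo_point x0 Y X th) * zeta k th * eta th)); last first.
    by move=> i _; rewrite EZ.
  rewrite [X in _ + th 0 l * X](eq_bigr (fun k => \sum_k' G (lo k) (lo k') (geo_point x0 Y X th) * (zeta k th * zeta k' th))); last first.
    by move=> i _; apply: eq_bigr => j _; rewrite !EZ.
  set A := Y th * _ + _ => H; have : Y0 * (A - 1) = 0 by move: H; rewrite /Y; lra.
  by move=> /eqP; rewrite mulf_eq0 (negbTE b0) /= subr_eq0 => /eqP.
have B10 : origin_ball d1 (0 : 'rV[R]_m) by rewrite /origin_ball /= normr0.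
have [eta00 Y00] : eta 0 != 0 /\ Y 0 != 0.
  have := eqY _ B10; rewrite mxE mulr0 !mul0r !addr0 => E; split; apply/eqP => z.
    by move: E; rewrite z expr2 !mulr0 => /eqP; rewrite eq_sym oner_eq0.
  by move: E; rewrite z mul0r => /eqP; rewrite eq_sym oner_eq0.
(* By [eqeta] this is the sum required to be nonzero by [Qneq0]. It equals [eta] at the origin,
   whence the smaller ball below. *)
pose g th := eta th - 2 * (th 0 l * pd l eta th).
have cg : Cinf (origin_ball d1) g.
  move=> k; apply: (CkB oB1); first exact: cc.
  apply: (CkM oB1); first exact: Ck_cst.
  by apply: (CkM oB1); [exact: Ck_coord|exact: (Cinf_D _ oB1 (cc _ _))].
have [d2 d20 Hg] : exists2 d2 : R, 0 < d2 & forall th : 'rV[R]_m, `|th| < d2 -> g th != 0.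
  have g0 : g 0 = eta 0 by rewrite /g mxE mul0r mulr0 subr0.
  have /cvgrPdist_lt/(_ `|g 0|) := Ck_cont (cg 0%N) B10.
  rewrite g0 normr_gt0 => /(_ eta00) /nbhs_dist[d2 d20 H]; exists d2 => // th thd.
  have := H th; rewrite subr0 => /(_ thd); apply: contraTneq => ->.
  by rewrite subr0 ltxx.
pose d := Num.min d1 d2.
have d0 : 0 < d by rewrite lt_min d10.
have sub : origin_ball d `<=` (origin_ball d1 : set 'rV[R]_m).
  by move=> th; rewrite /origin_ball /= lt_min => /andP[].
have Bg th : origin_ball d th -> g th != 0.
  by rewrite /origin_ball /= lt_min => /andP[_]; exact: Hg.
have ccd c a : Cinf (origin_ball d) (fun th => c + w th 0 a).
  by move=> k; exact: (Ck_sub sub (cc c a k)).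
have oB := @open_origin_ball R m d; have sB := @star_origin_ball R m l d.
have Qn th : origin_ball d th -> \sum_i \sum_j pd l (G i j) (geo_point x0 Y X th) *
     (geo_momentum eta zeta i th * geo_momentum eta zeta j th) != 0.
  move=> Bth; have := eqeta _ (sub _ Bth); set S := \sum_i _ => E.
  by rewrite (_ : S = g th) ?Bg // /g; move: E; set A := _ * pd l eta th; lra.
have WPhi' th Bth := WPhi th (sub th Bth).
have eqeta' th Bth := eqeta th (sub th Bth).
have eqY' th Bth := eqY th (sub th Bth).
have eqzeta' k th Bth := eqzeta k th (sub th Bth).
have eqX' k th Bth := eqX k th (sub th Bth).
exists d, (geo_point x0 Y X), (geo_momentum eta zeta).
have B0 : origin_ball d (0 : 'rV[R]_m) by rewrite /origin_ball /= normr0.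
split; split => //.
- by move=> i; apply: cPhi => // *; exact: ccd.
- apply/rowP => i; rewrite mxE; case: unliftP => [k ->|->]; rewrite !mxE mul0r ?x0l //.
  by rewrite !addr0.
(* At the origin the rows of the Jacobian other than [l] are unit vectors and row [l] has last entry
   [Y 0], so the matrix is triangular with nonzero diagonal. *)
- rewrite -row_free_unit; apply: inj_row_free => v vJ.
  have dc i j : derivable (fun th : 'rV[R]_m => th 0 i : R) 0 'e_j by exact/diff_derivable/differentiable_coord.
  have Jl c : pd c (fun th => geo_point x0 Y X th 0 l) 0 = (c == l)%:R * Y 0.
    rewrite PhilE (pdM (dc l c) (Cinf_derivable (ccd _ _) B0)) mxE mul0r add0r pd_coord.
    by rewrite mulrC.
  have Jk c k : pd c (fun th => geo_point x0 Y X th 0 (lo k)) 0 = (c == lo k)%:R + (c == l)%:R * X k 0.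
    have dX : derivable (X k) 0 'e_c by exact: (Cinf_derivable (ccd _ _) B0).
    rewrite PhiE (pdD (derivableD (derivable_cst _ _ _) (dc (lo k) c)) (derivableM (dc l c) dX)).
    rewrite (pdD (derivable_cst _ _ _) (dc (lo k) c)) pd_cst add0r pd_coord (pdM (dc l c) dX).
    by rewrite mxE mul0r add0r pd_coord [X k 0 * _]mulrC.
  have vl : v 0 l = 0.
    have /rowP/(_ l) := vJ; rewrite !mxE (bigD1 l) //= big1 ?addr0.
      by rewrite mxE Jl eqxx mul1r => /eqP; rewrite mulf_eq0 (negbTE Y00) orbF => /eqP.
    by move=> i il; rewrite mxE Jl (negbTE il) mul0r mulr0.
  apply/rowP => i; rewrite [RHS]mxE; case: (unliftP l i) => [k ->|->] //.
  have /rowP/(_ (lo k)) := vJ; rewrite !mxE (bigD1 (lo k)) //= big1 ?addr0.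
    by rewrite mxE Jk eqxx eq_sym (negbTE (neq_lift _ _)) mul0r addr0 mulr1.
  move=> j jk; rewrite mxE Jk (negbTE jk) add0r.
  by have [->|jl] := eqVneq j l; rewrite ?vl ?mul0r ?mulr0.
- by move=> th _ th0; rewrite mxE unlift_none th0 mul0r.
- move=> th i Bth; apply: (velocity oW oB cG symG cb Gb (X := X)) => // *; exact: ccd.
- move=> th Bth s0; apply: (momentum_velocity oW oB cG symG cb Gb (X := X)) => // *; exact: ccd.
- move=> c th cl Bth s0; apply: (momentum_tangent oW oB sB cG symG cb Gb (X := X)) => // *; exact: ccd.
Qed.

End GeodesicSystem.

(** * Charts and dual metrics *)

Section LinearAlgebra.
Context {R : realType} {m : nat}.
Implicit Types (B S : 'M[R]_m) (u v mu X : 'rV[R]_m).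

Lemma bil_delta B i j : bil B 'e_i 'e_j = B i j.
Proof. by rewrite /bil -rowE trmx_delta -colE !mxE. Qed.

Lemma pairing_sum mu X : pairing mu X = \sum_k mu 0 k * X 0 k.
Proof. by rewrite /pairing mxE; apply: eq_bigr => k _; rewrite mxE mulrC. Qed.

Lemma bil_pairing B u v : bil B u v = pairing (u *m B) v.
Proof. by rewrite /bil pairing_sum mxE; apply: eq_bigr => k _; rewrite [v^T _ _]mxE. Qed.

Lemma pairing0 X : pairing 0 X = 0.
Proof. by rewrite pairing_sum big1 // => k _; rewrite mxE mul0r. Qed.

Lemma dual_form_inverse B S : (forall X Y, bil B X Y = bil B Y X) ->
  radical B = [set 0] -> dual_form B S -> [/\ B \in unitmx, S = invmx B & S^T = S].
Proof.
move=> symB radB dual.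
have uB : B \in unitmx.
  rewrite -row_free_unit; apply: inj_row_free => v vB.
  have : radical B v by move=> w; rewrite bil_pairing vB pairing0.
  by rewrite radB.
have BT : B^T = B by apply/matrixP => i j; rewrite mxE -!bil_delta symB.
have SE : S = invmx B.
  apply/matrixP => i j; rewrite -!bil_delta.
  rewrite (dual _ _ ('e_i *m invmx B) ('e_j *m invmx B)); first last.
  - by move=> w; rewrite bil_pairing mulmxKV.
  - by move=> w; rewrite bil_pairing mulmxKV.
  by rewrite /bil mulmxKV // trmx_mul trmx_inv BT mulmxA.
by split => //; rewrite SE trmx_inv BT.
Qed.

Lemma singular_radical S : \det S = 0 -> exists2 mu, mu != 0 & radical S mu.
Proof.
move=> dS; have [mu mu0 muS] : exists2 mu : 'rV[R]_m, mu != 0 & mu *m S = 0.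
  apply: contrapT => h; have : S \in unitmx.
    rewrite -row_free_unit; apply: inj_row_free => v vS.
    by apply: contrapT => v0; apply: h; exists v => //; exact/eqP.
  by rewrite unitmxE dS unitr0.
by exists mu => // v; rewrite bil_pairing muS pairing0.
Qed.

End LinearAlgebra.

Section Charts.
Context {R : realType} {m : nat} (M : manifold R m).
Implicit Types (c d : chart R m M) (q : M).

Lemma chart_invK c y : (chart_map c @` chart_dom c) y ->
  chart_dom c (chart_inv c y) /\ chart_map c (chart_inv c y) = y.
Proof. by move=> [q cq <-]; rewrite chart_mapK. Qed.

Lemma open_chart_image c (A : set M) : open A -> open (chart_map c @` (chart_dom c `&` A)).
Proof.
move=> oA; rewrite openE => y [q [cq Aq] qy].
have yi : (chart_map c @` chart_dom c) y by exists q.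
have iy : chart_inv c y = q by rewrite -qy chart_mapK.
have H1 := open_nbhs_nbhs (conj (@chart_img_open _ _ _ c) yi).
have H2 : \forall z \near y, A (chart_inv c z).
  apply: (chart_inv_continuous yi); rewrite iy; exact: open_nbhs_nbhs.
apply: filterS2 H1 H2 => z /chart_invK[z1 z2] Az.
by exists (chart_inv c z).
Qed.

Lemma open_chart_preimage c (A : set 'rV[R]_m) : open A ->
  open (chart_dom c `&` chart_map c @^-1` A).
Proof.
move=> oA; rewrite openE => q [cq Aq].
have H1 := open_nbhs_nbhs (conj (chart_dom_open c) cq).
have H2 : \forall z \near q, A (chart_map c z).
  by apply: (chart_map_continuous cq); exact: open_nbhs_nbhs.
by apply: filterS2 H1 H2 => z.
Qed.

Lemma atlas_coordinate c : atlas c -> coordinate_system c.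
Proof. by move=> ac d ad; exact: atlas_compatible. Qed.

(** A coordinate system is only compared with charts of the atlas, so the transition between two of
    them is factored, near each point, through the atlas chart at that point. *)
Lemma transition_smooth c d j : coordinate_system c -> coordinate_system d ->
  Cinf (chart_map c @` (chart_dom c `&` chart_dom d)) (fun y => chart_map d (chart_inv c y) 0 j).
Proof.
move=> hc hd; apply: Cinf_local => y [q [cq dq] qy].
pose e := chart_at q; have ae := chart_at_atlas q; have eq := chart_at_dom q.
have [ce _] := hc e ae; have [_ ed] := hd e ae.
pose A := chart_dom d `&` chart_dom e.
have oA : open A by apply: openI; exact: chart_dom_open.
have oV := open_chart_image (c := c) (oA).
have oce := open_chart_image (c := c) (chart_dom_open e).
have oed : open (chart_map e @` (chart_dom d `&` chart_dom e)).
  by rewrite setIC; apply: open_chart_image; exact: chart_dom_open.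
exists (chart_map c @` (chart_dom c `&` A)); split; first by exists q.
move=> k; apply: (Ck_ext oV (f := fun y => (chart_map d \o chart_inv e) ((chart_map e \o chart_inv c) y) 0 j)).
  by move=> _ [q' [cq' [dq' eq']] <-] /=; rewrite chart_mapK // chart_mapK.
apply: (Ck_comp (f := fun z => (chart_map d \o chart_inv e) z 0 j) (g := chart_map e \o chart_inv c) oV oed).
- by move=> _ [q' [cq' [dq' eq']] <-] /=; rewrite chart_mapK //; exists q'.
- exact: (smooth_on_coord j oed ed).
move=> i; apply: (Ck_sub _ (smooth_on_coord i oce ce k)).
by move=> _ [q' [cq' [dq' eq']] <-]; exists q'.
Qed.

Section NewChart.
Variables (c : chart R m M) (U V : set 'rV[R]_m) (f g : 'rV[R]_m -> 'rV[R]_m).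
Hypothesis oU : open U.
Hypothesis oV : open V.
Hypothesis Uc : U `<=` chart_map c @` chart_dom c.
Hypothesis fU : forall x, U x -> V (f x) /\ g (f x) = x.
Hypothesis gV : forall y, V y -> U (g y) /\ f (g y) = y.
Hypothesis cf : forall j, Cinf U (fun x => f x 0 j).
Hypothesis cg : forall j, Cinf V (fun x => g x 0 j).

Let nd : set M := chart_dom c `&` chart_map c @^-1` U.

Lemma new_chart_img : (f \o chart_map c) @` nd = V.
Proof.
apply/seteqP; split=> [_ [q [cq Uq] <-]|y Vy]; first by have [] := fU Uq.
have [Ug fg] := gV Vy; have [h1 h2] := chart_invK (Uc Ug).
exists (chart_inv c (g y)); last by rewrite /= h2.
by split => //; rewrite /= h2.
Qed.

Lemma new_chart_img_open : open ((f \o chart_map c) @` nd).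
Proof. by rewrite new_chart_img. Qed.

Lemma new_chart_mapK q : nd q -> (chart_inv c \o g) ((f \o chart_map c) q) = q.
Proof. by move=> [cq Uq] /=; have [_ ->] := fU Uq; rewrite chart_mapK. Qed.

Lemma new_chart_map_continuous q : nd q -> {for q, continuous (f \o chart_map c)}.
Proof.
move=> [cq Uq]; apply: continuous_comp; first exact: chart_map_continuous.
by apply: continuous_row => j; exact: (Ck_cont (cf j 0%N) Uq).
Qed.

Lemma new_chart_inv_continuous y : ((f \o chart_map c) @` nd) y ->
  {for y, continuous (chart_inv c \o g)}.
Proof.
rewrite new_chart_img => Vy; apply: continuous_comp.
  by apply: continuous_row => j; exact: (Ck_cont (cg j 0%N) Vy).
by apply: chart_inv_continuous; apply: Uc; have [] := gV Vy.
Qed.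

Definition new_chart : chart R m M :=
  Chart (open_chart_preimage c oU) new_chart_img_open new_chart_mapK
    new_chart_map_continuous new_chart_inv_continuous.

Lemma new_chart_coordinate : coordinate_system c -> coordinate_system new_chart.
Proof.
move=> hc d ad.
have oS := open_chart_image (c := new_chart) (chart_dom_open d).
have oS' : open (chart_map d @` (chart_dom new_chart `&` chart_dom d)).
  by rewrite setIC; apply: open_chart_image; exact: chart_dom_open.
have [cd dc] := hc d ad.
have ocd := open_chart_image (c := c) (chart_dom_open d).
have odc : open (chart_map d @` (chart_dom c `&` chart_dom d)).
  by rewrite setIC; apply: open_chart_image; exact: chart_dom_open.
split; apply: coord_smooth_on => // j k.
  apply: (Ck_comp (f := fun z => (chart_map d \o chart_inv c) z 0 j) (g := g) oS ocd).
  - move=> _ [q [[cq Uq] dq] <-] /=; have [_ ->] := fU Uq; by exists q.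
  - exact: (smooth_on_coord j ocd cd).
  - move=> i; apply: (Ck_sub _ (cg i k)) => _ [q [[cq Uq] dq] <-].
    by have [] := fU Uq.
apply: (Ck_comp (f := fun z => f z 0 j) (g := chart_map c \o chart_inv d) oS' oU).
- by move=> _ [q [[cq Uq] dq] <-] /=; rewrite chart_mapK.
- exact: cf.
- move=> i; apply: (Ck_sub _ (smooth_on_coord i odc dc k)).
  by move=> _ [q [[cq Uq] dq] <-]; exists q.
Qed.

End NewChart.

(** Both arguments are components in [chart_at q], a choice that may jump with [q]. The chain rule
    through this chart shows that the pairing is free of the choice: it is a partial derivative in
    [c]. *)
Lemma pairing_dfun_dvect c (f : M -> R) (U : set M) q i : coordinate_system c ->
  chart_dom c q -> open U -> U q ->
  Cinf (chart_map (chart_at q) @` (chart_dom (chart_at q) `&` U)) (f \o chart_inv (chart_at q)) ->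
  pairing (dfun f q) (dvect c i q) = pd i (f \o chart_inv c) (chart_map c q).
Proof.
move=> hc cq oU Uq cf; set d := chart_at q in cf *.
have ad := chart_at_atlas q; have dq : chart_dom d q := chart_at_dom q.
have oW := open_chart_image (c := d) (oU).
have oce := open_chart_image (c := c) (chart_dom_open d).
have [ce _] := hc d ad.
have yq : (chart_map c @` (chart_dom c `&` chart_dom d)) (chart_map c q) by exists q.
have dT j : differentiable (fun y => (chart_map d \o chart_inv c) y 0 j : R) (chart_map c q).
  by have [] := Ck_diff oce (smooth_on_coord j oce ce 1%N) yq.
have -> : pd i (f \o chart_inv c) (chart_map c q) =
    pd i (fun y => (f \o chart_inv d) ((chart_map d \o chart_inv c) y)) (chart_map c q).
  apply: (eq_pd i oce _ yq) => _ [q' [cq' dq'] <-] /=.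
  by rewrite chart_mapK // chart_mapK.
have TE : (chart_map d \o chart_inv c) (chart_map c q) = chart_map d q by rewrite /= chart_mapK.
rewrite /pd (derive_comp (f := f \o chart_inv d) (g := chart_map d \o chart_inv c)) //; last first.
  rewrite TE; have Wq : (chart_map d @` (chart_dom d `&` U)) (chart_map d q) by exists q.
  by have [] := Ck_diff oW (cf 1%N) Wq.
rewrite pairing_sum; apply: eq_bigr => k _; rewrite mxE TE; congr (_ * _).
rewrite /dvect derive_coord //; exact: differentiable_row.
Qed.

Lemma pairing_dcoord c e q a i : coordinate_system c -> coordinate_system e ->
  chart_dom c q -> chart_dom e q ->
  pairing (dfun (chart_coord e a) q) (dvect c i q) =
  pd i (fun y => chart_map e (chart_inv c y) 0 a) (chart_map c q).
Proof.
move=> hc he cq eq.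
apply: (pairing_dfun_dvect (f := chart_coord e a) i hc cq (chart_dom_open e) eq).
exact: (transition_smooth a (atlas_coordinate (chart_at_atlas q)) he).
Qed.

Lemma pairing_dual_basis c q a i : coordinate_system c -> chart_dom c q ->
  pairing (dfun (chart_coord c a) q) (dvect c i q) = (i == a)%:R.
Proof.
move=> hc cq; rewrite pairing_dcoord //.
have yi : (chart_map c @` chart_dom c) (chart_map c q) by exists q.
rewrite (eq_pd (g := fun y => y 0 a) i (@chart_img_open _ _ _ c) _ yi) ?pd_coord //.
by move=> y /chart_invK[_ ->].
Qed.

Definition dcoord_mx c q : 'M[R]_m := \matrix_a dfun (chart_coord c a) q.
Definition dvect_mx c q : 'M[R]_m := \matrix_i dvect c i q.

Lemma dvect_dcoord c q : coordinate_system c -> chart_dom c q ->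
  dvect_mx c q *m (dcoord_mx c q)^T = 1%:M.
Proof.
move=> hc cq; apply/matrixP => i a; rewrite !mxE -(pairing_dual_basis a i hc cq) pairing_sum.
by apply: eq_bigr => k _; rewrite !mxE mulrC.
Qed.

Lemma dcoord_unit c q : coordinate_system c -> chart_dom c q ->
  (dcoord_mx c q)^T \in unitmx /\ dvect_mx c q \in unitmx.
Proof. by move=> hc cq; have [] := mulmx1_unit (dvect_dcoord hc cq). Qed.

(** Makes condition (D1) available for coordinate coframes. Smoothness holds because the components
    of [dfun (chart_coord c a)] in another coordinate system are partial derivatives of a transition
    map. *)
Lemma coframe_dcoord c : coordinate_system c ->
  coframe (chart_dom c) (fun a q => dfun (chart_coord c a) q).
Proof.
move=> hc; split=> [a e he i e' he'|q cq]; last first.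
  by rewrite row_free_unit -unitmx_tr; have [] := dcoord_unit hc cq.
have oce' : open (chart_map e' @` (chart_dom e' `&` (chart_dom c `&` chart_dom e))).
  by apply: open_chart_image; apply: openI; exact: chart_dom_open.
have oec := open_chart_image (c := e) (chart_dom_open c).
apply/(smooth_on_Cinf _ oce') => k.
apply: (Ck_ext oce' (f := fun y => pd i (fun y => chart_map c (chart_inv e y) 0 a) (chart_map e (chart_inv e' y)))).
  by move=> _ [q [e'q [cq eq]] <-] /=; rewrite chart_mapK // pairing_dcoord.
apply: (Ck_comp (f := pd i (fun y => chart_map c (chart_inv e y) 0 a)) (g := fun y => chart_map e (chart_inv e' y)) oce' oec).
- by move=> _ [q [e'q [cq eq]] <-] /=; rewrite chart_mapK //; exists q.
- by apply: Cinf_D => //; exact: transition_smooth.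
move=> j; apply: (Ck_sub _ (transition_smooth j he' he k)).
by move=> _ [q [e'q [cq eq]] <-]; exists q.
Qed.

End Charts.

(** The complement of the hyperplane is dense. This carries the symmetry of [g*], obtained from [g]
    off the polar end, over to the polar end. *)
Lemma eq0_off_hyperplane (R : realType) m (l : 'I_m) (W : set 'rV[R]_m) (h : 'rV[R]_m -> R) :
  open W -> (forall x, W x -> {for x, continuous h}) ->
  (forall x, W x -> x 0 l != 0 -> h x = 0) -> forall x, W x -> h x = 0.
Proof.
move=> oW ch h0 x Wx; have [xl|/h0] := eqVneq (x 0 l) 0; last exact.
apply/eqP/negP => /negP hx.
have /cvgrPdist_lt/(_ `|h x|) := ch x Wx; rewrite normr_gt0 => /(_ hx) H.
have [d d0 Hd] := (nbhs_dist _ _).1 (filterI (open_nbhs_nbhs (conj oW Wx)) H).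
have [|Wy] := Hd (d / 2 *: 'e_l + x).
  rewrite addrK; apply: le_lt_trans (_ : d / 2 < _); last by rewrite ltr_pdivrMr // ltr_pMr // ltr1n.
  have d20 : 0 <= d / 2 by rewrite divr_ge0 // ltW.
  apply: norm_row_le => // k; rewrite !mxE normrM (ger0_norm d20) ler_piMr //.
  by case: (_ && _); rewrite ?normr1 ?normr0.
rewrite (h0 (d / 2 *: 'e_l + x)) //; first by rewrite subr0 ltxx.
by rewrite !mxE !eqxx mulr1 xl addr0 mulf_neq0 ?gt_eqF ?invr_gt0.
Qed.

(** For a real variable all directions are multiples of 1: the iterated derivative along the list
    [s] is the product of its entries times the derivative of [f] of order [size s] in direction
    [v]. *)
Lemma smooth_on_line (R : realType) m (W : normedModType R) (U : set 'rV[R]_m) (f : 'rV[R]_m -> W) x v (e : R) :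
  smooth_on U f -> (forall t, ball (0 : R) e t -> U (t *: v + x)) ->
  smooth_on (ball (0 : R) e) (fun t : R => f (t *: v + x)).
Proof.
move=> sf Ut s.
pose g (k : nat) := iter_derive (nseq k v) f.
have dline (t : R) : differentiable (fun t : R => t *: v + x) t.
  by apply: differentiableD; [exact: ex_diff|exact: differentiable_cst].
have dg (k : nat) (t : R) : ball (0 : R) e t -> differentiable (fun t : R => g k (t *: v + x)) t.
  move=> te; apply: (differentiable_comp (f := fun t : R => t *: v + x)) => //.
  exact: sf (Ut t te).
have Dg (k : nat) (t : R) : ball (0 : R) e t -> 'D_1 (fun t : R => g k (t *: v + x)) t = g k.+1 (t *: v + x).
  move=> te; have d := is_derive_line (diff_derivable (v := v) (sf (nseq k v) _ (Ut t te))).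
  exact: (@derive_val _ _ _ _ _ _ _ d).
have oe : open (ball (0 : R) e) by exact: ball_open.
have E : forall t : R, ball (0 : R) e t ->
    iter_derive s (fun t : R => f (t *: v + x)) t = (\prod_(a <- s) a) *: g (size s) (t *: v + x).
  elim: s => [|a s IH] t te /=; first by rewrite big_nil scale1r.
  have En : \forall u \near t, iter_derive s (fun t : R => f (t *: v + x)) u =
      (\prod_(a <- s) a) *: g (size s) (u *: v + x) by exact: near_open oe te IH.
  rewrite (near_eq_derive _ En) deriveZ; last exact/diff_derivable/dg.
  rewrite big_cons [a * _]mulrC -scalerA; congr (_ *: _).
  rewrite deriveE; last exact: dg.
  rewrite -[a in LHS]mulr1 -[a * 1]/(a *: 1) linearZ /= -deriveE; last exact: dg.
  by rewrite Dg.
move=> t te; apply/derivable1_diffP.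
have En : \forall u \near t, (\prod_(a <- s) a) *: g (size s) (u *: v + x) =
    iter_derive s (fun t : R => f (t *: v + x)) u.
  by apply: near_open oe te _ => u ue; rewrite E.
by apply: near_eq_derivable En _; apply/derivable1_diffP/differentiableZ/dg.
Qed.

(** * Coordinates around the polar end *)

Section PolarEnd.
Context {R : realType} {n : nat} (M : manifold R n.+1) (D : set M) (g gs : M -> 'M[R]_n.+1).
Hypothesis hM : RL_polar_end D g gs.
Notation m := n.+1.
Notation l := (ord_max : 'I_n.+1).

Definition dual_gram (c : chart R m M) (q : M) : 'M[R]_m :=
  \matrix_(a, b) bil (gs q) (dfun (chart_coord c a) q) (dfun (chart_coord c b) q).

Lemma dual_gramE c q : dual_gram c q = dcoord_mx c q *m gs q *m (dcoord_mx c q)^T.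
Proof.
apply/matrixP => a b; rewrite mxE /bil.
have -> : dfun (chart_coord c a) q = row a (dcoord_mx c q) by rewrite rowK.
have -> : dfun (chart_coord c b) q = row b (dcoord_mx c q) by rewrite rowK.
rewrite -row_mul tr_row [LHS]mxE [RHS]mxE; apply: eq_bigr => k _.
by congr (_ * _); rewrite mxE.
Qed.

Lemma dual_gram_smooth c e i j : coordinate_system c -> coordinate_system e ->
  Cinf (chart_map e @` (chart_dom e `&` chart_dom c)) (fun y => dual_gram c (chart_inv e y) i j).
Proof.
move=> hc he; have := RL_gs_smooth hM hc i j he.
rewrite setTI smooth_on_Cinf; last by apply: open_chart_image; exact: chart_dom_open.
move=> h k; apply: (Ck_ext _ _ (h k)); first by apply: open_chart_image; exact: chart_dom_open.
by move=> y _ /=; rewrite mxE.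
Qed.

Lemma gram_det_D c q : coordinate_system c -> chart_dom c q -> D q -> \det (dual_gram c q) = 0.
Proof.
move=> hc cq Dq.
have [h _] := RL_D1 hM (chart_dom_open c) (ex_intro _ q (conj cq Dq)) (coframe_dcoord hc).
by have : (chart_dom c `&` D) q by []; rewrite h => -[].
Qed.

Lemma gram_det_notD c p q : coordinate_system c -> chart_dom c p -> D p -> chart_dom c q ->
  \det (dual_gram c q) = 0 -> D q.
Proof.
move=> hc cp Dp cq dq.
have [h _] := RL_D1 hM (chart_dom_open c) (ex_intro _ p (conj cp Dp)) (coframe_dcoord hc).
have : [set p | chart_dom c p /\ coframe_det gs (fun a q => dfun (chart_coord c a) q) p = 0] q by [].
by rewrite -h => -[].
Qed.

(** (D1) speaks of the differential in the reference chart. If all partials in [c] vanished, that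
    differential would pair to zero with the basis [dvect c i], hence be zero. *)
Lemma gram_det_derive c p : coordinate_system c -> chart_dom c p -> D p ->
  exists i, pd i (fun y => \det (dual_gram c (chart_inv c y))) (chart_map c p) != 0.
Proof.
move=> hc cp Dp.
have [_ h] := RL_D1 hM (chart_dom_open c) (ex_intro _ p (conj cp Dp)) (coframe_dcoord hc).
have F0 := h p (conj cp Dp); set F := coframe_det _ _ in F0.
apply: contrapT => nex; move/eqP: F0; apply.
have hd := atlas_coordinate (chart_at_atlas p).
have oS := open_chart_image (c := chart_at p) (chart_dom_open c).
have cF : Cinf (chart_map (chart_at p) @` (chart_dom (chart_at p) `&` chart_dom c)) (F \o chart_inv (chart_at p)).
  move=> k; apply: (Ck_ext oS (f := fun y => \det (dual_gram c (chart_inv (chart_at p) y)))) => //.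
  by apply: Ck_det => // i j; exact: dual_gram_smooth.
have P0 i : pairing (dfun F p) (dvect c i p) = 0.
  rewrite (pairing_dfun_dvect i hc cp (chart_dom_open c) cp cF).
  by apply: contrapT => /eqP ne; apply: nex; exists i.
have [_ uD] := dcoord_unit hc cp.
apply: trmx_inj; rewrite trmx0 -[LHS](mulKmx uD).
rewrite (_ : dvect_mx c p *m _ = 0) ?mulmx0 //.
apply/matrixP => i j; rewrite (ord1 j) mxE [RHS]mxE -[RHS](P0 i) pairing_sum.
by apply: eq_bigr => k _; rewrite !mxE mulrC.
Qed.

(** By (D1) the determinant of the Gram matrix of [g*] is an equation of the polar end with nonzero
    differential, so it can serve as the last coordinate. *)
Lemma straight_chart p : D p -> exists c : chart R m M, [/\ coordinate_system c,
  chart_dom c p & forall q, chart_dom c q -> D q <-> chart_coord c l q = 0].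
Proof.
move=> Dp; pose c := chart_at p.
have hc : coordinate_system c := atlas_coordinate (chart_at_atlas p).
have cp : chart_dom c p := chart_at_dom p.
pose U := chart_map c @` chart_dom c.
have oU : open U by exact: chart_img_open.
have Up : U (chart_map c p) by exists p.
have [k dk] := gram_det_derive hc cp Dp.
set F := (fun y => _) in dk.
have cF : Cinf U F.
  move=> j; apply: Ck_det => // a b.
  by have := dual_gram_smooth a b hc hc j; rewrite setIid.
(* The determinant takes the place of a coordinate [k] along which its derivative is nonzero; the
   transposition moves the old last coordinate to position [k]. *)
pose f (x : 'rV[R]_m) : 'rV[R]_m := \row_i (if i == l then F x else x 0 (tperm k l i)).
have fl : (fun x => f x 0 l) = F by apply/funext => x; rewrite mxE eqxx.
have fi i : i != l -> (fun x => f x 0 i) = (fun x => x 0 (tperm k l i)).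
  by move=> il; apply/funext => x; rewrite mxE (negbTE il).
have cf i : Cinf U (fun x => f x 0 i).
  have [->|il] := eqVneq i l; first by rewrite fl.
  by rewrite fi // => j; exact: Ck_coord.
have uJ : \matrix_(i, j) pd i (fun x => f x 0 j) (chart_map c p) \in unitmx.
  rewrite -row_free_unit; apply: inj_row_free => v vJ.
  have vi i : i != k -> v 0 i = 0.
    move=> ik; pose j := tperm k l i.
    have jl : j != l by rewrite /j -(inj_eq (@perm_inj _ (tperm k l))) tpermK tpermR.
    have /rowP/(_ j) := vJ; rewrite !mxE (bigD1 i) //= big1 ?addr0.
      by rewrite mxE fi // pd_coord /j tpermK eqxx mulr1.
    by move=> i' i'i; rewrite mxE fi // pd_coord /j tpermK (negbTE i'i) mulr0.
  apply/rowP => i; rewrite [RHS]mxE; have [->|/vi] := eqVneq i k; last exact.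
  have /rowP/(_ l) := vJ; rewrite !mxE (bigD1 k) //= big1 ?addr0.
    by rewrite mxE fl => /eqP; rewrite mulf_eq0 (negbTE dk) orbF => /eqP.
  by move=> i' i'k; rewrite vi ?mul0r.
have [U' [V [h [[oU' oV U'p U'U] [fU hV ch]]]]] := inverse_function oU Up cf uJ l.
pose z := new_chart oU' oV U'U fU hV (fun j k => Ck_sub U'U (cf j k)) ch.
exists z; split.
- exact: new_chart_coordinate.
- by split.
- move=> q [cq U'q].
  have -> : chart_coord z l q = \det (dual_gram c q).
    by rewrite /chart_coord /= mxE eqxx /F chart_mapK.
  by split; [exact: gram_det_D|exact: (gram_det_notD hc cp Dp cq)].
Qed.


Lemma gram_sym c q : coordinate_system c -> chart_dom c q -> ~ D q ->
  (dual_gram c q)^T = dual_gram c q.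
Proof.
move=> hc cq nDq.
have [_ _ sS] := dual_form_inverse (RL_g_sym hM nDq) (RL_g_nondegenerate hM nDq) (RL_gs_dual hM nDq).
by rewrite dual_gramE !trmx_mul trmxK sS mulmxA.
Qed.

Section Straight.
Variable c : chart R m M.
Hypothesis hc : coordinate_system c.
Hypothesis Dc : forall q, chart_dom c q -> D q <-> chart_coord c l q = 0.
Let U := chart_map c @` chart_dom c.
Let oU : open U. Proof. exact: chart_img_open. Qed.

Lemma dvect_tangent q i : chart_dom c q -> D q -> i != l -> tangent_to D q (dvect c i q).
Proof.
move=> cq Dq il; pose d := chart_at q.
have dq : chart_dom d q := chart_at_dom q.
have oA := open_chart_image (c := c) (chart_dom_open d).
have Ay : (chart_map c @` (chart_dom c `&` chart_dom d)) (chart_map c q) by exists q.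
have [e e0 He] := (nbhs_dist _ _).1 (open_nbhs_nbhs (conj oA Ay)).
have line (t : R) : ball (0 : R) e t ->
    (chart_map c @` (chart_dom c `&` chart_dom d)) (t *: 'e_i + chart_map c q).
  rewrite -ball_normE /= sub0r normrN => te; apply: He; rewrite addrK.
  apply: le_lt_trans te; apply: norm_row_le => // k; rewrite !mxE normrM ler_piMr //.
  by case: (_ && _); rewrite ?normr1 ?normr0.
have [cd _] := hc (chart_at_atlas q).
exists (fun t => chart_inv c (t *: 'e_i + chart_map c q)), e; split => //.
- by rewrite scale0r add0r chart_mapK.
- move=> t /line[q' [cq' dq'] E]; rewrite -E chart_mapK //; split => //.
  apply/Dc => //; rewrite /chart_coord E !mxE.
  have -> : chart_map c q 0 l = 0 by apply/Dc.
  by rewrite eq_sym (negbTE il) mulr0 addr0.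
- exact: (smooth_on_line cd line).
have df : differentiable (chart_map d \o chart_inv c) (0 *: 'e_i + chart_map c q).
  by rewrite scale0r add0r; exact: (cd [::]).
have dl := is_derive_line (diff_derivable (v := 'e_i) df).
have := @derive_val _ _ _ _ _ _ _ dl; rewrite scale0r add0r; exact.
Qed.

(** The radical contains some nonzero [mu], the determinant being zero. By (D2) [mu] annihilates the
    vectors tangent to the polar end, among them [dvect c i q] for [i != l], so it is a nonzero
    multiple of the differential of the last coordinate. *)
Lemma dcoord_radical q : chart_dom c q -> D q -> radical (gs q) (dfun (chart_coord c l) q).
Proof.
move=> cq Dq; pose J := dcoord_mx c q.
have [uJ uD] := dcoord_unit hc cq.
have [mu mu0 rmu] : exists2 mu, mu != 0 & radical (gs q) mu.
  apply: singular_radical; have := gram_det_D hc cq Dq.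
  rewrite dual_gramE !det_mulmx => /eqP; rewrite !mulf_eq0.
  have dJT : \det (dcoord_mx c q)^T != 0 by rewrite -unitfE -unitmxE.
  by have := dJT; rewrite det_tr => /negbTE ->; rewrite orbF => /eqP.
have tang i : i != l -> pairing mu (dvect c i q) = 0.
  move=> il; have := dvect_tangent cq Dq il; rewrite -(RL_D2 hM Dq); exact.
pose u := mu *m invmx J.
have uJ' : J \in unitmx by rewrite -unitmx_tr.
have muE : mu = u *m J by rewrite mulmxKV.
have ui i : pairing mu (dvect c i q) = u 0 i.
  have H : dvect_mx c q *m mu^T = u^T by rewrite muE trmx_mul mulmxA dvect_dcoord // mul1mx.
  have /matrixP/(_ i 0) := H; rewrite [RHS]mxE => <-; rewrite pairing_sum mxE.
  by apply: eq_bigr => k _; rewrite !mxE mulrC.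
have u0 i : i != l -> u 0 i = 0 by move=> /tang; rewrite ui.
have muE2 : mu = u 0 l *: dfun (chart_coord c l) q.
  rewrite muE; apply/rowP => k; rewrite !mxE (bigD1 l) //= big1 ?addr0 ?mxE //.
  by move=> i /u0 ->; rewrite mul0r.
have ul : u 0 l != 0.
  by apply: contra_neq mu0 => z; rewrite muE2 z scale0r.
move=> v; apply: (mulfI ul); rewrite mulr0 -[RHS](rmu v) muE2 !bil_pairing -scalemxAl.
by rewrite !pairing_sum mulr_sumr; apply: eq_bigr => k _; rewrite [in RHS]mxE mulrA.
Qed.

Let G i j x := dual_gram c (chart_inv c x) i j.

Lemma straight_smooth i j : Cinf U (G i j).
Proof. by move=> k; have := dual_gram_smooth i j hc hc k; rewrite setIid. Qed.

Lemma straight_sym i j x : U x -> G i j x = G j i x.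
Proof.
move=> Ux; apply/eqP; rewrite -subr_eq0; apply/eqP; move: x Ux.
apply: (eq0_off_hyperplane (l := l) oU) => x Ux.
  by apply: continuousB; exact: (Ck_cont (straight_smooth _ _ 0%N) Ux).
have [cx xE] := chart_invK Ux => xl.
have nD : ~ D (chart_inv c x) by rewrite Dc // /chart_coord xE; exact/eqP.
by have /matrixP/(_ i j) := gram_sym hc cx nD; rewrite mxE /G => ->; rewrite subrr.
Qed.

Lemma straight_last i x : U x -> x 0 l = 0 -> G l i x = 0.
Proof.
move=> Ux xl; have [cx xE] := chart_invK Ux.
have Dx : D (chart_inv c x) by apply/Dc; rewrite // /chart_coord xE.
by rewrite /G mxE; exact: dcoord_radical.
Qed.

End Straight.

(** The equations of the geodesic coordinates, with velocities and momenta still expressed in the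
    straight chart [c]; the main proof only has to lower indices. *)
Lemma normal_chart p : D p -> exists (z : chart R m M) (c : chart R m M) (P : 'I_m -> 'rV[R]_m -> R),
  [/\ coordinate_system z, coordinate_system c, chart_dom z p & chart_dom z `<=` chart_dom c] /\
  forall q, chart_dom z q -> ~ D q ->
   let s := chart_coord z l q in let Phi a y := chart_map c (chart_inv z y) 0 a in
   [/\ s != 0,
     forall i, s * pd l (Phi i) (chart_map z q) = \sum_j dual_gram c q i j * P j (chart_map z q),
     \sum_i P i (chart_map z q) * pd l (Phi i) (chart_map z q) = 1 &
     forall k, k != l -> \sum_i P i (chart_map z q) * pd k (Phi i) (chart_map z q) = 0].
Proof.
move=> Dp; have [c [hc cp Dc]] := straight_chart Dp.
pose U := chart_map c @` chart_dom c.
have oU : open U by exact: chart_img_open.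
pose x0 := chart_map c p.
have Ux0 : U x0 by exists p.
have x0l : x0 0 l = 0 by apply/(Dc p cp).
have [r r0 Hr] := (nbhs_dist _ _).1 (open_nbhs_nbhs (conj oU Ux0)).
pose W : set 'rV[R]_m := [set x | `|x - x0| < r].
have WU : W `<=` U by move=> x; exact: Hr.
have oW : open W.
  rewrite openE => y yc; apply/nbhs_dist; exists (r - `|y - x0|); first by rewrite subr_gt0.
  move=> z; rewrite ltrBrDr; apply: le_lt_trans.
  by rewrite -(subrKA y); exact: ler_normD.
(* The center [x0] lies on the hyperplane, so rescaling fixes it and does not increase the distance
   to it. *)
have sW : star l W.
  move=> x t Wx t01; apply: le_lt_trans Wx.
  have {1}-> : x0 = rescale l t x0.
    by apply/rowP => i; rewrite mxE; case: eqP => // ->; rewrite x0l mulr0.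
  exact: rescale_dist.
have Wx0 : W x0 by rewrite /W /= subrr normr0.
pose G i j x := dual_gram c (chart_inv c x) i j.
have cG i j : Cinf W (G i j) by move=> k; exact: (Ck_sub WU (straight_smooth hc i j k)).
have symG i j x : W x -> G i j x = G j i x by move=> /WU; exact: straight_sym.
pose b i := avg l 0 (pd l (G l i)).
have cb i : Cinf W (b i) by move=> k; apply: avg_Ck => //; exact: Cinf_D.
have Gb i x : W x -> G l i x = x 0 l * b i x.
  move=> Wx; rewrite (Hadamard oW sW (cG l i 1%N) Wx).
  rewrite [X in X + _](straight_last hc Dc) ?add0r //; last by rewrite mxE eqxx mul0r.
  by apply/WU/sW; rewrite // lexx ler01.
(* Taking the factor [x 0 l] out of the last row of the Gram matrix leaves a matrix [G']. If
   [b l x0] were zero, the last column of [G' x0] would be zero, so the determinant of the Gram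
   matrix would have zero differential at [x0], against (D1). *)
have b0 : b l x0 != 0.
  apply/eqP => bz.
  pose G' x : 'M[R]_m := \matrix_(i, j) (if i == l then b j x else G i j x).
  have detE x : W x -> \det (dual_gram c (chart_inv c x)) = x 0 l * \det (G' x).
    move=> Wx; rewrite (@determinant_multilinear _ _ _ (G' x) (G' x) l (x 0 l) 0) ?mul0r ?addr0 //.
    - apply/rowP => j; rewrite !mxE eqxx mul0r addr0; have := Gb j x Wx.
      by rewrite /G mxE.
    - by apply/matrixP => i j; rewrite !mxE eq_sym (negbTE (neq_lift _ _)) /G mxE.
    - by apply/matrixP => i j; rewrite !mxE eq_sym (negbTE (neq_lift _ _)) /G mxE.
  have cdet : Cinf W (fun x => \det (G' x)).
    move=> k; apply: Ck_det => // i j; have [il|il] := eqVneq i l.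
      by apply: (Ck_ext oW (f := b j)); [move=> x _; rewrite mxE il eqxx|exact: cb].
    by apply: (Ck_ext oW (f := G i j)); [move=> x _; rewrite mxE (negbTE il)|exact: cG].
  have det0 : \det (G' x0) = 0.
    rewrite (expand_det_col _ l) big1 // => i _.
    have -> : G' x0 i l = 0; last by rewrite mul0r.
    rewrite mxE; have [//|il] := eqVneq i l.
    by rewrite symG // Gb // x0l mul0r.
  have [i] := gram_det_derive hc cp Dp; rewrite -/x0 (eq_pd i oW detE Wx0).
  rewrite pdM; [|exact/diff_derivable/differentiable_coord|exact: (Cinf_derivable cdet Wx0)].
  by rewrite det0 x0l !mul0r addr0 eqxx.
have [d [Phi [P [[d0 cPhi PhiW Phi0 uJ] [Phil vel mv mt]]]]] :=
  geodesic_coordinates oW cG symG cb Gb Wx0 x0l b0.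
have B0 : origin_ball d (0 : 'rV[R]_m) by rewrite /origin_ball /= normr0.
have oB := @open_origin_ball R m d.
have [U2 [V [h [[oU2 oV U20 U2B] [PV hU ch]]]]] := inverse_function oB B0 cPhi uJ l.
have VU : V `<=` U.
  by move=> y /hU[/U2B /PhiW /WU]; move=> + E; rewrite E.
(* [Phi] leads from the new coordinates to the old ones, so its local inverse [h] is the chart map
   and [Phi] the inverse map. *)
pose z := new_chart oV oU2 VU hU PV ch (fun j k => Ck_sub U2B (cPhi j k)).
have hz : coordinate_system z by exact: new_chart_coordinate.
exists z, c, P; split.
  split => //; last by move=> q [].
  by split => //=; rewrite -/x0 -Phi0; have [] := PV 0 U20.
move=> q [cq Vq] nDq s Phi'.
set th := chart_map z q.
have [U2th PhE] : U2 th /\ Phi th = chart_map c q := hU _ Vq.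
have Bth := U2B _ U2th.
have sE : s = th 0 l by [].
have s0 : th 0 l != 0.
  apply/eqP => /(Phil _ Bth); rewrite PhE => H; apply: nDq.
  exact/(Dc q cq).
have PE i k : pd k (Phi' i) th = pd k (fun y => Phi y 0 i) th.
  apply: (eq_pd k oU2 _ U2th) => y U2y; rewrite /Phi' /=.
  have [Vy _] := PV y U2y; have [_ ->] := chart_invK (VU _ Vy); by [].
split; rewrite ?sE //.
- move=> i; rewrite PE vel //; apply: eq_bigr => j _.
  by rewrite /G PhE chart_mapK.
- by rewrite -[RHS](mv th Bth s0); apply: eq_bigr => i _; rewrite PE.
- by move=> k kl; rewrite -[RHS](mt k th kl Bth s0); apply: eq_bigr => i _; rewrite PE.
Qed.

End PolarEnd.

Theorem theorem12 (R : realType) (n : nat) (hm : (2 <= n.+1)%N)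
  (M : manifold R n.+1) (D : set M) (g gs : M -> 'M[R]_n.+1)
  (hM : RL_polar_end D g gs) (p : M) (hp : D p) :
  exists z : chart R n.+1 M,
    [/\ coordinate_system z, chart_dom z p &
      forall q, chart_dom z q -> ~ D q ->
        [/\ forall i : 'I_n.+1, i != ord_max ->
              bil (g q) (dvect z i q) (dvect z ord_max q) = 0,
            chart_coord z ord_max q != 0 &
            bil (g q) (dvect z ord_max q) (dvect z ord_max q)
              = 1 / chart_coord z ord_max q]].
Proof.
have [z [c [P [[hz hc zp zc] H]]]] := normal_chart hM hp.
exists z; split => // q zq nDq.
have cq := zc q zq; have [s0 vel mv mt] := H q zq nDq.
set s := chart_coord z ord_max q in s0 vel *.
have [uA SE sS] := dual_form_inverse (RL_g_sym hM nDq) (RL_g_nondegenerate hM nDq) (RL_gs_dual hM nDq).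
pose J := dcoord_mx c q; have [uJ _] := dcoord_unit hc cq.
(* The momentum in the coordinates [c]; its components in the reference chart are [p' *m J]. *)
pose p' : 'rV[R]_n.+1 := \row_j P j (chart_map z q).
have XJ i a : (dvect z i q *m J^T) 0 a = pd i (fun y => chart_map c (chart_inv z y) 0 a) (chart_map z q).
  rewrite -(pairing_dcoord a i hz hc zq cq) pairing_sum mxE.
  by apply: eq_bigr => k _; rewrite !mxE mulrC.
have E : s *: (dvect z ord_max q *m J^T) = p' *m J *m gs q *m J^T.
  rewrite -!mulmxA (mulmxA J) -dual_gramE; apply/rowP => a.
  rewrite mxE XJ vel mxE; apply: eq_bigr => j _.
  rewrite [p' _ _]mxE mulrC; congr (_ * _).
  by have /matrixP/(_ a j) := gram_sym hM hc cq nDq; rewrite mxE.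
(* The velocity equation with the index lowered by [g = (gs)^-1]: [s g(d_s, .) = p]. Pairing it with
   the coordinate vectors of [z] gives both claims. *)
have E2 : s *: (dvect z ord_max q *m g q) = p' *m J.
  have : s *: dvect z ord_max q = p' *m J *m gs q.
    by apply: (can_inj (mulmxK uJ)); rewrite -scalemxAl.
  by move=> /(congr1 (mulmx^~ (g q))); rewrite SE mulmxKV // scalemxAl.
have B i : s * bil (g q) (dvect z ord_max q) (dvect z i q) =
    \sum_a P a (chart_map z q) * pd i (fun y => chart_map c (chart_inv z y) 0 a) (chart_map z q).
  transitivity ((s *: (dvect z ord_max q *m g q) *m (dvect z i q)^T) 0 0).
    by rewrite -scalemxAl mxE.
  rewrite E2 -mulmxA -[J *m _]trmxK trmx_mul trmxK mxE; apply: eq_bigr => a _.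
  by rewrite [p' _ _]mxE [X in _ * X]mxE XJ.
split=> [i il||]; [|exact: s0|].
  by rewrite (RL_g_sym hM nDq); apply: (mulfI s0); rewrite mulr0 B mt.
by apply: (mulfI s0); rewrite B mv mulrA mulr1 mulfV.
Qed.
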